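(* Assume that $n$ is even and put $r=n/2$. The irreducible component $X_{\mu^*}^{\mathbf{b}_r,x_0}(\tau_r^* )$ is parametrized by the modifications $\mathcal{E}\dashrightarrow\mathcal{E}^0$ bounded by $\nu_r^*$ such that $\varpi\mathcal{E}\subset\mathrm{F}(\mathcal{E}^\vee)$. In particular, it is isomorphic to $X_{I_n^{r-1}}([1])^{\mathrm{pf}}$.
   Context: $(\cdot)^{\mathrm{pf}}$ denotes perfection. $F$ is a non-archimedean local field with ring of integers $\mathcal{O}_F$, uniformizer $\varpi$, residue field $k=\mathbb{F}_q$. For a perfect $k$-algebra $R$ put $W_{\mathcal{O}_F}(R)=\varprojlim_m W(R)\otimes_{W(k)}\mathcal{O}_F/\varpi^m$, $D_R=\mathrm{Spec}\,W_{\mathcal{O}_F}(R)$, $D_R^*=\mathrm{Spec}\,W_{\mathcal{O}_F}(R)[1/\varpi]$; $\sigma$ is the $q$-Frobenius. For a reductive $G/\mathcal{O}_F$: $\mathrm{L}^+G(R)=G(W_{\mathcal{O}_F}(R))$, $\mathrm{L}G(R)=G(W_{\mathcal{O}_F}(R)[1/\varpi])$, $\mathrm{Gr}=\mathrm{L}G/\mathrm{L}^+G$ (base changed to $\overline{k}$), which parametrizes $G$-torsors $\mathcal{E}$ on $D_R$ with an isomorphism over $D_R^*$ with the trivial torsor $\mathcal{E}^0$, written as a modification $\mathcal{E}\dashrightarrow\mathcal{E}^0$. For a dominant cocharacter $\lambda$, $\mathrm{Gr}_\lambda$ (resp. $\mathring{\mathrm{Gr}}_\lambda$) is the locus of modifications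 of relative position $\preceq\lambda$ (''bounded by $\lambda$'') (resp. equal to $\lambda$, i.e. the $\mathrm{L}^+G$-orbit of $\varpi^\lambda=\lambda(\varpi)$). $F_2/F$ is the unramified quadratic extension, $\Lambda=\mathcal{O}_{F_2}^n$ with hermitian form $(a,a')\mapsto\sum_i\sigma(a_i)a'_{n+1-i}$, $G=\mathrm{GU}(\Lambda)$, with $G_{\mathcal{O}_{F_2}}\simeq\mathrm{GL}_n\times\mathbb{G}_m$ by projection to the first factor of $\mathcal{O}_{F_2}\otimes\mathcal{O}_{F_2}\simeq\mathcal{O}_{F_2}\times\mathcal{O}_{F_2}$, $a\otimes b\mapsto(ab,a\sigma(b))$. Cocharacters are written $\sum_{i=0}^n m_i\varepsilon_i$ ($\varepsilon_0$ for $\mathbb{G}_m$, $\varepsilon_1,\dots,\varepsilon_n$ the standard basis for $\mathrm{GL}_n$); $(\sum m_i\varepsilon_i)^*=-m_0\varepsilon_0-\sum_{i\geq1}m_{n+1-i}\varepsilon_i$. Put $\mu=\varepsilon_0+\varepsilon_1+\varepsilon_2$, $\nu_r=\varepsilon_1+\cdots+\varepsilon_{r-1}$, $\tau_r=\varepsilon_0+\varepsilon_1+\cdots+\varepsilon_n$, $X_{\mu^*}(\tau_r^* )=\{g\,\mathrm{L}^+G\in\mathrm{Gr}: g^{-1}\varpi^{\tau_r^*}\sigma(g)\in\overline{\mathrm{L}^+G\varpi^{\mu^*}\mathrm{L}^+G}\}$. Let $\mathrm{Gr}_{(\nu_r^*,\mu^* )}$ parametrize $\mathcal{E}_2\dashrightarrow\mathcal{E}_1\dashrightarrow\mathcal{E}^0$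 with $\mathcal{E}_1\dashrightarrow\mathcal{E}^0$ bounded by $\nu_r^*$ and $\mathcal{E}_2\dashrightarrow\mathcal{E}_1$ bounded by $\mu^*$; it maps to $\mathrm{Gr}$ by composition. Put $\mathrm{Gr}^0_{(\nu_r^*,\mu^* )|\nu_r+\tau_r^*}=\mathrm{Gr}_{(\nu_r^*,\mu^* )}\times_{\mathrm{Gr}}\mathrm{Gr}_{\nu_r+\tau_r^*}$, with open subscheme $\mathring{\mathrm{Gr}}^0$ where all bounds are equalities. It has a unique irreducible component $\mathrm{Gr}^{0,\mathbf{a}_r}$ of dimension $\langle\rho,\nu_r^*+\mu^*+\nu_r+\tau_r^*\rangle$ ($\rho$ the half sum of positive roots); $\mathring{\mathrm{Gr}}^{0,\mathbf{a}_r}=\mathrm{Gr}^{0,\mathbf{a}_r}\cap\mathring{\mathrm{Gr}}^0$. $\mathring{X}_{\mu^*}^{\mathbf{b}_r,x_0}(\tau_r^* )$ is the fiber product of $1\times\varpi^{\tau_r^*}\sigma:\mathring{\mathrm{Gr}}_{\nu_r^*}\to\mathring{\mathrm{Gr}}_{\nu_r^*}\times\mathring{\mathrm{Gr}}_{\nu_r+\tau_r^*}$ and $\mathrm{pr}_1\times m:\mathring{\mathrm{Gr}}^{0,\mathbf{a}_r}\to\mathring{\mathrm{Gr}}_{\nu_r^*}\times\mathring{\mathrm{Gr}}_{\nu_r+\tau_r^*}$ ($\mathrm{pr}_1$ remembers $\mathcal{E}_1$, $m$ is the composition), and $X_{\mu^*}^{\mathbf{b}_r,x_0}(\tau_r^*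 )$ is its closure in $X_{\mu^*}(\tau_r^* )$. Lattice notation: for $\lambda$ trivial on $\mathbb{G}_m$, $\mathrm{Gr}_\lambda\subset\mathrm{Gr}_{\mathrm{GL}_n}$, so its points are rank $n$ vector bundles $\mathcal{E}$ on $D_R$ with a modification to $\mathcal{E}^0=\mathcal{O}_{F_2}^n$, i.e. lattices in $\mathcal{E}^0[1/\varpi]$ (position $\sum m_i\varepsilon_i$ means that $\varpi^{m_1}e_1,\dots,\varpi^{m_n}e_n$ is a basis of $\mathcal{E}$ for some basis $e_j$ of $\mathcal{E}^0$). $\mathrm{F}$ is Frobenius pullback; the hermitian form gives $\mathcal{E}^0\simeq\mathrm{F}((\mathcal{E}^0)^\vee)$, so $\mathrm{F}(\mathcal{E}^\vee)$ is a lattice in $\mathcal{E}^0[1/\varpi]$. Deligne–Lusztig variety: let $\mathbf{V}_0=\mathbb{F}_{q^2}^n$ with hermitian form $\sum a_i^qa'_{n+1-i}$, $\mathbf{G}=\mathrm{GU}(\mathbf{V}_0)_{\overline{\mathbb{F}}_q}\simeq\mathrm{GL}_n\times\mathbb{G}_m$ with Frobenius $\mathrm{F}$, and $(W,S=\{s_1,\dots,s_{n-1}\})$ its Coxeter system. For $I\subset S$, $X_I([1])$ is the scheme of parabolic subgroups $\mathbf{P}$ of type $I$ such that the relative position of $(\mathbf{P},\mathrm{F}(\mathbf{P}))$ is the class of $1$ in $W_I\backslash W/W_{\mathrm{F}(I)}$. $I_n^{m}=S\setminus\{s_m\}$ (and $I_n^0=S$); concretely, for $m\le n/2$, $X_{I_n^m}([1])$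 parametrizes $m$-dimensional subspaces $U\subset\overline{\mathbb{F}}_q^n$ with $U\subset\mathrm{F}(U^\perp)$, where $\perp$ is for the bilinear form $\sum x_iy_{n+1-i}$ and $\mathrm{F}$ is the coordinatewise $q$-Frobenius. *)

(* Defs.v *)
From HB Require Import structures.
From mathcomp Require Import all_boot all_order all_algebra.
From mathcomp Require Import all_fingroup all_solvable all_field.
From mathcomp Require Import boolp classical_sets.
From mathcomp Require mpoly.
From mathcomp Require Import zify.

Set Implicit Arguments.
Unset Strict Implicit.
Unset Printing Implicit Defensive.

Import GRing.Theory.
Local Open Scope ring_scope.
#[local] Obligation Tactic := idtac.

Record preRing := PreRing {
  pr_sort :> Type;
  pr_eq : pr_sort -> pr_sort -> Prop;
  pr_zero : pr_sort;
  pr_one : pr_sort;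
  pr_opp : pr_sort -> pr_sort;
  pr_add : pr_sort -> pr_sort -> pr_sort;
  pr_mul : pr_sort -> pr_sort -> pr_sort;
  pr_refl : forall x, pr_eq x x;
  pr_sym : forall x y, pr_eq x y -> pr_eq y x;
  pr_trans : forall y x z, pr_eq x y -> pr_eq y z -> pr_eq x z;
  pr_oppP : forall x x', pr_eq x x' -> pr_eq (pr_opp x) (pr_opp x');
  pr_addP : forall x x' y y', pr_eq x x' -> pr_eq y y' ->
    pr_eq (pr_add x y) (pr_add x' y');
  pr_mulP : forall x x' y y', pr_eq x x' -> pr_eq y y' ->
    pr_eq (pr_mul x y) (pr_mul x' y');
  pr_addA : forall x y z, pr_eq (pr_add x (pr_add y z)) (pr_add (pr_add x y) z);
  pr_addC : forall x y, pr_eq (pr_add x y) (pr_add y x);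
  pr_add0 : forall x, pr_eq (pr_add pr_zero x) x;
  pr_addN : forall x, pr_eq (pr_add (pr_opp x) x) pr_zero;
  pr_mulA : forall x y z, pr_eq (pr_mul x (pr_mul y z)) (pr_mul (pr_mul x y) z);
  pr_mulC : forall x y, pr_eq (pr_mul x y) (pr_mul y x);
  pr_mul1 : forall x, pr_eq (pr_mul pr_one x) x;
  pr_mulD : forall x y z,
    pr_eq (pr_mul (pr_add x y) z) (pr_add (pr_mul x z) (pr_mul y z)) }.

Record quot (P : preRing) :=
  Quot { qcls : set P; qclsP : exists x, qcls = pr_eq x }.

Section QuotTheory.
Variable P : preRing.

Definition qpi (x : P) : quot P := Quot (ex_intro (fun y => _ = pr_eq y) x erefl).

Lemma quot_inj (a b : quot P) : qcls a = qcls b -> a = b.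
Proof.
case: a b => [c hc] [d hd] /= e; subst d.
by rewrite (Prop_irrelevance hc hd).
Qed.

Lemma qpiP (x y : P) : qpi x = qpi y <-> pr_eq x y.
Proof.
split=> [e|h].
  have : qcls (qpi x) y by rewrite e; exact: pr_refl.
  by [].
apply: quot_inj; apply/seteqP; split=> z /= hz.
- exact: pr_trans (pr_sym h) hz.
- exact: pr_trans h hz.
Qed.

Definition qrepr (a : quot P) : P := sval (cid (qclsP a)).

Lemma qreprK : cancel qrepr qpi.
Proof.
move=> a; apply: quot_inj => /=.
by rewrite /qrepr; case: cid => x /= ->.
Qed.

Lemma qpiK (x : P) : pr_eq (qrepr (qpi x)) x.
Proof. by apply/qpiP; rewrite qreprK. Qed.

Lemma quotW (Q : quot P -> Prop) : (forall x, Q (qpi x)) -> forall a, Q a.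
Proof. by move=> h a; rewrite -(qreprK a). Qed.

HB.instance Definition _ := gen_eqMixin (quot P).
HB.instance Definition _ := gen_choiceMixin (quot P).

Definition qadd (a b : quot P) := qpi (pr_add (qrepr a) (qrepr b)).
Definition qopp (a : quot P) := qpi (pr_opp (qrepr a)).
Definition qmul (a b : quot P) := qpi (pr_mul (qrepr a) (qrepr b)).

Lemma qaddE x y : qadd (qpi x) (qpi y) = qpi (pr_add x y).
Proof. by apply/qpiP; apply: pr_addP; exact: qpiK. Qed.
Lemma qoppE x : qopp (qpi x) = qpi (pr_opp x).
Proof. by apply/qpiP; apply: pr_oppP; exact: qpiK. Qed.
Lemma qmulE x y : qmul (qpi x) (qpi y) = qpi (pr_mul x y).
Proof. by apply/qpiP; apply: pr_mulP; exact: qpiK. Qed.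

Fact qaddA : associative qadd.
Proof.
elim/quotW=> x; elim/quotW=> y; elim/quotW=> z.
by rewrite !qaddE; apply/qpiP; exact: pr_addA.
Qed.
Fact qaddC : commutative qadd.
Proof.
elim/quotW=> x; elim/quotW=> y.
by rewrite !qaddE; apply/qpiP; exact: pr_addC.
Qed.
Fact qadd0 : left_id (qpi (pr_zero P)) qadd.
Proof. by elim/quotW=> x; rewrite qaddE; apply/qpiP; exact: pr_add0. Qed.
Fact qaddN : left_inverse (qpi (pr_zero P)) qopp qadd.
Proof. by elim/quotW=> x; rewrite qoppE qaddE; apply/qpiP; exact: pr_addN. Qed.

HB.instance Definition _ :=
  GRing.isZmodule.Build (quot P) qaddA qaddC qadd0 qaddN.

Fact qmulA : associative qmul.
Proof.
elim/quotW=> x; elim/quotW=> y; elim/quotW=> z.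
by rewrite !qmulE; apply/qpiP; exact: pr_mulA.
Qed.
Fact qmulC : commutative qmul.
Proof.
elim/quotW=> x; elim/quotW=> y.
by rewrite !qmulE; apply/qpiP; exact: pr_mulC.
Qed.
Fact qmul1 : left_id (qpi (pr_one P)) qmul.
Proof. by elim/quotW=> x; rewrite qmulE; apply/qpiP; exact: pr_mul1. Qed.
Fact qmulD : left_distributive qmul qadd.
Proof.
elim/quotW=> x; elim/quotW=> y; elim/quotW=> z.
by rewrite qaddE !qmulE qaddE; apply/qpiP; exact: pr_mulD.
Qed.

HB.instance Definition _ :=
  GRing.Zmodule_isComPzRing.Build (quot P) qmulA qmulC qmul1 qmulD.

Lemma qpiD x y : qpi x + qpi y = qpi (pr_add x y).
Proof. exact: qaddE. Qed.
Lemma qpiN x : - qpi x = qpi (pr_opp x).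
Proof. exact: qoppE. Qed.
Lemma qpiM x y : qpi x * qpi y = qpi (pr_mul x y).
Proof. exact: qmulE. Qed.
Lemma qpi1 : qpi (pr_one P) = 1.
Proof. by []. Qed.
Lemma qpi0 : qpi (pr_zero P) = 0.
Proof. by []. Qed.

End QuotTheory.

Lemma rmorph_build (R S : pzRingType) (f : R -> S) :
  {morph f : x y / x + y} -> {morph f : x y / x * y} -> f 1 = 1 ->
  zmod_morphism f /\ monoid_morphism f.
Proof.
move=> fD fM f1.
have f0 : f 0 = 0 by apply: (addrI (f 0)); rewrite -fD !addr0.
split; last by split.
move=> x y; rewrite fD; congr (_ + _).
by apply: (addrI (f y)); rewrite -fD !subrr.
Qed.

Section QuotientByElement.
Variables (R : comPzRingType) (a : R).

Definition modeq (x y : R) := exists z, x - y = a * z.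

Lemma modeq_of x y : x = y -> modeq x y.
Proof. by move=> ->; exists 0; rewrite subrr mulr0. Qed.

Program Definition modpre : preRing := @PreRing R modeq 0 1 -%R +%R *%R
  _ _ _ _ _ _ _ _ _ _ _ _ _ _.
Next Obligation. by move=> x; exact: modeq_of. Qed.
Next Obligation. by move=> x y [z h]; exists (- z); rewrite mulrN -h opprB. Qed.
Next Obligation.
move=> y x z [u hu] [v hv]; exists (u + v).
by rewrite mulrDr -hu -hv addrA subrK.
Qed.
Next Obligation. by move=> x y [z h]; exists (- z); rewrite mulrN -h opprD. Qed.
Next Obligation.
move=> x x' y y' [u hu] [v hv]; exists (u + v).
by rewrite mulrDr -hu -hv opprD addrACA.
Qed.
Next Obligation.
move=> x x' y y' [u hu] [v hv]; exists (u * y + x' * v).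
rewrite mulrDr mulrA -hu mulrCA -hv mulrBl mulrBr.
by rewrite addrA subrK.
Qed.
Next Obligation. by move=> *; apply: modeq_of; rewrite addrA. Qed.
Next Obligation. by move=> *; apply: modeq_of; rewrite addrC. Qed.
Next Obligation. by move=> *; apply: modeq_of; rewrite add0r. Qed.
Next Obligation. by move=> *; apply: modeq_of; rewrite addNr. Qed.
Next Obligation. by move=> *; apply: modeq_of; rewrite mulrA. Qed.
Next Obligation. by move=> *; apply: modeq_of; rewrite mulrC. Qed.
Next Obligation. by move=> *; apply: modeq_of; rewrite mul1r. Qed.
Next Obligation. by move=> *; apply: modeq_of; rewrite mulrDl. Qed.

Definition modring := quot modpre.
HB.instance Definition _ := GRing.ComPzRing.on modring.

Definition modpi (x : R) : modring := qpi (x : modpre).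

Fact modpi_rmorph : zmod_morphism modpi /\ monoid_morphism modpi.
Proof. by apply: rmorph_build => [x y|x y|] //; rewrite ?qpiD ?qpiM. Qed.
HB.instance Definition _ :=
  GRing.isZmodMorphism.Build R modring modpi modpi_rmorph.1.
HB.instance Definition _ :=
  GRing.isMonoidMorphism.Build R modring modpi modpi_rmorph.2.

Lemma modpiP x y : modpi x = modpi y <-> exists z, x - y = a * z.
Proof. exact: (qpiP (x : modpre)). Qed.
End QuotientByElement.

Section ModProj.
Variables (R : comPzRingType) (a b : R).
Implicit Type hab : exists c, b = a * c.

Definition modproj hab (x : modring b) : modring a := modpi a (qrepr x).

Lemma modprojE hab x : modproj hab (modpi b x) = modpi a x.
Proof.
case: (hab) => c hc; apply/modpiP.
have [z hz] := qpiK (x : modpre b).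
by exists (c * z); rewrite hz hc mulrA.
Qed.

Fact modproj_rmorph hab : zmod_morphism (modproj hab) /\ monoid_morphism (modproj hab).
Proof.
apply: rmorph_build => [||].
- elim/quotW=> x; elim/quotW=> y.
  rewrite -[qpi x]/(modpi _ x) -[qpi y]/(modpi _ y).
  by rewrite -rmorphD !modprojE rmorphD.
- elim/quotW=> x; elim/quotW=> y.
  rewrite -[qpi x]/(modpi _ x) -[qpi y]/(modpi _ y).
  by rewrite -rmorphM !modprojE rmorphM.
- by rewrite -[1](rmorph1 (modpi b)) modprojE rmorph1.
Qed.
HB.instance Definition _ hab := GRing.isZmodMorphism.Build
  (modring b) (modring a) (modproj hab) (modproj_rmorph hab).1.
HB.instance Definition _ hab := GRing.isMonoidMorphism.Build
  (modring b) (modring a) (modproj hab) (modproj_rmorph hab).2.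
End ModProj.

(* A formal sum of pure tensors is identified with another one when every
   balanced biadditive map to an abelian group takes the same value on both. *)
Section Tensor.
Variables (A B C : comPzRingType).
Variables (f : {rmorphism A -> B}) (g : {rmorphism A -> C}).

Definition balanced (M : zmodType) (phi : B -> C -> M) :=
  [/\ forall b b' c, phi (b + b') c = phi b c + phi b' c,
      forall b c c', phi b (c + c') = phi b c + phi b c' &
      forall a b c, phi (b * f a) c = phi b (g a * c)].

Definition tsum (M : zmodType) (phi : B -> C -> M) (s : seq (B * C)) : M :=
  \sum_(t <- s) phi t.1 t.2.

Definition teq (s t : seq (B * C)) :=
  forall (M : zmodType) (phi : B -> C -> M), balanced phi ->
    tsum phi s = tsum phi t.

Definition topp (s : seq (B * C)) := [seq (- t.1, t.2) | t <- s].
Definition tmul (s t : seq (B * C)) :=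
  [seq (x.1 * y.1, x.2 * y.2) | x <- s, y <- t].

Lemma tsum_cat (M : zmodType) (phi : B -> C -> M) s t :
  tsum phi (s ++ t) = tsum phi s + tsum phi t.
Proof. exact: big_cat. Qed.

Lemma balN (M : zmodType) (phi : B -> C -> M) : balanced phi ->
  forall b c, phi (- b) c = - phi b c.
Proof.
move=> [hl _ _] b c.
have h0 : phi 0 c = 0 by apply: (addrI (phi 0 c)); rewrite -hl !addr0.
by apply: (addrI (phi b c)); rewrite -hl !subrr.
Qed.

Lemma tsum_opp (M : zmodType) (phi : B -> C -> M) s : balanced phi ->
  tsum phi (topp s) = - tsum phi s.
Proof.
move=> hb; rewrite /tsum /topp big_map -sumrN.
by apply: eq_bigr => t _; rewrite (balN hb).
Qed.

Lemma tsum_mul (M : zmodType) (phi : B -> C -> M) s t :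
  tsum phi (tmul s t) =
  \sum_(x <- s) \sum_(y <- t) phi (x.1 * y.1) (x.2 * y.2).
Proof. by rewrite /tsum /tmul big_allpairs_dep. Qed.

Lemma bal_mull (M : zmodType) (phi : B -> C -> M) (t : seq (B * C)) :
  balanced phi ->
  balanced (fun b c => \sum_(y <- t) phi (b * y.1) (c * y.2)).
Proof.
move=> [h1 h2 h3]; split=> [b b' c|b c c'|a b c].
- by rewrite -big_split; apply: eq_bigr => y _; rewrite mulrDl h1.
- by rewrite -big_split; apply: eq_bigr => y _; rewrite mulrDl h2.
- by apply: eq_bigr => y _; rewrite mulrAC h3 mulrA.
Qed.

Lemma tsum_mulC (M : zmodType) (phi : B -> C -> M) s t :
  tsum phi (tmul s t) = tsum phi (tmul t s).
Proof.
rewrite !tsum_mul exchange_big; apply: eq_bigr => y _.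
by apply: eq_bigr => x _; rewrite mulrC [x.2 * _]mulrC.
Qed.

Lemma teq_mull s s' t : teq s s' -> teq (tmul s t) (tmul s' t).
Proof.
move=> h M phi hb; rewrite !tsum_mul.
exact: (h M _ (bal_mull t hb)).
Qed.

Program Definition tpre : preRing := @PreRing (seq (B * C)) teq
  [::] [:: (1, 1)] topp cat tmul _ _ _ _ _ _ _ _ _ _ _ _ _ _.
Next Obligation. by []. Qed.
Next Obligation. by move=> x y h M phi hb; rewrite h. Qed.
Next Obligation. by move=> y x z h h' M phi hb; rewrite h // h'. Qed.
Next Obligation. by move=> x y h M phi hb; rewrite !tsum_opp // h. Qed.
Next Obligation. by move=> x x' y y' h h' M phi hb; rewrite !tsum_cat h // h'. Qed.
Next Obligation.
move=> x x' y y' h h' M phi hb.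
by rewrite (teq_mull y h hb) tsum_mulC (teq_mull x' h' hb) tsum_mulC.
Qed.
Next Obligation. by move=> x y z M phi hb; rewrite !tsum_cat addrA. Qed.
Next Obligation. by move=> x y M phi hb; rewrite !tsum_cat addrC. Qed.
Next Obligation. by []. Qed.
Next Obligation.
by move=> x M phi hb; rewrite tsum_cat tsum_opp // addNr /tsum big_nil.
Qed.
Next Obligation.
move=> x y z M phi hb; rewrite !tsum_mul /tmul big_allpairs_dep.
apply: eq_bigr => u _; rewrite big_allpairs_dep; apply: eq_bigr => v _.
by apply: eq_bigr => w _; rewrite !mulrA.
Qed.
Next Obligation. by move=> x y M phi hb; rewrite tsum_mulC. Qed.
Next Obligation.
move=> x M phi hb; rewrite tsum_mul big_seq1.
by apply: eq_bigr => u _; rewrite !mul1r.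
Qed.
Next Obligation. by move=> x y z M phi hb; rewrite tsum_cat !tsum_mul big_cat. Qed.

Definition tensor := quot tpre.
HB.instance Definition _ := GRing.ComPzRing.on tensor.

Definition tpure (b : B) (c : C) : tensor := qpi ([:: (b, c)] : tpre).
Definition tinr (c : C) : tensor := tpure 1 c.

Fact tinr_rmorph : zmod_morphism tinr /\ monoid_morphism tinr.
Proof.
apply: rmorph_build => // x y; rewrite /tinr /tpure ?qpiD ?qpiM; apply/qpiP.
- by move=> M phi [_ h _]; rewrite tsum_cat /tsum !big_seq1 h.
- by move=> M phi _; rewrite tsum_mul /tsum !big_seq1 /= mul1r.
Qed.
HB.instance Definition _ := GRing.isZmodMorphism.Build C tensor tinr tinr_rmorph.1.
HB.instance Definition _ := GRing.isMonoidMorphism.Build C tensor tinr tinr_rmorph.2.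
End Tensor.

Section TensorMap.
Variables (A B C B' C' : comPzRingType).
Variables (f : {rmorphism A -> B}) (g : {rmorphism A -> C}).
Variables (f' : {rmorphism A -> B'}) (g' : {rmorphism A -> C'}).
Variables (h : {rmorphism B -> B'}) (l : {rmorphism C -> C'}).
Implicit Types (hf : forall a, h (f a) = f' a) (lg : forall a, l (g a) = g' a).

Definition tpremap (s : seq (B * C)) : seq (B' * C') :=
  [seq (h t.1, l t.2) | t <- s].

Definition tmap hf lg (x : tensor f g) : tensor f' g' :=
  qpi (tpremap (qrepr x) : tpre f' g').

Lemma tmapE hf lg (s : tpre f g) : tmap hf lg (qpi s) = qpi (tpremap s : tpre f' g').
Proof.
apply/qpiP => M phi [h1 h2 h3]; rewrite /tsum !big_map.
have := @qpiK (tpre f g) s M (fun b c => phi (h b) (l c)); apply.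
split=> [b b' c|b c c'|a b c]; rewrite ?rmorphD ?rmorphM ?h1 ?h2 //.
by rewrite hf lg h3.
Qed.

Fact tmap_rmorph hf lg : zmod_morphism (tmap hf lg) /\ monoid_morphism (tmap hf lg).
Proof.
apply: rmorph_build => [||].
- elim/quotW=> x; elim/quotW=> y.
  by rewrite qpiD !tmapE qpiD /= /tpremap map_cat.
- elim/quotW=> x; elim/quotW=> y; rewrite qpiM !tmapE qpiM; congr qpi.
  rewrite /= /tmul /tpremap map_allpairs allpairs_mapl allpairs_mapr.
  by apply: eq_allpairs => u v /=; rewrite !rmorphM.
- by rewrite -qpi1 tmapE /= /tpremap /= !rmorph1.
Qed.
HB.instance Definition _ hf lg := GRing.isZmodMorphism.Build
  (tensor f g) (tensor f' g') (tmap hf lg) (tmap_rmorph hf lg).1.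
HB.instance Definition _ hf lg := GRing.isMonoidMorphism.Build
  (tensor f g) (tensor f' g') (tmap hf lg) (tmap_rmorph hf lg).2.
End TensorMap.

Section InverseLimit.
Variables (X : nat -> comPzRingType) (t : forall m, {rmorphism X m.+1 -> X m}).

Record invlim :=
  InvLim { il_proj : forall m, X m; il_coh : forall m, t m (il_proj m.+1) = il_proj m }.

Lemma invlim_inj (x y : invlim) : (forall m, il_proj x m = il_proj y m) -> x = y.
Proof.
case: x y => [x hx] [y hy] /= e.
have {e} e : x = y by apply: functional_extensionality_dep.
by subst y; rewrite (Prop_irrelevance hx hy).
Qed.

HB.instance Definition _ := gen_eqMixin invlim.
HB.instance Definition _ := gen_choiceMixin invlim.

Program Definition il_zero := @InvLim (fun=> 0) _.
Next Obligation. by move=> m; rewrite rmorph0. Qed.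
Program Definition il_one := @InvLim (fun=> 1) _.
Next Obligation. by move=> m; rewrite rmorph1. Qed.
Program Definition il_opp (x : invlim) := @InvLim (fun m => - il_proj x m) _.
Next Obligation. by move=> x m; rewrite rmorphN il_coh. Qed.
Program Definition il_add (x y : invlim) :=
  @InvLim (fun m => il_proj x m + il_proj y m) _.
Next Obligation. by move=> x y m; rewrite rmorphD !il_coh. Qed.
Program Definition il_mul (x y : invlim) :=
  @InvLim (fun m => il_proj x m * il_proj y m) _.
Next Obligation. by move=> x y m; rewrite rmorphM !il_coh. Qed.

Fact il_addA : associative il_add.
Proof. by move=> x y z; apply: invlim_inj => m /=; rewrite addrA. Qed.
Fact il_addC : commutative il_add.
Proof. by move=> x y; apply: invlim_inj => m /=; rewrite addrC. Qed.
Fact il_add0 : left_id il_zero il_add.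
Proof. by move=> x; apply: invlim_inj => m /=; rewrite add0r. Qed.
Fact il_addN : left_inverse il_zero il_opp il_add.
Proof. by move=> x; apply: invlim_inj => m /=; rewrite addNr. Qed.
HB.instance Definition _ :=
  GRing.isZmodule.Build invlim il_addA il_addC il_add0 il_addN.

Fact il_mulA : associative il_mul.
Proof. by move=> x y z; apply: invlim_inj => m /=; rewrite mulrA. Qed.
Fact il_mulC : commutative il_mul.
Proof. by move=> x y; apply: invlim_inj => m /=; rewrite mulrC. Qed.
Fact il_mul1 : left_id il_one il_mul.
Proof. by move=> x; apply: invlim_inj => m /=; rewrite mul1r. Qed.
Fact il_mulD : left_distributive il_mul il_add.
Proof. by move=> x y z; apply: invlim_inj => m /=; rewrite mulrDl. Qed.
HB.instance Definition _ :=
  GRing.Zmodule_isComPzRing.Build invlim il_mulA il_mulC il_mul1 il_mulD.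
End InverseLimit.

Section InverseLimitMap.
Variables (X : nat -> comPzRingType) (t : forall m, {rmorphism X m.+1 -> X m}).
Variables (Y : nat -> comPzRingType) (u : forall m, {rmorphism Y m.+1 -> Y m}).
Variables (h : forall m, {rmorphism X m -> Y m}).
Hypothesis ht : forall m x, u m (h m.+1 x) = h m (t m x).

Program Definition il_map (x : invlim t) : invlim u :=
  @InvLim _ u (fun m => h m (il_proj x m)) _.
Next Obligation. by move=> x m; rewrite ht il_coh. Qed.

Fact il_map_rmorph : zmod_morphism il_map /\ monoid_morphism il_map.
Proof.
by apply: rmorph_build => [x y|x y|]; apply: invlim_inj => m /=;
  rewrite ?rmorphD ?rmorphM ?rmorph1.
Qed.
HB.instance Definition _ :=
  GRing.isZmodMorphism.Build (invlim t) (invlim u) il_map il_map_rmorph.1.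
HB.instance Definition _ :=
  GRing.isMonoidMorphism.Build (invlim t) (invlim u) il_map il_map_rmorph.2.
End InverseLimitMap.

Section Localization.
Variables (R : comPzRingType) (a : R).

(* [(x, i)] stands for [x / a ^ i] *)
Definition loceq (x y : R * nat) :=
  exists N, a ^+ (N + y.2) * x.1 = a ^+ (N + x.2) * y.1.

Lemma loceq_of (x y : R * nat) : a ^+ y.2 * x.1 = a ^+ x.2 * y.1 -> loceq x y.
Proof. by move=> h; exists 0%N; rewrite !add0n. Qed.

Program Definition locpre : preRing := @PreRing (R * nat)%type loceq
  (0, 0%N) (1, 0%N) (fun x => (- x.1, x.2))
  (fun x y => (a ^+ y.2 * x.1 + a ^+ x.2 * y.1, (x.2 + y.2)%N))
  (fun x y => (x.1 * y.1, (x.2 + y.2)%N)) _ _ _ _ _ _ _ _ _ _ _ _ _ _.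
Next Obligation. by move=> x; exact: loceq_of. Qed.
Next Obligation. by move=> x y [N h]; exists N. Qed.
Next Obligation.
move=> [y j] [x i] [z k] [N /= h] [N' /= h']; exists (N + N' + j)%N => /=.
have e1 : (N + N' + j + k = N' + k + (N + j))%N by lia.
have e2 : (N + N' + j + i = N + i + (N' + j))%N by lia.
by rewrite e1 e2 exprD -mulrA h mulrCA h' mulrA -exprD.
Qed.
Next Obligation. by move=> x y [N h]; exists N; rewrite /= !mulrN h. Qed.
Next Obligation.
move=> [x i] [x' i'] [y j] [y' j'] [N /= h] [N' /= h']; exists (N + N')%N => /=.
rewrite !mulrDr !mulrA -!exprD; congr (_ + _).
  have -> : (N + N' + (i' + j') + j = N' + j' + j + (N + i'))%N by lia.
  have -> : (N + N' + (i + j) + j' = N' + j' + j + (N + i))%N by lia.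
  by rewrite exprD -mulrA h mulrA -exprD.
have -> : (N + N' + (i' + j') + i = N + i' + i + (N' + j'))%N by lia.
have -> : (N + N' + (i + j) + i' = N + i' + i + (N' + j))%N by lia.
by rewrite exprD -mulrA h' mulrA -exprD.
Qed.
Next Obligation.
move=> [x i] [x' i'] [y j] [y' j'] [N /= h] [N' /= h']; exists (N + N')%N => /=.
have -> : (N + N' + (i' + j') = N + i' + (N' + j'))%N by lia.
have -> : (N + N' + (i + j) = N + i + (N' + j))%N by lia.
by rewrite !exprD mulrACA -!exprD h h' mulrACA !exprD.
Qed.
Next Obligation.
move=> [x i] [y j] [z k]; apply: loceq_of => /=; congr (_ * _).
  by rewrite addnA.
rewrite !mulrDr !mulrA -!exprD addrA.
by congr (_ * _ + _ * _ + _ * _); congr (_ ^+ _); lia.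
Qed.
Next Obligation.
move=> [x i] [y j]; apply: loceq_of => /=.
by rewrite addnC addrC.
Qed.
Next Obligation.
by move=> [x i]; apply: loceq_of; rewrite /= mulr0 add0r add0n expr0 mul1r.
Qed.
Next Obligation.
by move=> [x i]; apply: loceq_of; rewrite /= !mulrN addNr !mulr0.
Qed.
Next Obligation.
by move=> [x i] [y j] [z k]; apply: loceq_of; congr (_ * _) => /=; rewrite ?mulrA ?addnA.
Qed.
Next Obligation. by move=> [x i] [y j]; apply: loceq_of; congr (_ * _) => /=; rewrite ?[(i + j)%N]addnC ?[x * y]mulrC. Qed.
Next Obligation. by move=> [x i]; apply: loceq_of; rewrite /= mul1r add0n. Qed.
Next Obligation.
move=> [x i] [y j] [z k]; apply: loceq_of => /=.
rewrite mulrDl !mulrDr !mulrA -!exprD; congr (_ * _ * _ + _ * _ * _);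
  congr (_ ^+ _); lia.
Qed.

Definition loc := quot locpre.
HB.instance Definition _ := GRing.ComPzRing.on loc.

Definition locfrac (x : R) (i : nat) : loc := qpi ((x, i) : locpre).
Definition locin (x : R) : loc := locfrac x 0.

Lemma locfracP x i y j : locfrac x i = locfrac y j <-> loceq (x, i) (y, j).
Proof. exact: (qpiP ((x, i) : locpre)). Qed.

Fact locin_rmorph : zmod_morphism locin /\ monoid_morphism locin.
Proof.
apply: rmorph_build => // x y; rewrite /locin /locfrac ?qpiD ?qpiM //=.
by rewrite expr0 !mul1r.
Qed.
HB.instance Definition _ := GRing.isZmodMorphism.Build R loc locin locin_rmorph.1.
HB.instance Definition _ := GRing.isMonoidMorphism.Build R loc locin locin_rmorph.2.
End Localization.

Section LocalizationMap.
Variables (R S : comPzRingType) (a : R) (b : S) (h : {rmorphism R -> S}).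
Implicit Type ha : h a = b.

Definition locmap ha (x : loc a) : loc b :=
  locfrac b (h (qrepr x).1) (qrepr x).2.

Lemma locmapE ha x i : locmap ha (locfrac a x i) = locfrac b (h x) i.
Proof.
have := qpiK ((x, i) : locpre a).
rewrite /locmap /locfrac; case: (qrepr _) => y j [N /= e].
by apply/qpiP; exists N; rewrite /= -ha -!rmorphXn -!rmorphM e.
Qed.

Fact locmap_rmorph ha : zmod_morphism (locmap ha) /\ monoid_morphism (locmap ha).
Proof.
have hE x : locmap ha (qpi x) = qpi ((h x.1, x.2) : locpre b).
  by case: x => x i; exact: locmapE.
apply: rmorph_build => [||].
- elim/quotW=> x; elim/quotW=> y; rewrite qpiD !hE qpiD /=.
  by rewrite rmorphD !rmorphM !rmorphXn ha.
- by elim/quotW=> x; elim/quotW=> y; rewrite qpiM !hE qpiM /= rmorphM.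
- by rewrite -qpi1 hE /= rmorph1.
Qed.
HB.instance Definition _ ha :=
  GRing.isZmodMorphism.Build (loc a) (loc b) (locmap ha) (locmap_rmorph ha).1.
HB.instance Definition _ ha :=
  GRing.isMonoidMorphism.Build (loc a) (loc b) (locmap ha) (locmap_rmorph ha).2.
End LocalizationMap.

(* The free commutative ring on the variables [fvar i], in which the Witt
   polynomials are found: two expressions are equal when they take the same
   values in all commutative rings. *)
Inductive fexpr :=
  | FVar of nat | FZero | FOne
  | FOpp of fexpr | FAdd of fexpr & fexpr | FMul of fexpr & fexpr.

Fixpoint feval (C : comPzRingType) (v : nat -> C) (e : fexpr) : C :=
  match e with
  | FVar i => v i
  | FZero => 0
  | FOne => 1
  | FOpp e => - feval v e
  | FAdd e e' => feval v e + feval v e'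
  | FMul e e' => feval v e * feval v e'
  end.

Definition feq (e e' : fexpr) :=
  forall (C : comPzRingType) (v : nat -> C), feval v e = feval v e'.

Program Definition fpre : preRing := @PreRing fexpr feq FZero FOne FOpp FAdd FMul
  _ _ _ _ _ _ _ _ _ _ _ _ _ _.
Next Obligation. by []. Qed.
Next Obligation. by move=> x y h C v; rewrite h. Qed.
Next Obligation. by move=> y x z h h' C v; rewrite h. Qed.
Next Obligation. by move=> x x' h C v /=; rewrite h. Qed.
Next Obligation. by move=> x x' y y' h h' C v /=; rewrite h h'. Qed.
Next Obligation. by move=> x x' y y' h h' C v /=; rewrite h h'. Qed.
Next Obligation. by move=> x y z C v /=; rewrite addrA. Qed.
Next Obligation. by move=> x y C v /=; rewrite addrC. Qed.
Next Obligation. by move=> x C v /=; rewrite add0r. Qed.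
Next Obligation. by move=> x C v /=; rewrite addNr. Qed.
Next Obligation. by move=> x y z C v /=; rewrite mulrA. Qed.
Next Obligation. by move=> x y C v /=; rewrite mulrC. Qed.
Next Obligation. by move=> x C v /=; rewrite mul1r. Qed.
Next Obligation. by move=> x y z C v /=; rewrite mulrDl. Qed.

Definition fring := quot fpre.
HB.instance Definition _ := GRing.ComPzRing.on fring.

Definition fvar (i : nat) : fring := qpi (FVar i : fpre).

Section FreeRingEval.
Variables (C : comPzRingType) (v : nat -> C).

Definition fev (x : fring) : C := feval v (qrepr x).

Lemma fevE (e : fpre) : fev (qpi e) = feval v e.
Proof. exact: (qpiK e). Qed.

Fact fev_rmorph : zmod_morphism fev /\ monoid_morphism fev.
Proof.
apply: rmorph_build => [||]; last by rewrite -qpi1 fevE.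
- by elim/quotW=> x; elim/quotW=> y; rewrite qpiD !fevE.
- by elim/quotW=> x; elim/quotW=> y; rewrite qpiM !fevE.
Qed.
HB.instance Definition _ := GRing.isZmodMorphism.Build fring C fev fev_rmorph.1.
HB.instance Definition _ := GRing.isMonoidMorphism.Build fring C fev fev_rmorph.2.

Lemma fev_var i : fev (fvar i) = v i.
Proof. by rewrite fevE. Qed.
End FreeRingEval.

Lemma feval_morph (C D : comPzRingType) (h : {rmorphism C -> D}) v e :
  h (feval v e) = feval (h \o v) e.
Proof.
by elim: e => [i|||e IH|e IH e' IH'|e IH e' IH'] //=;
  rewrite ?rmorph0 ?rmorph1 ?rmorphN ?rmorphD ?rmorphM ?IH ?IH'.
Qed.

Lemma fev_morph (C D : comPzRingType) (h : {rmorphism C -> D}) v x :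
  h (fev v x) = fev (h \o v) x.
Proof. exact: feval_morph. Qed.

Lemma eq_fev (C : comPzRingType) (v w : nat -> C) x : v =1 w -> fev v x = fev w x.
Proof. by move=> /funext ->. Qed.

Fixpoint fbound (e : fexpr) : nat :=
  match e with
  | FVar i => i.+1
  | FZero | FOne => 0
  | FOpp e => fbound e
  | FAdd e e' | FMul e e' => maxn (fbound e) (fbound e')
  end.

Module FreeRingTorsion.
Import mpoly.

Lemma fring_torsion_free (p : nat) (x : fring) : (0 < p)%N -> x *+ p = 0 -> x = 0.
Proof.
move=> p0; elim/quotW: x => s h.
have {}h (C : comPzRingType) (v : nat -> C) : feval v s *+ p = 0.
  by rewrite -fevE -rmorphMn h rmorph0.
rewrite -qpi0; apply/qpiP => C v /=.
have [e|n10] := eqVneq (1 : C) 0.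
  by rewrite -[LHS]mulr1 e mulr0.
pose C' : comNzRingType := HB.pack (GRing.ComPzRing.sort C)
  (GRing.ComPzRing.class C) (GRing.PzSemiRing_isNonZero.Build C n10).
pose n := fbound s.
pose v0 (i : nat) : {mpoly int[n]} := if insub i is Some j then 'X_j else 0.
have h0 : feval v0 s = 0.
  have := h _ v0; rewrite -mulr_natr => /eqP; rewrite mulf_eq0 => /orP[/eqP //|].
  rewrite -(rmorph_nat (@mpolyC n int)) mpolyC_eq0 Num.Theory.pnatr_eq0 => /eqP; lia.
pose hm : {rmorphism {mpoly int[n]} -> C'} :=
  mmap (intr : int -> C') (fun i : 'I_n => v i : C').
have H e : (fbound e <= n)%N -> hm (feval v0 e) = feval v e :> C.
  elim: e => [i|||e IH|e IH e' IH'|e IH e' IH'] /=.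
  - by move=> hi; rewrite /v0 insubT /hm /= mmapX mmap1U.
  - by move=> _; exact: (rmorph0 hm).
  - by move=> _; exact: (rmorph1 hm).
  - by move=> /IH <-; exact: (rmorphN hm).
  - by rewrite geq_max => /andP[/IH <- /IH' <-]; exact: (rmorphD hm).
  - by rewrite geq_max => /andP[/IH <- /IH' <-]; exact: (rmorphM hm).
by rewrite -H // h0; exact: (rmorph0 hm).
Qed.
End FreeRingTorsion.
Import FreeRingTorsion.

Section Ghost.
Variable p : nat.

Definition ghost (R : pzSemiRingType) (a : nat -> R) (n : nat) : R :=
  \sum_(i < n.+1) a i ^+ (p ^ (n - i)) *+ (p ^ i).

Lemma ghost_morph (R S : pzRingType) (h : {rmorphism R -> S}) a n :
  h (ghost a n) = ghost (h \o a) n.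
Proof.
by rewrite /ghost rmorph_sum; apply: eq_bigr => i _; rewrite rmorphMn rmorphXn.
Qed.

Lemma ghost_eq (R : pzSemiRingType) (a b : nat -> R) n :
  (forall i, (i <= n)%N -> a i = b i) -> ghost a n = ghost b n.
Proof. by move=> h; apply: eq_bigr => i _; rewrite h // -ltnS. Qed.

Lemma ghostS (R : pzSemiRingType) (a : nat -> R) n :
  ghost a n = \sum_(i < n) a i ^+ (p ^ (n - i)) *+ (p ^ i) + a n *+ (p ^ n).
Proof. by rewrite /ghost big_ord_recr /= subnn expn0 expr1. Qed.
End Ghost.

Section FrobeniusLift.
Variables (p : nat) (p_pr : prime p).

Lemma binom_p (R : comPzRingType) (x y : R) :
  exists z, (x + y) ^+ p = x ^+ p + y ^+ p + z *+ p.
Proof.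
have p0 := prime_gt0 p_pr.
pose F (i : nat) := x ^+ (p - i) * y ^+ i *+ 'C(p, i).
have eF : (x + y) ^+ p = \sum_(i < p.+1) F i by rewrite exprDn.
exists (\sum_(1 <= i < p) x ^+ (p - i) * y ^+ i *+ ('C(p, i) %/ p)).
rewrite eF -(big_mkord predT F) big_nat_recr //= big_ltn //.
rewrite {1}/F subn0 expr0 mulr1 bin0 mulr1n /F subnn expr0 mul1r binn mulr1n.
rewrite addrAC; congr (_ + _); rewrite -sumrMnl.
apply: eq_big_nat => i /andP[i0 ip].
by rewrite -mulrnA divnK // prime_dvd_bin // i0 ip.
Qed.

Definition fphi : {rmorphism fring -> fring} := fev (fun i => fvar i ^+ p).

Lemma fphi_lift x : exists z, fphi x = x ^+ p + z *+ p.
Proof.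
have p0 := prime_gt0 p_pr.
pose Q (x : fring) := exists z, fphi x = x ^+ p + z *+ p.
have QN (a : fring) : Q a -> Q (- a).
  move=> [z IH]; rewrite /Q (rmorphN fphi) IH.
  have [w hw] := binom_p a (- a).
  rewrite subrr expr0n in hw; exists (w - z).
  rewrite mulrnBl opprD addrA; congr (_ - _).
  apply: (addrI (a ^+ p)); rewrite subrr addrA -hw.
  by case: (p) p0.
have QD (a b : fring) : Q a -> Q b -> Q (a + b).
  move=> [z IH] [z' IH']; rewrite /Q (rmorphD fphi) IH IH'.
  have [w ->] := binom_p a b.
  exists (z + z' - w); rewrite mulrnBl mulrnDl addrACA -!addrA; congr (_ + (_ + _)).
  by rewrite [RHS]addrC -!addrA addNr addr0.
have QM (a b : fring) : Q a -> Q b -> Q (a * b).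
  move=> [z IH] [z' IH']; rewrite /Q (rmorphM fphi) IH IH' exprMn.
  exists (a ^+ p * z' + z * (b ^+ p + z' *+ p)).
  by rewrite mulrDl mulrDr -addrA mulrnDl -[in RHS]mulrnAr -[in RHS]mulrnAl.
rewrite -/(Q x); elim/quotW: x.
elim=> [i|||e IH|e IH e' IH'|e IH e' IH'].
- by exists 0; rewrite mul0rn addr0; exact: (fev_var (fun i => fvar i ^+ p)).
- by exists 0; rewrite mul0rn addr0 [LHS](rmorph0 fphi) expr0n; case: (p) p0.
- by exists 0; rewrite mul0rn addr0 [LHS](rmorph1 fphi) expr1n.
- by have := QN _ IH; rewrite (qpiN (e : fpre)).
- by have := QD _ _ IH IH'; rewrite (qpiD (e : fpre)).
- by have := QM _ _ IH IH'; rewrite (qpiM (e : fpre)).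
Qed.

Lemma congr_pow (R : comPzRingType) (x y z : R) k : (0 < k)%N ->
  x = y + z *+ (p ^ k) -> exists w, x ^+ p = y ^+ p + w *+ (p ^ k.+1).
Proof.
move=> k0 ->; have p0 := prime_gt0 p_pr.
pose F (i : nat) := y ^+ (p - i) * (z *+ (p ^ k)) ^+ i *+ 'C(p, i).
exists (\sum_(1 <= i < p.+1)
  y ^+ (p - i) * z ^+ i *+ (p ^ (k * i) * 'C(p, i) %/ p ^ k.+1)).
have -> : (y + z *+ (p ^ k)) ^+ p = \sum_(i < p.+1) F i by rewrite exprDn.
rewrite -(big_mkord predT F) big_ltn //.
rewrite {1}/F subn0 expr0 mulr1 bin0 mulr1n; congr (_ + _).
rewrite -sumrMnl; apply: eq_big_nat => i /andP[i0 ip].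
rewrite /F exprMn_n -expnM mulrnAr -2!mulrnA divnK //.
have [e|ne] := eqVneq i p.
  rewrite e binn muln1 dvdn_exp2l //; have := prime_gt1 p_pr; nia.
have hi : (p %| 'C(p, i))%N by apply: prime_dvd_bin => //; lia.
rewrite expnSr; apply: dvdn_mul => //.
by rewrite dvdn_exp2l //; nia.
Qed.

Lemma congr_pow_iter (R : comPzRingType) (x y z : R) k :
  x = y + z *+ p ->
  exists w, x ^+ (p ^ k) = y ^+ (p ^ k) + w *+ (p ^ k.+1).
Proof.
move=> h; elim: k => [|k [w IH]]; first by exists z; rewrite !expr1 expn1.
have [w' h'] := congr_pow (ltn0Sn k) IH.
by exists w'; rewrite expnSr !exprM.
Qed.

Lemma ghost_phi (a : nat -> fring) n :
  exists z, ghost p a n.+1 = fphi (ghost p a n) + z *+ (p ^ n.+1).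
Proof.
have /choice[z hz] (i : nat) := fphi_lift (a i).
have hw (i : nat) : exists w, fphi (a i) ^+ (p ^ (n - i)) =
    a i ^+ (p ^ (n.+1 - i)) * (i <= n)%N%:R + (i > n)%N%:R * fphi (a i)
    + w *+ (p ^ (n - i).+1).
  case: (leqP i n) => hi /=; last first.
    exists 0; rewrite mulr0 mul0rn addr0 add0r mul1r.
    by have -> : (n - i = 0)%N by lia.
  have [w hw] := congr_pow_iter (n - i) (hz i).
  by exists w; rewrite hw mulr1 mul0r addr0 -exprM -expnS subSn.
have {hw} /choice[w hw] := hw.
exists (a n.+1 - \sum_(i < n.+1) w i).
suff E : \sum_(i < n.+1) a i ^+ (p ^ (n.+1 - i)) *+ (p ^ i) =
    fphi (ghost p a n) - (\sum_(i < n.+1) w i) *+ (p ^ n.+1).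
  by rewrite ghostS E mulrnBl addrAC addrA.
rewrite /ghost rmorph_sum -sumrMnl -sumrB.
apply: eq_bigr => i _; have hi : (i <= n)%N by rewrite -ltnS.
rewrite rmorphMn rmorphXn hw hi ltnNge hi mulr1 mul0r addr0 mulrnDl.
rewrite -mulrnA -expnD.
have -> : ((n - i).+1 + i = n.+1)%N by lia.
by rewrite addrK.
Qed.

Lemma ftf k (x y : fring) : x *+ (p ^ k) = y *+ (p ^ k) -> x = y.
Proof.
move=> h; apply/eqP; rewrite -subr_eq0; apply/eqP.
apply: (@fring_torsion_free (p ^ k)); first by rewrite expn_gt0 prime_gt0.
by rewrite mulrnBl h subrr.
Qed.

Lemma ghost_inj (a b : nat -> fring) : (forall n, ghost p a n = ghost p b n) -> a =1 b.
Proof.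
move=> h n; elim/ltn_ind: n => n IH; apply: (@ftf n).
have := h n; rewrite !ghostS.
have -> : \sum_(i < n) a i ^+ (p ^ (n - i)) *+ (p ^ i) =
          \sum_(i < n) b i ^+ (p ^ (n - i)) *+ (p ^ i).
  by apply: eq_bigr => i _; rewrite IH.
by move/addrI.
Qed.

(* Dwork's lemma *)
Lemma ghost_surj (u : nat -> fring) :
  (forall n, exists z, u n.+1 = fphi (u n) + z *+ (p ^ n.+1)) ->
  exists a, forall n, ghost p a n = u n.
Proof.
move=> hu.
have ext (a : nat -> fring) n : (forall i, (i < n)%N -> ghost p a i = u i) ->
    exists x, forall b, (forall i, (i < n)%N -> b i = a i) -> b n = x ->
      ghost p b n = u n.
  case: n => [|n] ha.
    by exists (u 0%N) => b _ hb; rewrite ghostS big_ord0 add0r hb mulr1n.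
  have [z hz] := hu n; have [z' hz'] := ghost_phi a n.
  exists (z - z' + a n.+1) => b hb hbn.
  have : \sum_(i < n.+1) b i ^+ (p ^ (n.+1 - i)) *+ (p ^ i)
         = ghost p a n.+1 - a n.+1 *+ (p ^ n.+1).
    rewrite ghostS addrK; apply: eq_bigr => i _; rewrite hb //.
  move=> E; rewrite ghostS hbn E hz hz' ha // mulrnDl mulrnBl.
  rewrite addrACA addNr addr0 -addrA; congr (_ + _).
  by rewrite addrCA subrr addr0.
pose P (s : seq fring) x :=
  (forall i, (i < size s)%N -> ghost p (nth 0 s) i = u i) ->
  forall b, (forall i, (i < size s)%N -> b i = nth 0 s i) -> b (size s) = x ->
      ghost p b (size s) = u (size s).
have /choice[nx hnx] (s : seq fring) : exists x, P s x.
  have [hs|hs] := pselect (forall i, (i < size s)%N -> ghost p (nth 0 s) i = u i).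
    by have [x hx] := ext _ _ hs; exists x => _; exact: hx.
  by exists 0 => h; case: hs.
pose l := fix l n := if n is n'.+1 then rcons (l n') (nx (l n')) else [::].
have sl n : size (l n) = n by elim: n => //= n IH; rewrite size_rcons IH.
have ln i n : (i < n)%N -> nth 0 (l n) i = nx (l i).
  elim: n => // n IH; rewrite ltnS leq_eqVlt => /orP[/eqP ->|hi] /=.
    by rewrite nth_rcons sl ltnn eqxx.
  by rewrite nth_rcons sl hi IH.
exists (fun i => nx (l i)) => n; elim/ltn_ind: n => n IH.
have := hnx (l n); rewrite /P sl; apply => //.
- move=> i hi; rewrite -(IH i hi); apply: ghost_eq => j hj.
  by apply: ln; lia.
- by move=> i hi; rewrite ln.
Qed.

End FrobeniusLift.

Section WittPolynomials.
Variables (p : nat) (p_pr : prime p).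

Let X i := fvar i.*2.
Let Y i := fvar i.*2.+1.

Fact witt_addP : exists c, forall n, ghost p c n = ghost p X n + ghost p Y n.
Proof.
apply: (ghost_surj p_pr) => n.
have [z ->] := ghost_phi p_pr X n; have [z' ->] := ghost_phi p_pr Y n.
by exists (z + z'); rewrite rmorphD mulrnDl addrACA.
Qed.

Fact witt_mulP : exists c, forall n, ghost p c n = ghost p X n * ghost p Y n.
Proof.
apply: (ghost_surj p_pr) => n.
have [z ->] := ghost_phi p_pr X n; have [z' ->] := ghost_phi p_pr Y n.
exists (fphi p (ghost p X n) * z' + z * (fphi p (ghost p Y n) + z' *+ (p ^ n.+1))).
by rewrite rmorphM mulrDl mulrDr -addrA mulrnDl -[in RHS]mulrnAr -[in RHS]mulrnAl.
Qed.

Fact witt_oppP : exists c, forall n, ghost p c n = - ghost p X n.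
Proof.
apply: (ghost_surj p_pr) => n; have [z ->] := ghost_phi p_pr X n.
by exists (- z); rewrite rmorphN opprD mulNrn.
Qed.

(* The [n]-th sum, product and opposite polynomials, in the variables
   [X_i = fvar (2 i)] and [Y_i = fvar (2 i + 1)] *)
Definition witt_addpoly := sval (cid witt_addP).
Definition witt_mulpoly := sval (cid witt_mulP).
Definition witt_opppoly := sval (cid witt_oppP).
End WittPolynomials.

Record witt (p : nat) (p_pr : prime p) (R : Type) := Witt { wcoef :> nat -> R }.

Section WittRing.
Variables (p : nat) (p_pr : prime p).
Local Notation W := (witt p_pr).

Lemma witt_inj R (a b : W R) : a =1 b -> a = b.
Proof. by case: a b => [a] [b] /= /funext ->. Qed.

HB.instance Definition _ (R : Type) := gen_eqMixin (W R).
HB.instance Definition _ (R : Type) := gen_choiceMixin (W R).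

Section Operations.
Variable R : comPzRingType.
Implicit Types a b : W R.

Definition witt_eval a b : fring -> R :=
  fev (fun i => if odd i then b i./2 else a i./2).
HB.instance Definition _ a b := GRing.RMorphism.on (witt_eval a b).

Definition wzero : W R := Witt p_pr (fun=> 0).
Definition wone : W R := Witt p_pr (fun n => (n == 0%N)%:R).
Definition wadd a b : W R := Witt p_pr (fun n => witt_eval a b (witt_addpoly p_pr n)).
Definition wmul a b : W R := Witt p_pr (fun n => witt_eval a b (witt_mulpoly p_pr n)).
Definition wopp a : W R := Witt p_pr (fun n => witt_eval a a (witt_opppoly p_pr n)).

Lemma witt_eval_ghostX a b n :
  witt_eval a b (ghost p (fun i => fvar i.*2) n) = ghost p a n.
Proof.
rewrite ghost_morph; apply: ghost_eq => i _ /=.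
by rewrite /witt_eval fev_var odd_double doubleK.
Qed.

Lemma witt_eval_ghostY a b n :
  witt_eval a b (ghost p (fun i => fvar i.*2.+1) n) = ghost p b n.
Proof.
rewrite ghost_morph; apply: ghost_eq => i _ /=.
by rewrite /witt_eval fev_var /= odd_double uphalf_double.
Qed.

Lemma ghost_add a b n : ghost p (wadd a b) n = ghost p a n + ghost p b n.
Proof.
rewrite -(witt_eval_ghostX a b) -(witt_eval_ghostY a b) -rmorphD.
by rewrite -(svalP (cid (witt_addP p_pr))) ghost_morph.
Qed.

Lemma ghost_mul a b n : ghost p (wmul a b) n = ghost p a n * ghost p b n.
Proof.
rewrite -(witt_eval_ghostX a b) -(witt_eval_ghostY a b) -rmorphM.
by rewrite -(svalP (cid (witt_mulP p_pr))) ghost_morph.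
Qed.

Lemma ghost_opp a n : ghost p (wopp a) n = - ghost p a n.
Proof.
rewrite -(witt_eval_ghostX a a) -rmorphN.
by rewrite -(svalP (cid (witt_oppP p_pr))) ghost_morph.
Qed.

Lemma ghost_zero n : ghost p wzero n = 0.
Proof.
rewrite /ghost big1 // => i _; rewrite expr0n expn_eq0.
by have := prime_gt0 p_pr; case: (p) => //= *; rewrite mul0rn.
Qed.

Lemma ghost_one n : ghost p wone n = 1.
Proof.
rewrite /ghost big_ord_recl /= expr1n expn0 mulr1n big1 ?addr0 // => i _ /=.
rewrite expr0n expn_eq0.
by have := prime_gt0 p_pr; case: (p) => //= *; rewrite mul0rn.
Qed.
End Operations.

Section Functoriality.
Variables (R S : comPzRingType) (h : {rmorphism R -> S}).

Definition wmap (a : W R) : W S := Witt p_pr (h \o a).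

Lemma wmapD a b : wmap (wadd a b) = wadd (wmap a) (wmap b).
Proof.
apply: witt_inj => n /=; rewrite /witt_eval fev_morph.
by apply: eq_fev => i /=; case: ifP.
Qed.
Lemma wmapM a b : wmap (wmul a b) = wmul (wmap a) (wmap b).
Proof.
apply: witt_inj => n /=; rewrite /witt_eval fev_morph.
by apply: eq_fev => i /=; case: ifP.
Qed.
Lemma wmapN a : wmap (wopp a) = wopp (wmap a).
Proof.
apply: witt_inj => n /=; rewrite /witt_eval fev_morph.
by apply: eq_fev => i /=; case: ifP.
Qed.
Lemma wmap0 : wmap (wzero R) = wzero S.
Proof. by apply: witt_inj => n /=; rewrite rmorph0. Qed.
Lemma wmap1 : wmap (wone R) = wone S.
Proof. by apply: witt_inj => n /=; rewrite rmorph_nat. Qed.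
End Functoriality.

Lemma ghost_injW (a b : W fring) : (forall n, ghost p a n = ghost p b n) -> a = b.
Proof. by move=> h; apply: witt_inj; exact: (ghost_inj p_pr). Qed.

Let V j : W fring := Witt p_pr (fun i => fvar (3 * i + j)).

(* Every triple of Witt vectors is the image of the generic one. *)
Lemma witt_generic (R : comPzRingType) (a b c : W R) :
  exists h : {rmorphism fring -> R},
    [/\ wmap h (V 0) = a, wmap h (V 1) = b & wmap h (V 2) = c].
Proof.
exists (fev (fun i => nth 0 [:: a (i %/ 3)%N; b (i %/ 3)%N; c (i %/ 3)%N] (i %% 3)%N)).
split; apply: witt_inj => i /=; rewrite fev_var.
- have [-> ->] // : ((3 * i + 0) %/ 3 = i /\ (3 * i + 0) %% 3 = 0)%N.
  by split; lia.
- have [-> ->] // : ((3 * i + 1) %/ 3 = i /\ (3 * i + 1) %% 3 = 1)%N.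
  by split; lia.
- have [-> ->] // : ((3 * i + 2) %/ 3 = i /\ (3 * i + 2) %% 3 = 2)%N.
  by split; lia.
Qed.

Section WittRingLaws.
Variable R : comPzRingType.
Let wE := (ghost_add, ghost_mul, ghost_opp, ghost_zero, ghost_one).
Let mE := (wmapD, wmapM, wmapN, wmap0, wmap1).

Fact waddA : associative (@wadd R).
Proof.
move=> a b c; have [h [<- <- <-]] := witt_generic a b c.
rewrite -!mE; congr wmap; apply: ghost_injW => n; rewrite !wE; exact: addrA.
Qed.
Fact waddC : commutative (@wadd R).
Proof.
move=> a b; have [h [<- <- _]] := witt_generic a b a.
rewrite -!mE; congr wmap; apply: ghost_injW => n; rewrite !wE; exact: addrC.
Qed.
Fact wadd0 : left_id (wzero R) (@wadd R).
Proof.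
move=> a; have [h [<- _ _]] := witt_generic a a a.
rewrite -(wmap0 h) -!mE; congr wmap; apply: ghost_injW => n; rewrite !wE; exact: add0r.
Qed.
Fact waddN : left_inverse (wzero R) (@wopp R) (@wadd R).
Proof.
move=> a; have [h [<- _ _]] := witt_generic a a a.
rewrite -(wmap0 h) -!mE; congr wmap; apply: ghost_injW => n; rewrite !wE; exact: addNr.
Qed.
Fact wmulA : associative (@wmul R).
Proof.
move=> a b c; have [h [<- <- <-]] := witt_generic a b c.
rewrite -!mE; congr wmap; apply: ghost_injW => n; rewrite !wE; exact: mulrA.
Qed.
Fact wmulC : commutative (@wmul R).
Proof.
move=> a b; have [h [<- <- _]] := witt_generic a b a.
rewrite -!mE; congr wmap; apply: ghost_injW => n; rewrite !wE; exact: mulrC.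
Qed.
Fact wmul1 : left_id (wone R) (@wmul R).
Proof.
move=> a; have [h [<- _ _]] := witt_generic a a a.
rewrite -(wmap1 h) -!mE; congr wmap; apply: ghost_injW => n; rewrite !wE; exact: mul1r.
Qed.
Fact wmulD : left_distributive (@wmul R) (@wadd R).
Proof.
move=> a b c; have [h [<- <- <-]] := witt_generic a b c.
rewrite -!mE; congr wmap; apply: ghost_injW => n; rewrite !wE; exact: mulrDl.
Qed.

HB.instance Definition _ := GRing.isZmodule.Build (W R) waddA waddC wadd0 waddN.
HB.instance Definition _ :=
  GRing.Zmodule_isComPzRing.Build (W R) wmulA wmulC wmul1 wmulD.
End WittRingLaws.

Fact wmap_rmorph (R S : comPzRingType) (h : {rmorphism R -> S}) :
  zmod_morphism (wmap h) /\ monoid_morphism (wmap h).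
Proof.
apply: rmorph_build => [x y|x y|]; [exact: wmapD|exact: wmapM|exact: wmap1].
Qed.
HB.instance Definition _ (R S : comPzRingType) (h : {rmorphism R -> S}) :=
  GRing.isZmodMorphism.Build (W R) (W S) (wmap h) (wmap_rmorph h).1.
HB.instance Definition _ (R S : comPzRingType) (h : {rmorphism R -> S}) :=
  GRing.isMonoidMorphism.Build (W R) (W S) (wmap h) (wmap_rmorph h).2.
End WittRing.

(* A non-archimedean local field enters through its ring of integers, a
   complete discrete valuation ring with finite residue field. *)
Record local_field := LocalField {
  lf_O : idomainType;
  lf_pi : lf_O;
  lf_k : finFieldType;
  lf_res : {rmorphism lf_O -> lf_k};
  lf_res_surj : forall c, exists x, lf_res x = c;
  lf_res_ker : forall x, lf_res x = 0 <-> exists y, x = lf_pi * y;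
  lf_pi_neq0 : lf_pi != 0;
  lf_dvr : forall x, x != 0 ->
    exists (u : lf_O) (m : nat), u \is a GRing.unit /\ x = u * lf_pi ^+ m;
  lf_complete : forall u : nat -> lf_O,
    (forall m, exists y, u m.+1 - u m = lf_pi ^+ m * y) ->
    exists l, forall m, exists y, l - u m = lf_pi ^+ m * y }.

Definition lf_p (F : local_field) : nat := s2val (finPcharP (lf_k F)).
Fact lf_p_prime (F : local_field) : prime (lf_p F).
Proof. by rewrite /lf_p; case: finPcharP. Qed.
Fact lf_p_char (F : local_field) : lf_p F \in [pchar (lf_k F)].
Proof. by rewrite /lf_p; case: finPcharP. Qed.
Definition lf_q (F : local_field) : nat := #|lf_k F|.

(* [bd_W] is the structure of [W(k)]-algebra of [O_F]: the unique ring morphism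
   lifting the identity of the residue field. *)
Record base_data := BaseData {
  bd_F :> local_field;
  bd_W : {rmorphism witt (lf_p_prime bd_F) (lf_k bd_F) -> lf_O bd_F};
  bd_WP : forall w, lf_res bd_F (bd_W w) = w 0%N;
  bd_kbar : closedFieldType;
  bd_iota : {rmorphism lf_k bd_F -> bd_kbar};
  bd_alg : forall x : bd_kbar, algebraicOver bd_iota x }.

Section RamifiedWitt.
Variable D : base_data.
Local Notation O := (lf_O D).
Local Notation k := (lf_k D).
Local Notation pi := (lf_pi D).
Local Notation W := (witt (lf_p_prime D)).
Local Notation Wm := (@wmap _ (lf_p_prime D) _ _).

Section Object.
Variables (R : comPzRingType) (j : {rmorphism k -> R}).

Definition WOlevel (m : nat) : comPzRingType :=
  tensor (Wm j : {rmorphism W k -> W R})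
         (modpi (pi ^+ m) \o bd_W D : {rmorphism W k -> modring (pi ^+ m)}).

Fact pi_expS m : exists c, pi ^+ m.+1 = pi ^+ m * c.
Proof. by exists pi; rewrite exprSr. Qed.

Fact WOtrans_compat m (a : W k) :
  modproj (pi_expS m) (modpi (pi ^+ m.+1) (bd_W D a)) = modpi (pi ^+ m) (bd_W D a).
Proof. exact: modprojE. Qed.

Definition WOtrans (m : nat) : {rmorphism WOlevel m.+1 -> WOlevel m} :=
  tmap (f := Wm j) (g := modpi (pi ^+ m.+1) \o bd_W D)
       (f' := Wm j) (g' := modpi (pi ^+ m) \o bd_W D)
       (h := idfun) (l := modproj (pi_expS m)) (fun=> erefl) (WOtrans_compat m).

(* [W_{O_F}(R)], the limit over [m] of [W(R) (x)_{W(k)} O_F / pi^m] *)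
Definition WO : comPzRingType := invlim WOtrans.

Definition WO_const (c : O) : WO.
Proof.
refine (@InvLim _ WOtrans (fun m => tinr _ _ (modpi (pi ^+ m) c)) _) => m.
by rewrite [LHS]tmapE /= /tpremap /= modprojE.
Defined.
End Object.

Section Functor.
Variables (R R' : comPzRingType).
Variables (j : {rmorphism k -> R}) (j' : {rmorphism k -> R'}).
Variables (f : {rmorphism R -> R'}) (fj : forall c, f (j c) = j' c).

Fact WOmap_compat (a : W k) : Wm f (Wm j a) = Wm j' a.
Proof. by apply: witt_inj => i /=; rewrite fj. Qed.

Definition WOlevelmap (m : nat) : {rmorphism WOlevel j m -> WOlevel j' m} :=
  tmap (f := Wm j) (g := modpi (pi ^+ m) \o bd_W D)
       (f' := Wm j') (g' := modpi (pi ^+ m) \o bd_W D)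
       (h := Wm f) (l := idfun) WOmap_compat (fun=> erefl).

Fact WOlevelmap_compat m (x : WOlevel j m.+1) :
  WOtrans j' m (WOlevelmap m.+1 x) = WOlevelmap m (WOtrans j m x).
Proof.
elim/quotW: x => s; rewrite /WOtrans /WOlevelmap /= !tmapE.
by congr qpi; rewrite /tpremap -!map_comp.
Qed.

Definition WOmap : {rmorphism WO j -> WO j'} := il_map WOlevelmap_compat.

Fact WOmap_const c : WOmap (WO_const j c) = WO_const j' c.
Proof.
by apply: invlim_inj => m /=; rewrite [LHS]tmapE /= rmorph1.
Qed.
End Functor.
End RamifiedWitt.

Section Frobenius.
Variables (D : base_data) (R : comPzRingType).
Implicit Type j : {rmorphism lf_k D -> R}.

Definition frobq j (x : R) : R := x ^+ lf_q D.

Fact frobq_rmorph j : zmod_morphism (frobq j) /\ monoid_morphism (frobq j).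
Proof.
have pR (z : R) : z *+ lf_p D = 0.
  have := pcharf0 (lf_p_char D) => h.
  by rewrite -mulr_natr -(rmorph_nat j) h rmorph0 mulr0.
have [e he] : exists e, lf_q D = (lf_p D ^ e)%N.
  have := abelem_pgroup (fin_ring_pchar_abelem (lf_p_char D)).
  by move=> /card_pgroup; rewrite cardsT => h; exists (logn (lf_p D) #|lf_k D|).
apply: rmorph_build => [x y|x y|]; rewrite /frobq ?exprMn ?expr1n // he.
elim: e {he} => [|e IH]; first by rewrite !expr1.
rewrite expnSr !exprM IH.
by have [z ->] := binom_p (lf_p_prime D) (x ^+ (lf_p D ^ e)) (y ^+ (lf_p D ^ e));
  rewrite pR addr0.
Qed.
HB.instance Definition _ j :=
  GRing.isZmodMorphism.Build R R (frobq j) (frobq_rmorph j).1.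
HB.instance Definition _ j :=
  GRing.isMonoidMorphism.Build R R (frobq j) (frobq_rmorph j).2.

Fact frobq_over j c : frobq j (j c) = j c.
Proof. by rewrite /frobq -rmorphXn expf_card. Qed.
End Frobenius.

Section PerfectAlgebras.
Variable D : base_data.
Local Notation k := (lf_k D).
Local Notation kbar := (bd_kbar D).

Record palg := PAlg {
  pa_ring :> comPzRingType;
  pa_str : {rmorphism kbar -> pa_ring};
  pa_perfect : bijective (fun x : pa_ring => x ^+ lf_p D) }.

Record palg_hom (R R' : palg) := PAlgHom {
  ph_fun :> {rmorphism R -> R'};
  ph_str : forall c, ph_fun (pa_str R c) = pa_str R' c }.

Definition pa_k (R : palg) : {rmorphism k -> R} := pa_str R \o bd_iota D.

Definition is_field (R : palg) :=
  (1 : R) <> 0 /\ forall x : R, x <> 0 -> exists y, x * y = 1.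

Record presheaf := Presheaf {
  ps_pt : palg -> Type;
  ps_res : forall R R', palg_hom R R' -> ps_pt R -> ps_pt R' }.

Definition subfunctor (P : presheaf) := forall R, set (ps_pt P R).

Section Subfunctors.
Variable P : presheaf.
Implicit Types X Y Z : subfunctor P.

Definition subfun Y X := forall R x, Y R x -> X R x.

(* [Z] is cut out, locally on [X], by the vanishing of a set of functions.  On
   perfect algebras such subfunctors of a perfect (ind-)scheme are its closed
   perfect sub-(ind-)schemes, i.e. the closed subsets of its space. *)
Definition closed_in X Z :=
  subfun Z X /\
  forall R x, X R x -> exists I : set R, forall R' (f : palg_hom R R'),
    Z R' (ps_res f x) <-> (forall a, I a -> f a = 0).

Definition closure_in X Y : subfunctor P := fun R x =>
  X R x /\ forall Z, closed_in X Z -> subfun Y Z -> Z R x.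

(* A closed subset is irreducible when it is nonempty and is not covered by two
   closed subsets not containing it; unions are tested on points with values
   in perfect fields. *)
Definition irreducible_in X Z :=
  [/\ closed_in X Z,
      exists K x, is_field K /\ Z K x &
      forall Z1 Z2, closed_in X Z1 -> closed_in X Z2 ->
        (forall K x, is_field K -> Z K x -> Z1 K x \/ Z2 K x) ->
        subfun Z Z1 \/ subfun Z Z2].

Definition irr_component X Z :=
  irreducible_in X Z /\
  forall Z', irreducible_in X Z' -> subfun Z Z' -> subfun Z' Z.

Definition irr_chain X Z (d : nat) :=
  exists c : nat -> subfunctor P,
    [/\ forall i, (i <= d)%N -> irreducible_in X (c i) /\ subfun (c i) Z &
        forall i, (i < d)%N -> subfun (c i) (c i.+1) /\ ~ subfun (c i.+1) (c i)].

Definition krull_dim X Z (d : nat) :=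
  irr_chain X Z d /\ ~ irr_chain X Z d.+1.
End Subfunctors.

Definition prodP (P Q : presheaf) : presheaf :=
  @Presheaf (fun R => (ps_pt P R * ps_pt Q R)%type)
            (fun R R' f x => (ps_res f x.1, ps_res f x.2)).

Definition isomorphic (P Q : presheaf) (X : subfunctor P) (Y : subfunctor Q) :=
  exists phi : forall R, ps_pt P R -> ps_pt Q R,
    [/\ forall R x, X R x -> Y R (phi R x),
        forall R x x', X R x -> X R x' -> phi R x = phi R x' -> x = x',
        forall R y, Y R y -> exists2 x, X R x & phi R x = y &
        forall R R' (f : palg_hom R R') x, X R x ->
          phi R' (ps_res f x) = ps_res f (phi R x)].
End PerfectAlgebras.

Section Submodules.
Variables (A B : comPzRingType) (i : {rmorphism A -> B}) (n : nat).

Definition lincomb m (c : 'I_m -> A) (b : 'I_m -> 'cV[B]_n) : 'cV[B]_n :=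
  \sum_j i (c j) *: b j.

Definition mspan (X : set 'cV[B]_n) : set 'cV[B]_n :=
  [set v | exists m (c : 'I_m -> A) (b : 'I_m -> 'cV[B]_n),
     (forall j, X (b j)) /\ v = lincomb c b].

Definition submodule (E : set 'cV[B]_n) :=
  [/\ E 0, forall u v, E u -> E v -> E (u + v) &
      forall c v, E v -> E (i c *: v)].

Definition mbasis m (b : 'I_m -> 'cV[B]_n) (E : set 'cV[B]_n) :=
  (forall v, E v <-> exists c, v = lincomb c b) /\
  (forall c, lincomb c b = 0 -> forall j, c j = 0).

(* finitely generated projective, by means of a finite dual basis *)
Definition fg_projective (E : set 'cV[B]_n) :=
  exists m (b : 'I_m -> 'cV[B]_n) (f : 'I_m -> 'cV[B]_n -> A),
    [/\ forall j, E (b j),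
        forall j u v, E u -> E v -> f j (u + v) = f j u + f j v,
        forall j c v, E v -> f j (i c *: v) = c * f j v &
        forall v, E v -> v = lincomb (fun j => f j v) b].
End Submodules.

Section Cocharacters.
Variable n : nat.

(* [(m_0, (m_1, ..., m_n))] *)
Definition cochar : zmodType := (int * 'rV[int]_n)%type.

Definition eps0 : cochar := (1, 0).
Definition eps (i : 'I_n) : cochar := (0, delta_mx 0 i).

Definition star (l : cochar) : cochar :=
  (- l.1, \row_i - l.2 0 (rev_ord i)).

Definition dominant (l : cochar) :=
  forall i j : 'I_n, (i <= j)%N -> (l.2 0 j <= l.2 0 i)%R.

(* [l' - l] is a sum of positive coroots *)
Definition coch_le (l l' : cochar) :=
  exists c : 'I_n -> 'I_n -> nat,
    l' = l + \sum_(i < n) \sum_(j < n | (i < j)%N) (eps i - eps j) *+ c i j.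

(* the pairing of [l] with the sum of the positive roots *)
Definition two_rho (l : cochar) : int :=
  \sum_(i < n) \sum_(j < n | (i < j)%N) (l.2 0 i - l.2 0 j).

Definition mu : cochar := eps0 + \sum_(i < n | (i < 2)%N) eps i.
Definition nu (r : nat) : cochar := \sum_(i < n | (i < r.-1)%N) eps i.
Definition tau : cochar := eps0 + \sum_(i < n) eps i.
End Cocharacters.

Section Grassmannian.
Variables (D : base_data) (n : nat).
Local Notation palg := (palg D).
Local Notation pi := (lf_pi D).
Local Open Scope classical_set_scope.

Definition Aring (R : palg) : comPzRingType := WO (pa_k R).
Definition varpi (R : palg) : Aring R := WO_const (pa_k R) pi.
Definition Bring (R : palg) : comPzRingType := loc (varpi R).
Definition AtoB (R : palg) : {rmorphism Aring R -> Bring R} := locin (varpi R).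

Definition Bmap (R R' : palg) (f : {rmorphism R -> R'})
    (fk : forall c, f (pa_k R c) = pa_k R' c) : {rmorphism Bring R -> Bring R'} :=
  locmap (WOmap_const fk pi).

Fact palg_hom_k (R R' : palg) (f : palg_hom R R') c : f (pa_k R c) = pa_k R' c.
Proof. exact: ph_str. Qed.

Definition resB (R R' : palg) (f : palg_hom R R') := Bmap (palg_hom_k f).
Definition sigmaB (R : palg) : {rmorphism Bring R -> Bring R} :=
  Bmap (frobq_over (pa_k R)).

Definition piz (R : palg) (m : int) : Bring R :=
  match m with
  | Posz j => locfrac (varpi R) (varpi R ^+ j) 0
  | Negz j => locfrac (varpi R) 1 j.+1
  end.

Definition base_change (R R' : palg) (h : {rmorphism Bring R -> Bring R'}) m
    (E : set 'cV[Bring R]_m) : set 'cV[Bring R']_m :=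
  mspan (AtoB R') ((map_mx h) @` E).

Definition lattice (R : palg) m (E : set 'cV[Bring R]_m) :=
  [/\ submodule (AtoB R) E, fg_projective (AtoB R) E &
      forall v, exists N : nat, E (piz R N%:Z *: v)].

Definition std_lattice (R : palg) m : set 'cV[Bring R]_m :=
  [set v | forall i, exists a, v i 0 = AtoB R a].
Arguments std_lattice R m : clear implicits.

(* A [GU]-torsor over [Spec A] trivialized over [Spec A[1/varpi]] is, through the
   isomorphism of [GU] with [GL_n x G_m] explained at [frobPt], a pair [(E, L)] of
   lattices in [B^n] and [B]. Restriction maps send a lattice [E] to the
   [A']-span of its image, that is to [A' (x)_A E]. *)
Definition Pt : presheaf D :=
  @Presheaf D (fun R => (set 'cV[Bring R]_n * set 'cV[Bring R]_1)%type)
    (fun R R' f x => (base_change (resB f) x.1, base_change (resB f) x.2)).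

Definition Gr : subfunctor Pt := fun R x => lattice x.1 /\ lattice x.2.

Definition std (R : palg) : ps_pt Pt R := (std_lattice R n, std_lattice R 1).

Definition antidiag (S : pzRingType) : 'M[S]_n :=
  \matrix_(i, j) (j == rev_ord i)%:R.

Definition hdual (R : palg) (E : set 'cV[Bring R]_n) (L : set 'cV[Bring R]_1) :
    set 'cV[Bring R]_n :=
  [set y | forall x, E x -> L (y^T *m antidiag _ *m x)].

(* As [kbar] contains the quadratic extension of [k], every [Aring R] is an
   algebra over the ring of integers [O_2] of the unramified quadratic extension
   of [F], and [O_2 (x)_O A = A * A] by [a (x) b |-> (a b, conj a b)].  A point of
   [GU] over [A] is thus a triple [(g1, g2, c)] with [g2^T J g1 = c J], where [J]
   is the antidiagonal matrix of the hermitian form; [(g1, c)] ranges freely over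
   [GL_n x G_m].  The Frobenius [1 (x) sigma] of [O_2 (x)_O A] is
   [(x, y) |-> (sigma y, sigma x)], so it sends [(g1, g2, c)] to
   [(sigma g2, sigma g1, sigma c)].  For [E = g1 A^n] and [L = c A], the lattice
   [g2 A^n] is [hdual E L], which gives [frobPt] on the affine Grassmannian. *)
Definition frobPt (R : palg) (x : ps_pt Pt R) : ps_pt Pt R :=
  (base_change (sigmaB R) (hdual x.1 x.2), base_change (sigmaB R) x.2).

Definition cochar_act (R : palg) (l : cochar n) (x : ps_pt Pt R) : ps_pt Pt R :=
  ((fun v => \col_i (piz R (l.2 0 i) * v i 0)) @` x.1,
   (fun v => piz R l.1 *: v) @` x.2).

Definition grp_act (R : palg) (g : 'M[Bring R]_n) (c : Bring R) (x : ps_pt Pt R) :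
    ps_pt Pt R :=
  ((mulmx g) @` x.1, (fun v => c *: v) @` x.2).

Definition rel_pos (K : palg) (l : cochar n) (x x0 : ps_pt Pt K) :=
  exists (e : 'I_n -> 'cV[Bring K]_n) (e0 : 'I_1 -> 'cV[Bring K]_1),
    [/\ mbasis (AtoB K) e x0.1,
        mbasis (AtoB K) (fun i => piz K (l.2 0 i) *: e i) x.1,
        mbasis (AtoB K) e0 x0.2 &
        mbasis (AtoB K) (fun i => piz K l.1 *: e0 i) x.2].

(* [l] is the position of [x] relative to [x0] when for some bases [e] and [e0] of
   the two components of [x0], the vectors [varpi^(m_i) e_i] and [varpi^(m_0) e0]
   form bases of those of [x].  A perfect ring being reduced, lying in the
   (locally) closed perfect subscheme of given (bounded) position is tested on
   points with values in perfect fields. *)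
Definition exact (l : cochar n) (R : palg) (x x0 : ps_pt Pt R) :=
  forall (K : palg) (f : palg_hom R K), is_field K ->
    rel_pos l (ps_res f x) (ps_res f x0).

Definition bounded (l : cochar n) (R : palg) (x x0 : ps_pt Pt R) :=
  forall (K : palg) (f : palg_hom R K), is_field K ->
    exists l', [/\ dominant l', coch_le l' l &
      rel_pos l' (ps_res f x) (ps_res f x0)].

Definition Gr_le (l : cochar n) : subfunctor Pt :=
  fun R x => Gr x /\ bounded l x (std R).
Definition Gr_eq (l : cochar n) : subfunctor Pt :=
  fun R x => Gr x /\ exact l x (std R).

(* For [K] a field, a point of [Gr] is the class of some [(g, c)]; the last
   condition says that the class of [(g, c)^-1 varpi^(tau^* ) sigma(g, c)] is in the
   closure of the orbit of [varpi^(mu^* )]. *)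
Definition X_mu_tau : subfunctor Pt := fun R x =>
  Gr x /\
  forall (K : palg) (f : palg_hom R K), is_field K ->
    exists (g h : 'M[Bring K]_n) (c d : Bring K),
      [/\ g *m h = 1%:M, h *m g = 1%:M, c * d = 1,
          ps_res f x = grp_act g c (std K) &
          closure_in Gr (Gr_eq (star (mu n))) 
            (grp_act h d (cochar_act (star (tau n)) (frobPt (ps_res f x))))].

(* the pair [(E_1, E_2)] stands for [E_2 --> E_1 --> E^0] *)
Definition Pt2 : presheaf D := prodP Pt Pt.

Definition Gr0 (r : nat) : subfunctor Pt2 := fun R x =>
  [/\ Gr_le (star (nu n r)) x.1, Gr x.2, bounded (star (mu n)) x.2 x.1 &
      Gr_le (nu n r + star (tau n)) x.2].

Definition Gr0_open (r : nat) : subfunctor Pt2 := fun R x =>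
  [/\ Gr_eq (star (nu n r)) x.1, Gr x.2, exact (star (mu n)) x.2 x.1 &
      Gr_eq (nu n r + star (tau n)) x.2].

(* The fiber product over pairs: since [(E_1, E_2)] is determined by its images
   [E_1] and [E_2] in [Gr], a point of it is a point [x] of the first factor such
   that the pair [(x, varpi^(tau^* ) sigma(x))] is in [C] and in [Gr0_open]. *)
Definition Xb_open (r : nat) (C : subfunctor Pt2) : subfunctor Pt := fun R x =>
  Gr_eq (star (nu n r)) x /\
  let y := (x, cochar_act (star (tau n)) (frobPt x)) in C R y /\ Gr0_open r y.

Definition Xb (r : nat) (C : subfunctor Pt2) : subfunctor Pt :=
  closure_in X_mu_tau (Xb_open r C).

(* [F(E^dual)], seen in [B^n] by means of the hermitian form *)
Definition F_dual (R : palg) (E : set 'cV[Bring R]_n) : set 'cV[Bring R]_n :=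
  base_change (sigmaB R) (hdual E (std_lattice R 1)).

Definition DLPt : presheaf D :=
  @Presheaf D (fun R => set 'cV[R]_n)
    (fun R R' f U => mspan (idfun : {rmorphism R' -> R'}) ((map_mx f) @` U)).

Definition subbundle (R : palg) (m : nat) (U : set 'cV[R]_n) :=
  exists e : 'M[R]_n, [/\ e *m e = e, U = (mulmx e) @` setT &
    forall (K : palg) (f : palg_hom R K), is_field K ->
      exists b : 'I_m -> 'cV[K]_n,
        mbasis (idfun : {rmorphism K -> K}) b ((mulmx (map_mx f e)) @` setT)].

Definition F_perp (R : palg) (U : set 'cV[R]_n) : set 'cV[R]_n :=
  mspan (idfun : {rmorphism R -> R})
    ((map_mx (frobq (pa_k R))) @` [set y | forall x, U x -> y^T *m antidiag _ *m x = 0]).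

(* Subspaces [U] of rank [m] with [U] contained in [F(U^perp)].  On perfect
   algebras, a scheme and its perfection have the same points. *)
Definition DL (m : nat) : subfunctor DLPt :=
  fun R U => subbundle m U /\ U `<=` F_perp U.
End Grassmannian.
Arguments std_lattice {D} R m _.
Arguments std {D} n R.

(* Main.v *)
(** A lattice [E] with [E^0 <= E <= pi^-1 E^0] is the same as the subspace
    [U = pi E / pi E^0] of [R^n].  The positions [nu_r^*], [mu^*] and
    [nu_r + tau_r^*] are minuscule, so a modification bounded by one of them
    automatically has that exact position, and the position prescribes the rank of
    the corresponding subspace.  Hence, for [n = 2 r], the fiber [Gr^0] is the
    variety of flags [U_1 <= U_2] of ranks [r - 1] and [r + 1].  It is irreducible:
    it is the image of [GL_n], whose generic matrix lives over the perfection of a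
    localized polynomial ring; so its component is all of it.  Duality turns the
    lattice of [U] into the lattice of [U^perp], and the fiber product becomes the
    locus where [U] is contained in [F(U^perp)].  That locus is already closed in
    [X_(mu^* )(tau_r^* )], being cut out there by polar parts, minors and the entries of a
    matrix product, and it is the Deligne-Lusztig variety.

    Points with values in an arbitrary perfect [R] are compared through fields:
    elements of [R] vanish as soon as they vanish in all perfect fields under [R],
    and a matrix whose rank is the same at all such points has a direct summand as
    its column space. *)

From HB Require Import structures.
Require Import Defs.
From mathcomp Require Import all_boot all_order all_algebra.
From mathcomp Require Import generic_quotient ring_quotient.
From mathcomp Require Import boolp classical_sets.
From mathcomp Require mpoly.
From mathcomp Require Import zify ring.

Set Implicit Arguments.
Unset Strict Implicit.
Unset Printing Implicit Defensive.

Import GRing.Theory.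
Local Open Scope ring_scope.

(** * Witt vectors in characteristic p *)

(** All that is used of the ramified Witt vectors is that reduction maps them onto [R] with kernel
    generated by the uniformizer, that the uniformizer is a nonzerodivisor, that an element with
    invertible reduction is invertible, and that elements of [Bring R] have powers of the
    uniformizer as denominators. Regularity of the uniformizer is the delicate point: a tensor is
    zero only when every balanced map kills it, so a suitable target has to be built. It comes from
    [p] being a nonzerodivisor on [W(R)], where perfectness of [R] enters.

    A lattice over [Aring R] is projective without a given basis. It is therefore encoded by
    generators and dual functionals, and a subbundle by an idempotent matrix; both are transported
    along a ring morphism entry by entry, whereas the sets themselves are only transported through
    spans.

    For [n = 2 r] and [U] of rank [r - 1], the bundle [F(U^perp)] has rank [n - (r - 1) = r + 1].
    The difference with the rank of [U] is 2, the number of nonzero coordinates of [mu] on [GL_n];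
    this is why the isotropy condition and the bound by the dual of [mu] match. *)

Section WittCharP.
Variables (p : nat) (p_pr : prime p).
Local Notation W := (witt p_pr).

(** By induction the coordinates below [n] agree modulo [p], so their [p ^ (n - i)]-th powers agree
    modulo [p ^ (n - i + 1)]. Their contributions to the ghost component then cancel modulo
    [p ^ (n + 1)], and [p ^ n] can be divided out because [fring] has no torsion. *)
Lemma ghost_congr (a b : nat -> fring) :
  (forall n, exists z, ghost p a n = ghost p b n + z *+ (p ^ n.+1)) ->
  forall n, exists z, a n = b n + z *+ p.
Proof.
move=> h n; elim/ltn_ind: n => n IH.
have /choice[z hz] (i : 'I_n) : exists z,
    a i ^+ (p ^ (n - i)) = b i ^+ (p ^ (n - i)) + z *+ (p ^ (n - i).+1).
  by have [z hz] := IH i (ltn_ord i); exact: congr_pow_iter hz.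
have [u] := h n; rewrite !ghostS => hu.
have e : \sum_(i < n) a i ^+ (p ^ (n - i)) *+ (p ^ i) =
    \sum_(i < n) b i ^+ (p ^ (n - i)) *+ (p ^ i) + (\sum_(i < n) z i) *+ (p ^ n.+1).
  rewrite -sumrMnl -big_split; apply: eq_bigr => i _ /=.
  rewrite hz mulrnDl -mulrnA -expnD; congr (_ + _ *+ (p ^ _)).
  by have := ltn_ord i; lia.
exists (u - \sum_(i < n) z i); apply: (ftf p_pr (k := n)).
move: hu; rewrite e mulrnDl -mulrnA -expnS mulrnBl => hu.
by apply: (addrI (\sum_(i < n) b i ^+ (p ^ (n - i)) *+ (p ^ i) +
  (\sum_(i < n) z i) *+ (p ^ n.+1))); rewrite hu; ring.
Qed.

(** In characteristic [p], multiplication by [p] is Verschiebung composed with Frobenius. The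
    comparison is made on the generic Witt vector over [fring], where it holds modulo [p]; the error
    dies in [R]. *)
Lemma witt_mulpE (R : comPzRingType) (pR : forall z : R, z *+ p = 0) (a : W R) n :
  (a *+ p) n = if n is n'.+1 then a n' ^+ p else 0.
Proof.
have [h [<- _ _]] := witt_generic a a a.
set x : W fring := Witt _ _.
rewrite -(rmorphMn (wmap (p_pr:=p_pr) h)) /=.
(* The ghost component of index [m + 1] of [b] is that of [p x] without its last term
   [p ^ (m + 2) x_(m + 1)], which is exactly of the size allowed by [ghost_congr]. *)
pose b : nat -> fring := fun n => if n is n'.+1 then x n' ^+ p else 0.
have gM m k : ghost p (x *+ k) m = ghost p x m *+ k.
  by elim: k => [|k IH]; rewrite ?mulr0n ?ghost_zero // !mulrS ghost_add IH.
have [|z hz] := @ghost_congr (x *+ p) b _ n.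
  case=> [|m].
    exists (x 0%N); rewrite gM !ghostS !big_ord0 !add0r.
    by rewrite /= expn0 expn1 !mulr1n.
  exists (x m.+1); rewrite gM {1}/ghost [in RHS]/ghost big_ord_recr /= [in RHS]big_ord_recl /=.
  rewrite expr0n expn_eq0 /= subn0 addn0.
  have -> /= : (p == 0)%N = false by have := prime_gt0 p_pr; case: (p).
  rewrite mul0rn add0r mulrnDl subnn expr1 -mulrnA -expnSr; congr (_ + _).
  rewrite -sumrMnl; apply: eq_bigr => i _ /=.
  rewrite /bump /= add1n subSS -mulrnA -expnSr -exprM -expnS subSn //.
  by rewrite -ltnS.
rewrite hz rmorphD rmorphMn pR addr0.
by case: n {hz} => [|n] /=; rewrite ?rmorph0 // rmorphXn.
Qed.

Section Perfect.
Variable R : comPzRingType.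
Hypothesis pR : forall z : R, z *+ p = 0.
Hypothesis perfR : bijective (fun x : R => x ^+ p).

Lemma witt_mulp_inj (a : W R) : a *+ p = 0 -> a = 0.
Proof.
move=> h; apply: witt_inj => n.
apply: (bij_inj perfR); have := witt_mulpE pR a n.+1; rewrite h /= => <-.
by rewrite expr0n; have := prime_gt0 p_pr; case: (p).
Qed.

(** Verschiebung and Frobenius are undone by shifting the coordinates back and taking their [p]-th
    roots. *)
Lemma witt_divp (a : W R) : a 0%N = 0 -> exists b : W R, a = b *+ p.
Proof.
have [g gK Kg] := perfR.
move=> a0; exists (Witt p_pr (fun n => g (a n.+1))); apply: witt_inj => n.
by rewrite witt_mulpE //; case: n => //= n; rewrite Kg.
Qed.
End Perfect.
End WittCharP.

(** * Ramified Witt vectors *)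

Section TensorLift.
Variables (A B C : comPzRingType) (f : {rmorphism A -> B}) (g : {rmorphism A -> C}).
Local Notation tpure := (tpure f g).

Lemma tensor_sum (s : tpre f g) : qpi s = \sum_(t <- s) tpure t.1 t.2.
Proof.
elim: s => [|[b c] s IH]; first by rewrite big_nil -qpi0.
by rewrite big_cons -IH /Defs.tpure qpiD.
Qed.

Lemma tensorW (P : tensor f g -> Prop) :
  P 0 -> (forall x y, P x -> P y -> P (x + y)) -> (forall b c, P (tpure b c)) ->
  forall x, P x.
Proof.
move=> P0 PD Pp x; rewrite -(qreprK x) tensor_sum.
by apply: big_rec => // t y _ Py; exact: PD.
Qed.

Lemma tpureP (s t : tpre f g) : teq f g s t -> qpi s = qpi t.
Proof. by move=> h; apply/qpiP. Qed.

Lemma tpureDl b b' c : tpure (b + b') c = tpure b c + tpure b' c.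
Proof.
rewrite /Defs.tpure qpiD; apply: tpureP => M phi [h _ _].
by rewrite tsum_cat /tsum !big_seq1 h.
Qed.

Lemma tpureDr b c c' : tpure b (c + c') = tpure b c + tpure b c'.
Proof.
rewrite /Defs.tpure qpiD; apply: tpureP => M phi [_ h _].
by rewrite tsum_cat /tsum !big_seq1 h.
Qed.

Lemma tpure_bal b c a : tpure (b * f a) c = tpure b (g a * c).
Proof. by apply: tpureP => M phi [_ _ h]; rewrite /tsum !big_seq1 h. Qed.

Lemma tpureM b c b' c' : tpure b c * tpure b' c' = tpure (b * b') (c * c').
Proof. by rewrite /Defs.tpure qpiM. Qed.

Lemma tpure1 : tpure 1 1 = 1.
Proof. by []. Qed.

Lemma tpure0l c : tpure 0 c = 0.
Proof. by apply: (addrI (tpure 0 c)); rewrite -tpureDl !addr0. Qed.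

Lemma tpure0r b : tpure b 0 = 0.
Proof. by apply: (addrI (tpure b 0)); rewrite -tpureDr !addr0. Qed.

Lemma tpureNl b c : tpure (- b) c = - tpure b c.
Proof. by apply: (addrI (tpure b c)); rewrite -tpureDl !subrr tpure0l. Qed.

Variables (M : zmodType) (phi : B -> C -> M).
Hypothesis phib : balanced f g phi.

Definition tlift (x : tensor f g) : M := tsum phi (qrepr x).

Lemma tliftE s : tlift (qpi s) = tsum phi s.
Proof. by apply: (qpiK (s : tpre f g)). Qed.

Lemma tlift_pure b c : tlift (tpure b c) = phi b c.
Proof. by rewrite tliftE /tsum big_seq1. Qed.

Lemma tliftD : {morph tlift : x y / x + y}.
Proof.
move=> x y; rewrite -(qreprK x) -(qreprK y) qpiD !tliftE; exact: tsum_cat.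
Qed.

Lemma tlift0 : tlift 0 = 0.
Proof. by apply: (addrI (tlift 0)); rewrite -tliftD !addr0. Qed.

Lemma tliftN x : tlift (- x) = - tlift x.
Proof. by apply: (addrI (tlift x)); rewrite -tliftD !subrr tlift0. Qed.
End TensorLift.

Lemma tmap_pure (A B C B' C' : comPzRingType)
    (f : {rmorphism A -> B}) (g : {rmorphism A -> C})
    (f' : {rmorphism A -> B'}) (g' : {rmorphism A -> C'})
    (h : {rmorphism B -> B'}) (l : {rmorphism C -> C'})
    (hf : forall a, h (f a) = f' a) (lg : forall a, l (g a) = g' a) b c :
  tmap hf lg (tpure f g b c) = tpure f' g' (h b) (l c).
Proof. by rewrite tmapE. Qed.

(** This provides targets for balanced maps: showing that a tensor is nonzero requires an explicit
    abelian group in which it survives. *)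
Lemma zmod_quotient (V : zmodType) (S : set V) :
  S 0 -> (forall x y, S x -> S y -> S (x - y)) ->
  exists (Q : zmodType) (f : V -> Q),
    {morph f : x y / x + y} /\ forall x y, f x = f y <-> S (x - y).
Proof.
move=> S0 SB; pose I : pred V := fun v => `[< S v >].
have Iz : zmod_closed I.
  split=> [|x y]; rewrite !unfold_in; first exact/asboolP.
  by move=> /asboolP Sx /asboolP Sy; apply/asboolP; exact: SB.
pose J : zmodClosed V := HB.pack I (GRing.isZmodClosed.Build V I Iz).
exists (Quotient.quot J), (\pi_(Quotient.quot J))%qT; split.
  by move=> x y; rewrite raddfD.
move=> x y; split=> [/eqP|h].
  by rewrite -Quotient.idealrBE unfold_in => /asboolP.
by apply/eqP; rewrite -Quotient.idealrBE unfold_in; apply/asboolP.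
Qed.

(** * Finite levels and multiplication by the uniformizer between them *)

Section Levels.
Variable D : base_data.
Local Notation O := (lf_O D).
Local Notation k := (lf_k D).
Local Notation pi := (lf_pi D).
Local Notation p := (lf_p D).
Local Notation W := (witt (lf_p_prime D)).
Local Notation Wm := (@wmap _ (lf_p_prime D) _ _).
Local Notation mpi m := (modpi (pi ^+ m) : O -> modring (pi ^+ m)).

Lemma modringW m (P : modring (pi ^+ m) -> Prop) : (forall c, P (mpi m c)) -> forall x, P x.
Proof. by move=> h x; rewrite -(qreprK x); exact: h. Qed.

(** Raising the level by one makes multiplication by [pi] injective, which it is not inside a single
    quotient. *)
Definition mulpi m (x : modring (pi ^+ m)) : modring (pi ^+ m.+1) :=
  mpi m.+1 (pi * qrepr x).

Lemma mulpiE m c : mulpi (mpi m c) = mpi m.+1 (pi * c).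
Proof.
apply/modpiP; have [z hz] := qpiK (c : modpre (pi ^+ m)).
by exists z; rewrite -mulrBr hz mulrA -exprS.
Qed.

Lemma mulpiD m (x y : modring (pi ^+ m)) : mulpi (x + y) = mulpi x + mulpi y.
Proof.
elim/modringW: x => x; elim/modringW: y => y.
by rewrite -rmorphD !mulpiE mulrDr rmorphD.
Qed.

Lemma mulpi_scale m a (x : modring (pi ^+ m)) : mulpi (mpi m a * x) = mpi m.+1 a * mulpi x.
Proof.
elim/modringW: x => x.
by rewrite -rmorphM !mulpiE -rmorphM mulrCA.
Qed.

Lemma mulpi_inj m : injective (@mulpi m).
Proof.
elim/modringW=> x; elim/modringW=> y; rewrite !mulpiE => /modpiP[z hz].
apply/modpiP; exists z; apply: (mulfI (lf_pi_neq0 D)).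
by rewrite mulrBr hz exprS mulrA.
Qed.

Lemma mulpi_proj m (x : modring (pi ^+ m.+1)) :
  mulpi (modproj (pi_expS D m) x) = mpi m.+1 pi * x.
Proof. by elim/modringW: x => x; rewrite modprojE mulpiE rmorphM. Qed.

Lemma mulpi_proj2 m (x : modring (pi ^+ m.+1)) :
  modproj (pi_expS D m.+1) (mulpi x) = mulpi (modproj (pi_expS D m) x).
Proof. by elim/modringW: x => x; rewrite mulpiE !modprojE mulpiE. Qed.

(** The Teichmuller representative. *)
Definition wteich (R : comPzRingType) (r : R) : W R :=
  Witt _ (fun n => if n is 0%N then r else 0).

(** As [bd_W] lifts the identity of the residue field, subtracting the image of a Teichmuller
    representative leaves a multiple of [pi]. *)
Lemma level_decomp m (c : modring (pi ^+ m.+1)) :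
  exists (a : W k) c', c = mpi m.+1 (bd_W D a) + mulpi c'.
Proof.
elim/modringW: c => c.
have [|y hy] := (lf_res_ker (c - bd_W D (wteich (lf_res D c)))).1.
  by rewrite rmorphB bd_WP subrr.
exists (wteich (lf_res D c)), (mpi m y).
by rewrite mulpiE -hy -rmorphD addrC subrK.
Qed.

Lemma pi_dvd_p : exists t : O, 1 *+ p = pi * t.
Proof.
apply/lf_res_ker; rewrite rmorphMn rmorph1.
exact: pcharf0 (lf_p_char D).
Qed.
(** The quotient [p / pi]. *)
Definition ptail : O := sval (cid pi_dvd_p).
Lemma ptailE : 1 *+ p = pi * ptail.
Proof. by rewrite /ptail; case: cid. Qed.

Section Object.
Variables (R : comPzRingType) (j : {rmorphism k -> R}).
Local Notation WOlevel := (WOlevel j).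
Local Notation gm m := (modpi (pi ^+ m) \o bd_W D : {rmorphism W k -> modring (pi ^+ m)}).
Local Notation tp m := (tpure (Wm j) (gm m)).

Lemma charR (z : R) : z *+ p = 0.
Proof.
have := pcharf0 (lf_p_char D) => h.
by rewrite -mulr_natr -(rmorph_nat j) h rmorph0 mulr0.
Qed.

Fact shift_bal m : balanced (Wm j) (gm m) (fun w c => tp m.+1 w (mulpi c)).
Proof.
split=> [b b' c|b c c'|a b c]; first exact: tpureDl.
  by rewrite mulpiD tpureDr.
by rewrite tpure_bal mulpi_scale.
Qed.

(** The map induced by [mulpi] on the second factor. Multiplication by [pi] at level [m + 1] is
    truncation to level [m] followed by [shift] ([shift_mul]), so regularity of the uniformizer in
    the limit reduces to injectivity of [shift]. *)
Definition shift m : WOlevel m -> WOlevel m.+1 :=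
  @tlift _ _ _ (Wm j) (gm m) _ (fun w c => tp m.+1 w (mulpi c)).

Lemma shift_pure m w c : shift (tp m w c) = tp m.+1 w (mulpi c).
Proof. exact: tlift_pure (shift_bal m) _ _. Qed.

Lemma shiftD m : {morph @shift m : x y / x + y}.
Proof. exact: tliftD (shift_bal m). Qed.

Lemma shift0 m : @shift m 0 = 0.
Proof. exact: tlift0 (shift_bal m). Qed.

Lemma shiftN m x : @shift m (- x) = - shift x.
Proof. exact: tliftN (shift_bal m) _. Qed.

Lemma WOtrans_pure m w c : WOtrans j m (tp m.+1 w c) = tp m w (modproj (pi_expS D m) c).
Proof. exact: tmap_pure. Qed.

Lemma shift_trans m (x : WOlevel m.+1) : WOtrans j m.+1 (shift x) = shift (WOtrans j m x).
Proof.
elim/tensorW: x => [|x y hx hy|w c].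
- by rewrite !(shift0, rmorph0).
- by rewrite !(rmorphD, shiftD) hx hy.
- by rewrite WOtrans_pure !shift_pure WOtrans_pure mulpi_proj2.
Qed.

Lemma shift_mul m (x : WOlevel m.+1) :
  tinr (Wm j) (gm m.+1) (mpi m.+1 pi) * x = shift (WOtrans j m x).
Proof.
elim/tensorW: x => [|x y hx hy|w c].
- by rewrite rmorph0 shift0 mulr0.
- by rewrite mulrDr rmorphD shiftD hx hy.
- by rewrite WOtrans_pure shift_pure mulpi_proj /tinr tpureM mul1r.
Qed.

(** The part of the second factor coming from [W(k)] moves to the first factor by balance; what is
    left is a multiple of [pi]. *)
Lemma level_split m (x : WOlevel m.+1) : exists w y, x = tp m.+1 w 1 + shift y.
Proof.
elim/tensorW: x => [|x y [w [z ->]] [w' [z' ->]]|w c].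
- by exists 0, 0; rewrite tpure0l shift0 addr0.
- by exists (w + w'), (z + z'); rewrite tpureDl shiftD addrACA.
- have [a [c' ->]] := level_decomp c; exists (w * Wm j a), (tp m w c').
  by rewrite tpureDr shift_pure tpure_bal mulr1.
Qed.

Lemma tpure_p m w : tp m.+1 (w *+ p) 1 = shift (tp m w (mpi m ptail)).
Proof.
rewrite shift_pure mulpiE -ptailE rmorphMn rmorph1.
have -> : w *+ p = w * Wm j (1 *+ p) by rewrite rmorphMn rmorph1 mulr_natr.
by rewrite tpure_bal mulr1 /= rmorphMn rmorph1 rmorphMn rmorph1.
Qed.

Section ResidueLevel.
Variable m : nat.

Definition resm (c : modring (pi ^+ m.+1)) : k := lf_res D (qrepr c).

Lemma resmE c : resm (mpi m.+1 c) = lf_res D c.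
Proof.
have [z hz] := qpiK (c : modpre (pi ^+ m.+1)).
apply/eqP; rewrite -subr_eq0 -rmorphB; apply/eqP/lf_res_ker.
by exists (pi ^+ m * z); rewrite hz mulrA -exprS.
Qed.

Lemma witt0M (S : comPzRingType) (a b : W S) : (a * b) 0%N = a 0%N * b 0%N.
Proof.
have := ghost_mul a b 0; rewrite !ghostS !big_ord0 !add0r /=.
by rewrite !expn0 !mulr1n.
Qed.

Lemma witt0D (S : comPzRingType) (a b : W S) : (a + b) 0%N = a 0%N + b 0%N.
Proof.
have := ghost_add a b 0; rewrite !ghostS !big_ord0 !add0r /=.
by rewrite !expn0 !mulr1n.
Qed.

(** Balance expresses [bd_WP]: a Witt vector over [k] and its image in [O] have the same residue. *)
Fact redl_bal : balanced (Wm j) (gm m.+1) (fun w c => w 0%N * j (resm c)).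
Proof.
split=> [b b' c|b|a b].
- by rewrite witt0D mulrDl.
- elim/modringW=> c; elim/modringW=> c'.
  by rewrite -rmorphD !resmE rmorphD rmorphD mulrDr.
- elim/modringW=> c.
  rewrite witt0M -[gm m.+1 a]/(mpi m.+1 (bd_W D a)).
  by rewrite -rmorphM !resmE rmorphM bd_WP rmorphM mulrA.
Qed.

Definition redl : WOlevel m.+1 -> R :=
  @tlift _ _ _ (Wm j) (gm m.+1) _ (fun w c => w 0%N * j (resm c)).

Lemma redl_pure w c : redl (tp m.+1 w c) = w 0%N * j (resm c).
Proof. exact: tlift_pure redl_bal _ _. Qed.

Lemma redlD : {morph redl : x y / x + y}.
Proof. exact: tliftD redl_bal. Qed.

Lemma redl0 : redl 0 = 0.
Proof. exact: tlift0 redl_bal. Qed.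

Lemma redlM : {morph redl : x y / x * y}.
Proof.
move=> x y; elim/tensorW: x => [|x x' hx hx'|w c].
- by rewrite mul0r redl0 mul0r.
- by rewrite mulrDl !redlD hx hx' mulrDl.
- elim/tensorW: y => [|y y' hy hy'|w' c'].
  + by rewrite mulr0 redl0 mulr0.
  + by rewrite mulrDr !redlD hy hy' mulrDr.
  + rewrite tpureM !redl_pure witt0M.
    elim/modringW: c => c; elim/modringW: c' => c'.
    by rewrite -rmorphM !resmE !rmorphM mulrACA.
Qed.

Lemma redl1 : redl 1 = 1.
Proof. by rewrite -tpure1 redl_pure -(rmorph1 (modpi _)) resmE !rmorph1 mulr1. Qed.

Lemma redl_shift y : redl (shift y) = 0.
Proof.
elim/tensorW: y => [|x x' hx hx'|w c].
- by rewrite shift0 redl0.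
- by rewrite shiftD redlD hx hx' addr0.
- rewrite shift_pure redl_pure; elim/modringW: c => c.
  rewrite mulpiE resmE (_ : lf_res D (pi * c) = 0) ?rmorph0 ?mulr0 //.
  by apply/lf_res_ker; exists c.
Qed.
End ResidueLevel.

Lemma redl_trans m (x : WOlevel m.+2) : redl (WOtrans j m.+1 x) = redl x.
Proof.
elim/tensorW: x => [|x x' hx hx'|w c].
- by rewrite rmorph0 !redl0.
- by rewrite rmorphD !redlD hx hx'.
- by rewrite WOtrans_pure !redl_pure; elim/modringW: c => c; rewrite modprojE !resmE.
Qed.

Hypothesis perfR : bijective (fun x : R => x ^+ p).

(** After [level_split] only a tensor [w (x) 1] with [w 0 = 0] is left. Then [w = p u] by
    perfectness, and [p] is [pi] times [ptail]. *)
Lemma redl_ker m (x : WOlevel m.+1) : redl x = 0 -> exists y, x = shift y.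
Proof.
have [w [y ->]] := level_split x.
rewrite redlD redl_pure redl_shift addr0 -(rmorph1 (modpi _)) resmE !rmorph1 mulr1.
move=> /(witt_divp charR perfR)[u ->].
by exists (tp m u (mpi m ptail) + y); rewrite tpure_p shiftD.
Qed.

(* Multiplying by [pi] from level [m] to level [m + 1] is injective because the
   kernel would be [Tor_1(W(R), k)], and [W(R)] has no [p]-torsion. Concretely, a
   balanced map from level [m + 1] to the quotient of [W(R) + level m] by
   the elements [(p u, - u (x) p / pi)] detects it. *)
Section ShiftInjective.
Variable m : nat.
Local Notation V := (W R * WOlevel m)%type.

Fact pglueP : exists (Q : zmodType) (f : V -> Q), {morph f : x y / x + y} /\
  forall x y, f x = f y <-> exists u : W R, x - y = (u *+ p, - tp m u (mpi m ptail)).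
Proof.
apply: (@zmod_quotient V (fun v => exists u : W R,
  v = (u *+ p, - tp m u (mpi m ptail)))) => [|x y [u ->] [v ->]].
  by exists 0; rewrite mul0rn tpure0l oppr0.
by exists (u - v); rewrite mulrnBl tpureDl tpureNl opprD.
Qed.
Let Q := sval (cid pglueP).
Let piQ : V -> Q := sval (cid (svalP (cid pglueP))).
Let piQD : {morph piQ : x y / x + y} := (svalP (cid (svalP (cid pglueP)))).1.
Let pglue_eq := (svalP (cid (svalP (cid pglueP)))).2.

Let dec (c : modring (pi ^+ m.+1)) := cid (level_decomp c).
Let dec2 (c : modring (pi ^+ m.+1)) := cid (svalP (dec c)).
Let psi (w : W R) (c : modring (pi ^+ m.+1)) : Q :=
  piQ (w * Wm j (sval (dec c)), tp m w (sval (dec2 c))).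

(** Independence of the chosen decomposition: two choices differ by a Witt vector of [W(k)] with
    zero constant coordinate, hence by some [p u]. The two values then differ by one of the elements
    that are divided out. *)
Lemma psiE w a c' :
  psi w (mpi m.+1 (bd_W D a) + mulpi c') = piQ (w * Wm j a, tp m w c').
Proof.
rewrite /psi; case: (dec2 _) => d' /=; case: (dec _) => b /= hb e.
apply/pglue_eq.
have {e} e : mpi m.+1 (bd_W D (b - a)) = mulpi (c' - d').
  have -> : mulpi (c' - d') = mulpi c' - mulpi d'.
    by apply/(canRL (addrK _)); rewrite -mulpiD subrK.
  rewrite rmorphB rmorphB; apply/eqP; rewrite subr_eq.
  by rewrite addrAC -subr_eq opprK addrC -e addrC.
have : b 0%N = a 0%N.
  have : resm (mpi m.+1 (bd_W D (b - a))) = 0.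
    rewrite e; elim/modringW: (c' - d') => z; rewrite mulpiE resmE.
    by apply/lf_res_ker; exists z.
  rewrite resmE bd_WP => h; have := witt0D (b - a) a; rewrite subrK h add0r.
  by [].
move=> ba.
have perfk : bijective (fun x : k => x ^+ p).
  apply: injF_bij => x y.
  exact: (fmorph_inj (pFrobenius_aut (lf_p_char D))).
have chark (z : k) : z *+ p = 0.
  by rewrite -mulr_natr pcharf0 ?mulr0 // lf_p_char.
have [u hu] : exists u : W k, b - a = u *+ p.
  apply: (witt_divp chark perfk).
  by have := witt0D (b - a) a; rewrite subrK ba => h; apply: (addIr (a 0%N)); rewrite -h add0r.
exists (w * Wm j u); congr (_, _).
  by rewrite -mulrBr -rmorphB hu rmorphMn mulrnAr.
rewrite tpure_bal.
(* Injectivity of [mulpi] cancels [pi] in the equality of [pi (c' - d')] with [p u]. *)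
have -> : c' = d' + mpi m (bd_W D u) * mpi m ptail.
  rewrite addrC; apply: (canRL (subrK _)); apply: mulpi_inj.
  rewrite -e mulpi_scale mulpiE -ptailE hu.
  by rewrite -rmorphM mulrnAr mulr1 [bd_W D _]rmorphMn.
by rewrite tpureDr /= opprD addrA subrr add0r.
Qed.

Fact psi_bal : balanced (Wm j) (gm m.+1) psi.
Proof.
split=> [b b' c|b c c'|x b c].
- have [a [d ->]] := level_decomp c; rewrite !psiE.
  by rewrite mulrDl tpureDl -piQD.
- have [a [d ->]] := level_decomp c; have [a' [d' ->]] := level_decomp c'.
  have e : mpi m.+1 (bd_W D a) + mpi m.+1 (bd_W D a') = mpi m.+1 (bd_W D (a + a')).
    by rewrite !rmorphD.
  rewrite !psiE addrACA -mulpiD e psiE.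
  by rewrite rmorphD mulrDr tpureDr -piQD.
- have [a [d ->]] := level_decomp c.
  have e : mpi m.+1 (bd_W D x) * mpi m.+1 (bd_W D a) = mpi m.+1 (bd_W D (x * a)).
    by rewrite !rmorphM.
  by rewrite /= mulrDr -mulpi_scale e !psiE rmorphM mulrA tpure_bal.
Qed.

Lemma shift_inj : injective (@shift m).
Proof.
suff h (x : WOlevel m) : shift x = 0 -> x = 0.
  move=> x y e; apply/eqP; rewrite -subr_eq0; apply/eqP; apply: h.
  by rewrite shiftD shiftN e subrr.
move=> sx.
have pi0 : piQ 0 = 0 by apply: (addrI (piQ 0)); rewrite -piQD !addr0.
(* If [shift x = 0], this makes [(0, x)] trivial in the quotient, i.e. of the form
   [(p u, - u (x) p / pi)]. From [p u = 0] follows [u = 0], hence [x = 0]. *)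
have e y : tlift psi (shift y) = piQ (0, y).
  elim/tensorW: y => [|y y' hy hy'|w c].
  - by rewrite shift0 (tlift0 psi_bal) pi0.
  - by rewrite shiftD (tliftD psi_bal) hy hy' -piQD -[(0, y) + _]/(0 + 0, y + y') addr0.
  - rewrite shift_pure (tlift_pure psi_bal).
    by rewrite -[mulpi c]add0r -{1}(rmorph0 (gm m.+1)) psiE rmorph0 mulr0.
have := e x; rewrite sx (tlift0 psi_bal) => /esym.
rewrite -pi0 => /pglue_eq[u]; rewrite subr0 => -[/esym hu ->].
by rewrite (witt_mulp_inj charR perfR hu) tpure0l oppr0.
Qed.
End ShiftInjective.
End Object.
End Levels.

(** * Reduction and the uniformizer in the limit ring *)

Section WittO.
Variables (D : base_data) (R : comPzRingType) (j : {rmorphism lf_k D -> R}).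
Local Notation O := (lf_O D).
Local Notation k := (lf_k D).
Local Notation pi := (lf_pi D).
Local Notation p := (lf_p D).
Local Notation W := (witt (lf_p_prime D)).
Local Notation Wm := (@wmap _ (lf_p_prime D) _ _).
Local Notation mpi m := (modpi (pi ^+ m) : O -> modring (pi ^+ m)).
Local Notation gm m := (modpi (pi ^+ m) \o bd_W D : {rmorphism W k -> modring (pi ^+ m)}).
Local Notation tp m := (tpure (Wm j) (gm m)).
Local Notation vpi := (WO_const j pi).

Lemma WO_inj (x y : WO j) : (forall m, il_proj x m.+1 = il_proj y m.+1) -> x = y.
Proof.
move=> h; apply: invlim_inj => -[|m] //.
by rewrite -(il_coh x 0) -(il_coh y 0) h.
Qed.

(** Level 0 is the zero ring, so level 1 is the first one to see the residue; by [redE] every later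
    level gives the same value. *)
Definition red (x : WO j) : R := redl (il_proj x 1).

Lemma redE x m : redl (il_proj x m.+1) = red x.
Proof. by elim: m => // m <-; rewrite -redl_trans il_coh. Qed.

Fact red_rmorph : zmod_morphism red /\ monoid_morphism red.
Proof.
apply: rmorph_build => [x y|x y|]; rewrite /red ?redlD ?redlM //.
exact: redl1.
Qed.
HB.instance Definition _ := GRing.isZmodMorphism.Build (WO j) R red red_rmorph.1.
HB.instance Definition _ := GRing.isMonoidMorphism.Build (WO j) R red red_rmorph.2.

Lemma vpi_shift m (x : WO j) : il_proj (vpi * x) m.+1 = shift (il_proj x m).
Proof. by rewrite /= shift_mul il_coh. Qed.

Lemma red_vpi x : red (vpi * x) = 0.
Proof. by rewrite /red vpi_shift redl_shift. Qed.

Fact WOteich_coh (r : R) m :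
  WOtrans j m (tp m.+1 (wteich D r) 1) = tp m (wteich D r) 1.
Proof. by rewrite WOtrans_pure rmorph1. Qed.
Definition WOteich (r : R) : WO j := @InvLim _ (WOtrans j) _ (WOteich_coh r).

Lemma red_teich r : red (WOteich r) = r.
Proof. by rewrite /red /= redl_pure -(rmorph1 (modpi _)) resmE !rmorph1 mulr1. Qed.

Lemma WOteich0 : WOteich 0 = 0.
Proof.
apply: invlim_inj => m /=; rewrite -[RHS](@tpure0l _ _ _ (Wm j) (gm m) 1).
by congr (tp m _ 1); apply: witt_inj => -[].
Qed.

Lemma vpi_nilp (x : WO j) m : il_proj (vpi ^+ m * x) m = 0.
Proof.
elim: m x => [|m IH] x.
  elim/tensorW: (il_proj _ _) => [|y z -> ->|b c]; rewrite ?addr0 //.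
  rewrite (_ : c = 0) ?tpure0r //; elim/modringW: c => c.
  by rewrite -(rmorph0 (modpi _)); apply/modpiP; exists c; rewrite subr0 mul1r.
by rewrite exprS -mulrA vpi_shift IH shift0.
Qed.

(** The geometric series: its sum up to [m] is already the inverse at level [m], and these sums are
    coherent, since the [m]-th power of the uniformizer vanishes at level [m]. *)
Lemma invr_one_sub (z : WO j) : exists y, (1 - vpi * z) * y = 1.
Proof.
pose s m := \sum_(i < m) (vpi * z) ^+ i.
have sc m : WOtrans j m (il_proj (s m.+1) m.+1) = il_proj (s m) m.
  rewrite il_coh /s big_ord_recr /= exprMn vpi_nilp addr0 //.
exists (@InvLim _ (WOtrans j) (fun m => il_proj (s m) m) sc); apply: invlim_inj => m.
suff : il_proj ((1 - vpi * z) * s m) m = il_proj (1 : WO j) m by [].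
rewrite /s -opprB mulNr -subrX1 opprB exprMn.
rewrite -[LHS]/(il_proj (1 : WO j) m - il_proj (vpi ^+ m * z ^+ m) m).
by rewrite vpi_nilp subr0.
Qed.

Hypothesis perfR : bijective (fun x : R => x ^+ p).

(** The component of [x] at level [m] is seen, through the injective [shift], in the component of
    its multiple at level [m + 1]. *)
Lemma vpi_reg (x : WO j) : vpi * x = 0 -> x = 0.
Proof.
move=> h; apply: invlim_inj => m; apply: (shift_inj perfR).
by rewrite -vpi_shift h shift0.
Qed.

(** The preimages under [shift] at the various levels are unique, and therefore form a coherent
    family. *)
Lemma red_ker (x : WO j) : red x = 0 -> exists y, x = vpi * y.
Proof.
move=> h.
have ex m : exists y, il_proj x m.+1 = shift y.
  by apply: (redl_ker perfR); rewrite redE.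
pose y m := sval (cid (ex m)).
have hy m : il_proj x m.+1 = shift (y m) := svalP (cid (ex m)).
have yc m : WOtrans j m (y m.+1) = y m.
  by apply: (shift_inj perfR); rewrite -shift_trans -!hy il_coh.
by exists (InvLim yc); apply: WO_inj => m; rewrite vpi_shift hy.
Qed.

Lemma WO_decomp (x : WO j) : exists y, x = WOteich (red x) + vpi * y.
Proof.
have [|y hy] := @red_ker (x - WOteich (red x)).
  by rewrite rmorphB /= red_teich subrr.
by exists y; rewrite -hy addrC subrK.
Qed.

Lemma WO_unit (x : WO j) r : red x * r = 1 -> exists y, x * y = 1.
Proof.
move=> h; have [|z hz] := @red_ker (1 - x * WOteich r).
  by rewrite rmorphB rmorphM rmorph1 /= red_teich h subrr.
have [y hy] := invr_one_sub z; exists (WOteich r * y).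
by rewrite mulrA -hy -hz opprB addrC subrK.
Qed.
End WittO.

Section WittOMap.
Variables (D : base_data) (R R' : comPzRingType).
Variables (j : {rmorphism lf_k D -> R}) (j' : {rmorphism lf_k D -> R'}).
Variables (f : {rmorphism R -> R'}) (fj : forall c, f (j c) = j' c).

Lemma red_map (x : WO j) : red (WOmap fj x) = f (red x).
Proof.
rewrite /red /=; elim/tensorW: (il_proj x 1) => [|y z hy hz|w c].
- by rewrite rmorph0 !redl0 rmorph0.
- by rewrite rmorphD !redlD hy hz rmorphD.
- rewrite [X in redl X]tmap_pure !redl_pure; elim/modringW: c => c.
  by rewrite !resmE rmorphM fj.
Qed.

Lemma WOmap_teich r : WOmap fj (WOteich j r) = WOteich j' (f r).
Proof.
apply: invlim_inj => m /=; rewrite tmap_pure; congr (tpure _ _ _ _).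
by apply: witt_inj => -[|i] //=; rewrite rmorph0.
Qed.
End WittOMap.

(** * Points with values in perfect fields *)

Section MaximalIdeal.
Variable R : comPzRingType.

Definition pre_ideal (I : set R) :=
  [/\ forall x y, I x -> I y -> I (x + y), forall c x, I x -> I (c * x) & ~ I 1].

Lemma ex_maximal_ideal : (1 : R) <> 0 -> exists I : set R,
  [/\ pre_ideal I, I 0 & forall x, ~ I x -> exists y, I (1 - x * y)].
Proof.
move=> n10.
have [|I [PI maxI]] := @Zorn_bigcup R pre_ideal.
  move=> F FP tot; split.
  - move=> x y [A FA Ax] [B FB By].
    have [AB|BA] := tot A B FA FB.
    + by exists B => //; have [h _ _] := FP _ FB; apply: h => //; exact: AB.
    + by exists A => //; have [h _ _] := FP _ FA; apply: h => //; exact: BA.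
  - by move=> c x [A FA Ax]; exists A => //; have [_ h _] := FP _ FA; exact: h.
  - by move=> [A FA A1]; have [_ _] := FP _ FA.
have [ID IM I1] := PI.
have I0 : I 0.
  apply: contrapT => nI0.
  have IE x : ~ I x by move=> Ix; apply: nI0; rewrite -(mul0r x); exact: IM.
  apply: (maxI (fun x => x = 0)); last first.
    split=> [x y -> ->|c x ->|/esym //]; rewrite ?addr0 ?mulr0 //.
  by split=> [x /IE //|/(_ 0 erefl)/nI0].
exists I; split=> // x nIx; apply: contrapT => h.
apply: (maxI (fun z => exists a b, I a /\ z = a + b * x)); last first.
  split.
  - move=> _ _ [a [b [Ia ->]]] [a' [b' [Ia' ->]]].
    by exists (a + a'), (b + b'); split; [exact: ID|ring].
  - move=> c _ [a [b [Ia ->]]].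
    by exists (c * a), (c * b); split; [exact: IM|ring].
  - move=> [a [b [Ia e]]]; apply: h; exists b.
    by rewrite e [x * b]mulrC addrK.
split=> [z Iz|]; first by exists z, 0; split=> //; ring.
move=> /(_ x) ex; apply/nIx/ex; exists 0, 1; split=> //; ring.
Qed.

Variable I : set R.
Hypotheses (ID : forall x y, I x -> I y -> I (x + y)).
Hypotheses (IM : forall c x, I x -> I (c * x)) (I0 : I 0).

Lemma idl_eq0 x : x = 0 -> I x.
Proof. by move=> ->. Qed.
Lemma idl_eq x y : x = y -> I y -> I x.
Proof. by move=> ->. Qed.

Definition idlpre : preRing.
Proof.
refine (@PreRing R (fun x y => I (x - y)) 0 1 -%R +%R *%R _ _ _ _ _ _ _ _ _ _ _ _ _ _).
- by move=> x; apply: idl_eq0; ring.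
- by move=> x y h; apply: (idl_eq _ (IM (-1) h)); ring.
- by move=> y x z h h'; apply: (idl_eq _ (ID h h')); ring.
- by move=> x y h; apply: (idl_eq _ (IM (-1) h)); ring.
- by move=> x x' y y' h h'; apply: (idl_eq _ (ID h h')); ring.
- by move=> x x' y y' h h'; apply: (idl_eq _ (ID (IM y h) (IM x' h'))); ring.
- by move=> *; apply: idl_eq0; ring.
- by move=> *; apply: idl_eq0; ring.
- by move=> *; apply: idl_eq0; ring.
- by move=> *; apply: idl_eq0; ring.
- by move=> *; apply: idl_eq0; ring.
- by move=> *; apply: idl_eq0; ring.
- by move=> *; apply: idl_eq0; ring.
- by move=> *; apply: idl_eq0; ring.
Defined.

Lemma ex_quotient : exists (Q : comPzRingType) (f : {rmorphism R -> Q}),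
  (forall y, exists x, f x = y) /\ (forall x, f x = 0 <-> I x).
Proof.
pose f (x : R) : quot idlpre := qpi (x : idlpre).
have fr : zmod_morphism f /\ monoid_morphism f.
  by apply: rmorph_build => [x y|x y|] //; rewrite /f ?qpiD ?qpiM.
pose g : {rmorphism R -> quot idlpre} := HB.pack f
  (GRing.isZmodMorphism.Build _ _ f fr.1) (GRing.isMonoidMorphism.Build _ _ f fr.2).
exists (quot idlpre), g; split=> [y|x].
  by exists (qrepr y); exact: qreprK.
have -> : (g x = 0) = (qpi (x : idlpre) = qpi (0 : idlpre)) by [].
by rewrite qpiP /= subr0.
Qed.
End MaximalIdeal.

Section FieldPoints.
Variable D : base_data.
Local Notation p := (lf_p D).

Lemma expp_inj_of (R : comPzRingType) : (forall z : R, z *+ p = 0) ->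
  (forall z : R, z ^+ p = 0 -> z = 0) -> injective (fun x : R => x ^+ p).
Proof.
move=> ch h x y /= e.
have [z] := binom_p (lf_p_prime D) y (x - y).
rewrite addrC subrK ch addr0 e => /eqP; rewrite -subr_eq0 opprD addrA subrr add0r oppr_eq0.
by move=> /eqP/h/eqP; rewrite subr_eq0 => /eqP.
Qed.

Lemma expp_bij (R : comPzRingType) : (forall z : R, z *+ p = 0) ->
  (forall z : R, z ^+ p = 0 -> z = 0) -> (forall y : R, exists x, y = x ^+ p) ->
  bijective (fun x : R => x ^+ p).
Proof.
move=> ch h /choice[g gK]; exists g => [x|x]; last by rewrite -gK.
by apply: (expp_inj_of ch h); rewrite /= -gK.
Qed.

Lemma palg_reduced (R : palg D) (x : R) : x ^+ p = 0 -> x = 0.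
Proof.
move=> h; apply: (bij_inj (pa_perfect R)); rewrite /= h expr0n.
by have := prime_gt0 (lf_p_prime D); case: (p).
Qed.

Lemma palg_root (R : palg D) (y : R) : exists x, y = x ^+ p.
Proof. by have [g gK Kg] := pa_perfect R; exists (g y); rewrite Kg. Qed.

Lemma palg_nilp (R : palg D) (x : R) m : x ^+ m = 0 -> x = 0.
Proof.
move=> h; have {h} : x ^+ (p ^ m) = 0.
  have : (m <= p ^ m)%N by rewrite ltnW // ltn_expl // prime_gt1 // lf_p_prime.
  by move=> /subnK <-; rewrite exprD h mulr0.
elim: m x => [|m IH] x; first by rewrite expn0 expr1.
by rewrite expnS exprM => /IH /palg_reduced.
Qed.

(** A localization of a perfect algebra is perfect. The four properties are the invertibility of
    [a], the kernel, the form of the elements as fractions, and the universal property. *)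
Lemma palg_localization (R : palg D) (a : R) : exists (R' : palg D) (f : palg_hom R R'),
  [/\ exists y, f a * y = 1, forall x, f x = 0 -> exists m, a ^+ m * x = 0,
   (forall z, exists x m, f a ^+ m * z = f x) &
   forall (S : palg D) (g : palg_hom R S) y, g a * y = 1 ->
     exists h : palg_hom R' S, forall x, h (f x) = g x].
Proof.
pose L : comPzRingType := loc a.
pose j : {rmorphism R -> L} := locin a.
have jE x m : locfrac a x m * j a ^+ m = j x.
  rewrite -rmorphXn /j /= /locin /locfrac [LHS](qpiM ((x, m) : locpre a)).
  apply/locfracP; apply: loceq_of; rewrite /= expr0 mul1r addn0; exact: mulrC.
have ja m : locfrac a 1 m * j a ^+ m = 1 by rewrite jE rmorph1.
have j0 x : j x = 0 -> exists m, a ^+ m * x = 0.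
  rewrite -(rmorph0 j) => /locfracP[m /=]; rewrite !addn0 mulr0 => h.
  by exists m.
have Lz (z : L) : exists x m, j a ^+ m * z = j x.
  rewrite -(qreprK z); case: (qrepr z) => x m; exists x, m.
  by rewrite mulrC; exact: jE.
have ch (z : L) : z *+ p = 0 by exact: (charR (j \o pa_k R)).
have jau m (z w : L) : j a ^+ m * z = j a ^+ m * w -> z = w.
  by move=> h; rewrite -[z]mul1r -[w]mul1r -(ja m) -!mulrA h.
have perfL : bijective (fun x : L => x ^+ p).
  apply: expp_bij => // z.
    have [x [m e]] := Lz z => z0.
    have : j (x ^+ p) = 0.
      by rewrite rmorphXn -e exprMn z0 mulr0.
    move=> /j0[l hl]; have {}hl : a ^+ l * x = 0.
      apply: palg_reduced; rewrite exprMn.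
      have := lf_p_prime D; move/prime_gt0; case: (p) hl => // q hl _.
      by rewrite exprS -mulrA [_ ^+ q * _]mulrC mulrA hl mul0r.
    apply: (jau m); rewrite e mulr0; apply: (jau l).
    by rewrite -rmorphXn -rmorphM hl rmorph0 mulr0.
  have [x [m e]] := Lz z.
  (* A root of [x / a ^ m] is sought with denominator [a ^ m]; the [p]-th power of its numerator
     must be [a ^ (m p - m) x]. *)
  have [y hy] := palg_root (a ^+ (m * p.-1) * x).
  exists (locfrac a y m); apply: (jau (m * p)%N).
  rewrite [in RHS]exprM -exprMn [_ ^+ m * _]mulrC jE -(rmorphXn j p y) -hy rmorphM rmorphXn -e.
  rewrite mulrA -exprD; congr (_ ^+ _ * _).
  have := prime_gt0 (lf_p_prime D); nia.
pose R' := @PAlg D L (j \o pa_str R) perfL.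
pose f : palg_hom R R' := @PAlgHom D R R' j (fun=> erefl).
exists R', f; split=> //.
  by exists (locfrac a 1 1); rewrite mulrC -[X in _ * X]expr1; exact: ja.
move=> S g y gy.
pose h0 (z : L) : S := g (qrepr z).1 * y ^+ (qrepr z).2.
have h0E x m : h0 (locfrac a x m) = g x * y ^+ m.
  rewrite /h0; have := qpiK ((x, m) : locpre a).
  rewrite -/(locfrac a x m); case: (qrepr _) => x' m' [N /= e].
  have {e} := congr1 (fun t => g t * y ^+ (N + m + m')) e.
  rewrite !rmorphM !rmorphXn.
  have gyE l : g a ^+ l * y ^+ l = 1 by rewrite -exprMn gy expr1n.
  rewrite {1}(exprD y) mulrACA gyE mul1r => ->.
  rewrite (_ : N + m + m' = N + m' + m)%N; last by lia.
  by rewrite (exprD y) mulrACA gyE mul1r.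
have h0W (P : L -> Prop) : (forall x m, P (locfrac a x m)) -> forall z, P z.
  by move=> hP z; rewrite -(qreprK z); case: (qrepr z) => x m; exact: hP.
have gyE l : g a ^+ l * y ^+ l = 1 by rewrite -exprMn gy expr1n.
have hr : zmod_morphism h0 /\ monoid_morphism h0.
  apply: rmorph_build.
  - elim/h0W=> x m; elim/h0W=> x' m'.
    rewrite /locfrac (qpiD ((x, m) : locpre a)) -/(locfrac a _ _) !h0E.
    rewrite rmorphD !rmorphM !rmorphXn exprD mulrDl; congr (_ + _).
      by rewrite [y ^+ m * _]mulrC mulrACA gyE mul1r.
    by rewrite mulrACA gyE mul1r.
  - elim/h0W=> x m; elim/h0W=> x' m'.
    rewrite /locfrac (qpiM ((x, m) : locpre a)) -/(locfrac a _ _) !h0E.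
    by rewrite rmorphM exprD mulrACA.
  - by rewrite -[1](rmorph1 j) [LHS]h0E rmorph1 mulr1.
pose h : {rmorphism L -> S} := HB.pack h0
  (GRing.isZmodMorphism.Build _ _ h0 hr.1) (GRing.isMonoidMorphism.Build _ _ h0 hr.2).
have hj x : h (j x) = g x by rewrite [LHS]h0E mulr1.
have hs c : h (pa_str R' c) = pa_str S c by rewrite [LHS]hj ph_str.
by exists (@PAlgHom D R' S h hs).
Qed.

(** A field quotient inherits surjectivity of Frobenius, and a field is reduced, so it is perfect.
    Dividing by [I0] first produces a maximal ideal above [I0]. *)
Lemma palg_residue_field (R : palg D) (I0 : set R) : pre_ideal I0 -> I0 0 ->
  exists (K : palg D) (f : palg_hom R K), is_field K /\ forall x, I0 x -> f x = 0.
Proof.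
move=> [ID0 IM0 I10] I00; have [Q0 [f0 [f0s f0k]]] := ex_quotient ID0 IM0 I00.
have n10 : (1 : Q0) <> 0 by rewrite -(rmorph1 f0) => /f0k.
have [I [[ID IM I1] Iz Imax]] := ex_maximal_ideal n10.
have [Q [f1 [f1s f1k]]] := ex_quotient ID IM Iz.
pose f : {rmorphism R -> Q} := f1 \o f0.
have fs y : exists x, f x = y.
  by have [x0 <-] := f1s y; have [x <-] := f0s x0; exists x.
have Qf : (1 : Q) <> 0 /\ forall x : Q, x <> 0 -> exists y, x * y = 1.
  split; first by rewrite -(rmorph1 f1) => /f1k.
  move=> y; have [x <-] := f1s y => h.
  have [|z hz] := Imax x; first by move=> /f1k.
  exists (f1 z); apply/eqP; rewrite eq_sym -subr_eq0 -rmorphM -(rmorph1 f1) -rmorphB.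
  exact/eqP/f1k.
have ch (z : Q) : z *+ p = 0 by exact: (charR (f \o pa_k R)).
have perfQ : bijective (fun x : Q => x ^+ p).
  apply: expp_bij => // z.
    move=> zp; apply: contrapT => /Qf.2[y hy]; apply: Qf.1.
    rewrite -(expr1n _ p) -hy exprMn zp mul0r //.
  have [x <-] := fs z; have [y ->] := palg_root x.
  by exists (f y); rewrite rmorphXn.
pose K := @PAlg D Q (f \o pa_str R) perfQ.
exists K, (@PAlgHom D R K f (fun=> erefl)); split=> // x /f0k e.
by rewrite /= e rmorph0.
Qed.

Fact hom_comp_str (R R' R'' : palg D) (g : palg_hom R' R'') (f : palg_hom R R') c :
  (g \o f : {rmorphism R -> R''}) (pa_str R c) = pa_str R'' c.
Proof. by rewrite /= !ph_str. Qed.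
Definition hom_comp (R R' R'' : palg D) (g : palg_hom R' R'') (f : palg_hom R R') :
  palg_hom R R'' := PAlgHom (hom_comp_str g f).
Definition hom_id (R : palg D) : palg_hom R R :=
  @PAlgHom D R R (idfun : {rmorphism R -> R}) (fun=> erefl).

(** A perfect ring is reduced, so inverting a nonzero [a] gives a nonzero ring; any residue field of
    it will do. *)
Lemma field_point (R : palg D) (a : R) : a <> 0 ->
  exists (K : palg D) (f : palg_hom R K), is_field K /\ f a <> 0.
Proof.
move=> a0; have [R' [f [[y hy] f0 _ _]]] := palg_localization a.
have n10 : (1 : R') <> 0.
  rewrite -(rmorph1 f) => /f0[m]; rewrite mulr1 => /palg_nilp; exact: a0.
have [|//|K [g [Kf _]]] := @palg_residue_field R' (fun x => x = 0).
  by split=> [u z -> ->|c z ->|/n10]; rewrite ?addr0 ?mulr0.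
exists K, (hom_comp g f); split=> // h; apply: Kf.1.
by rewrite -(rmorph1 g) -hy rmorphM [g (f a)]h mul0r.
Qed.

Lemma field_descent (R : palg D) (a : R) :
  (forall (K : palg D) (f : palg_hom R K), is_field K -> f a = 0) -> a = 0.
Proof.
move=> h; apply: contrapT => /field_point[K [f [Kf]]]; apply.
exact: h.
Qed.
End FieldPoints.

(** * Lattices given by matrices *)

(** The sum serves as an exponent large enough to clear all of finitely many denominators. *)
Lemma nat_sum_split (I : finType) (l : I -> nat) i : exists d, (\sum_j l j = l i + d)%N.
Proof.
exists (\sum_j l j - l i)%N; rewrite subnKC // (bigD1 i) //=; exact: leq_addr.
Qed.

Lemma mulr_cancel (S : comPzRingType) (u z x y : S) : u * z = 1 -> u * x = u * y -> x = y.
Proof.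
by move=> uz e; rewrite -[x]mul1r -[y]mul1r -uz mulrC mulrA [x * u]mulrC e; ring.
Qed.

Section LatticeMatrices.
Section OneRing.
Variables (A B : comPzRingType) (iota : {rmorphism A -> B}).

Definition integral (x : B) := exists a, x = iota a.

Lemma integralM x y : integral x -> integral y -> integral (x * y).
Proof. by move=> [a ->] [b ->]; exists (a * b); rewrite rmorphM. Qed.
Definition intM m n (M : 'M[B]_(m, n)) := exists N, M = map_mx iota N.

Lemma intMP m n (M : 'M[B]_(m, n)) : intM M <-> forall i j, integral (M i j).
Proof.
split=> [[N ->] i j|h]; first by exists (N i j); rewrite mxE.
exists (\matrix_(i, j) sval (cid (h i j))); apply/matrixP => i j.
by rewrite !mxE; case: cid.
Qed.

Lemma intMM m n q (M : 'M[B]_(m, n)) (N : 'M[B]_(n, q)) :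
  intM M -> intM N -> intM (M *m N).
Proof. by move=> [M' ->] [N' ->]; exists (M' *m N'); rewrite map_mxM. Qed.
Lemma intMD m n (M N : 'M[B]_(m, n)) : intM M -> intM N -> intM (M + N).
Proof. by move=> [M' ->] [N' ->]; exists (M' + N'); rewrite map_mxD. Qed.
Lemma intM_map m n (M : 'M[A]_(m, n)) : intM (map_mx iota M).
Proof. by exists M. Qed.
Lemma intM1 n : intM (1%:M : 'M[B]_n).
Proof. by exists 1%:M; rewrite map_mx1. Qed.
Lemma intMZ m n (M : 'M[B]_(m, n)) a : intM M -> intM (iota a *: M).
Proof. by move=> [M' ->]; exists (a *: M'); rewrite map_mxZ. Qed.
Lemma intM0 m n : intM (0 : 'M[B]_(m, n)).
Proof. by exists 0; rewrite map_mx0. Qed.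
(** A dual basis in matrix form: the columns of [b] generate, the rows of [phi] are coordinate
    functionals. The first condition says that the coordinates reconstruct a vector, the second that
    they are integral on the generators. As [m] may exceed [n], lattices without a basis are
    covered. *)
Definition adm n m (b : 'M[B]_(n, m)) (phi : 'M[B]_(m, n)) :=
  b *m phi = 1%:M /\ intM (phi *m b).

(** Describing the lattice by its functionals turns membership and inclusions into integrality of
    matrices. *)
Definition latM n m (phi : 'M[B]_(m, n)) : set 'cV[B]_n :=
  fun v => intM (phi *m v).

Hypothesis iota_inj : injective iota.
Variable w : A.
Hypothesis wunit : forall m, exists y, iota (w ^+ m) * y = 1.
Hypothesis denom : forall x : B, exists m a, iota (w ^+ m) * x = iota a.

Lemma wreg m x y : iota (w ^+ m) * x = iota (w ^+ m) * y -> x = y.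
Proof. by have [z hz] := wunit m; exact: mulr_cancel hz. Qed.

Lemma wregM n q m (M N : 'M[B]_(n, q)) :
  iota (w ^+ m) *: M = iota (w ^+ m) *: N -> M = N.
Proof.
move=> /matrixP h; apply/matrixP => i j; apply: (@wreg m).
by have := h i j; rewrite mxE [RHS]mxE.
Qed.

Lemma intM_denom m n (M : 'M[B]_(m, n)) : exists l : nat, intM (iota (w ^+ l) *: M).
Proof.
have h (ij : 'I_m * 'I_n) : exists l, integral (iota (w ^+ l) * M ij.1 ij.2).
  by have [l [a e]] := denom (M ij.1 ij.2); exists l, a.
have /choice[l hl] := h.
exists (\sum_ij l ij)%N; apply/intMP => i j; rewrite mxE.
have [d ->] := nat_sum_split l (i, j).
rewrite exprD rmorphM -mulrA mulrCA; apply: integralM; first by eexists.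
exact: (hl (i, j)).
Qed.

Lemma lincombE n m (c : 'I_m -> A) (b : 'I_m -> 'cV[B]_n) :
  lincomb iota c b = (\matrix_(i, j) b j i 0) *m map_mx iota (\col_j c j).
Proof.
apply/matrixP => i j; rewrite (ord1 j) /lincomb summxE !mxE.
by apply: eq_bigr => l _; rewrite !mxE mulrC.
Qed.

Lemma latM_gen n m (b : 'M[B]_(n, m)) (phi : 'M[B]_(m, n)) v : adm b phi ->
  latM phi v <-> exists c, v = b *m map_mx iota c.
Proof.
move=> [h1 h2]; split=> [[c hc]|[c ->]].
  by exists c; rewrite -hc mulmxA h1 mul1mx.
by rewrite /latM mulmxA; apply: intMM => //; exact: intM_map.
Qed.

Lemma latM_col n m (b : 'M[B]_(n, m)) (phi : 'M[B]_(m, n)) j : adm b phi ->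
  latM phi (col j b).
Proof.
move=> [_ h2]; rewrite /latM colE mulmxA -colE; apply/intMP => i l; rewrite mxE.
by have /intMP := h2; apply.
Qed.

Lemma latM_submodule n m (phi : 'M[B]_(m, n)) : submodule iota (latM phi).
Proof.
rewrite /latM; split=> [|u v|c v].
- by rewrite mulmx0; exact: intM0.
- by rewrite mulmxDr; exact: intMD.
- by rewrite -scalemxAr; exact: intMZ.
Qed.

Lemma latM_fg_projective n m (b : 'M[B]_(n, m)) (phi : 'M[B]_(m, n)) :
  adm b phi -> fg_projective iota (latM phi).
Proof.
move=> h; exists m, (fun j => col j b).
  (* The functionals must be total on [B^n]; the value 0 fills in where the coordinate is not
     integral, which never happens on the lattice. *)
  pose f (j : 'I_m) (v : 'cV[B]_n) : A :=
    if pselect (integral ((phi *m v) j 0)) is left e then sval (cid e) else 0.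
  have fE j v : latM phi v -> iota (f j v) = (phi *m v) j 0.
    move=> /intMP/(_ j 0) i; rewrite /f; case: pselect => // e.
    by case: cid.
  have [sm0 smD smZ] := latM_submodule phi.
  exists f; split=> [j|j u v hu hv|j c v hv|v hv].
  - exact: (latM_col j h).
  - apply: iota_inj; rewrite rmorphD !fE //; last exact: smD.
    by rewrite mulmxDr mxE.
  - apply: iota_inj; rewrite rmorphM !fE //; last exact: smZ.
    by rewrite -scalemxAr mxE.
  - rewrite lincombE -[LHS]mul1mx -h.1 -mulmxA; congr (_ *m _).
      by apply/matrixP => i j; rewrite !mxE.
    apply/matrixP => i j; rewrite (ord1 j) [RHS]mxE [X in iota X]mxE fE //.
Qed.

Lemma latM_absorb n m (phi : 'M[B]_(m, n)) v : exists l, latM phi (iota (w ^+ l) *: v).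
Proof. by have [l hl] := intM_denom (phi *m v); exists l; rewrite /latM -scalemxAr. Qed.

Lemma submodule_lincomb n (E : set 'cV[B]_n) m (c : 'I_m -> A) b : submodule iota E ->
  (forall j, E (b j)) -> E (lincomb iota c b).
Proof.
move=> [E0 ED EZ] h; rewrite /lincomb; elim/big_rec: _ => // j x _ Ex.
by apply: ED => //; exact: EZ.
Qed.

(** Since [E] absorbs every vector after scaling, each functional of a dual basis of [E] extends
    linearly to [B^n], and the extensions form [phi]. *)
Lemma fg_projective_latM n (E : set 'cV[B]_n) : submodule iota E -> fg_projective iota E ->
  (forall v, exists l, E (iota (w ^+ l) *: v)) ->
  exists m (b : 'M[B]_(n, m)) (phi : 'M[B]_(m, n)), adm b phi /\ E = latM phi.
Proof.
move=> smE [m [b [f [Eb fD fZ fE]]]] absE.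
have [E0 ED EZ] := smE.
have /choice[N hN] (i : 'I_n) := absE (delta_mx i 0).
have /choice[y hy] (i : 'I_n) := wunit (N i).
pose bM : 'M[B]_(n, m) := \matrix_(i, j) b j i 0.
(* [w ^ N i] times the [i]-th basis vector lies in [E], where [f j] is meaningful; [y i] divides by
   [w ^ N i] again. *)
pose phi : 'M[B]_(m, n) :=
  \matrix_(j, i) (iota (f j (iota (w ^+ N i) *: delta_mx i 0)) * y i).
have f0 j : f j 0 = 0.
  by apply: (addrI (f j 0)); rewrite -fD // !addr0.
have fS j (I : seq 'I_n) (F : 'I_n -> 'cV[B]_n) (c : 'I_n -> A) :
    (forall i, E (F i)) ->
    f j (\sum_(i <- I) iota (c i) *: F i) = \sum_(i <- I) c i * f j (F i) /\
    E (\sum_(i <- I) iota (c i) *: F i).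
  move=> EF; elim: I => [|i I [IH1 IH2]]; first by rewrite !big_nil.
  rewrite !big_cons; split; last by apply: ED => //; exact: EZ.
  by rewrite fD //; [rewrite fZ // IH1|exact: EZ].
(* A multiple of [v] by a high power of [w] is a combination, with coefficients in [A], of the
   vectors that define [phi]. There linearity of [f j] applies, and the power of [w] cancels. *)
have phiE j v : E v -> iota (f j v) = (phi *m v) j 0.
  move=> Ev; have [l [v' hv']] := intM_denom v.
  pose K := (\sum_i N i)%N.
  have /choice[d hd] := nat_sum_split N.
  have e : iota (w ^+ (K + l)) *: v =
      \sum_i iota (v' i 0 * w ^+ d i) *: (iota (w ^+ N i) *: delta_mx i 0).
    rewrite exprD rmorphM -scalerA hv'; apply/matrixP => s t; rewrite (ord1 t) !mxE summxE.
    rewrite (bigD1 s) //= big1 ?addr0.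
      rewrite !mxE !eqxx mulr1 rmorphM -mulrA mulrC; congr (_ * _).
      by rewrite /K (hd s) addnC exprD rmorphM.
    by move=> i /negPf hi; rewrite !mxE eq_sym hi !mulr0.
  have [fe _] := fS j (index_enum 'I_n) (fun i => iota (w ^+ N i) *: delta_mx i 0)
    (fun i => v' i 0 * w ^+ d i) hN.
  apply: (@wreg (K + l)).
  have -> : iota (w ^+ (K + l)) * iota (f j v) = iota (f j (iota (w ^+ (K + l)) *: v)).
    by rewrite fZ // rmorphM.
  rewrite e fe rmorph_sum.
  have -> : iota (w ^+ (K + l)) * (phi *m v) j 0 = (phi *m (iota (w ^+ (K + l)) *: v)) j 0.
    by rewrite -scalemxAr [in RHS]mxE.
  rewrite e mulmx_sumr summxE; apply: eq_bigr => i _.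
  rewrite -!scalemxAr -colE !mxE rmorphM; congr (_ * _).
  by rewrite mulrCA hy mulr1.
have bphi v : E v -> bM *m (phi *m v) = v.
  move=> Ev; rewrite [RHS](fE v Ev) lincombE; congr (_ *m _).
  by apply/matrixP => i j; rewrite (ord1 j) [RHS]mxE [X in iota X]mxE phiE.
have bphi1 : bM *m phi = 1%:M.
  apply/matrixP => i j.
  have := bphi _ (hN j); rewrite -!scalemxAr mulmxA -colE => /wregM/matrixP/(_ i 0).
  by rewrite [LHS]mxE => ->; rewrite !mxE eqxx andbT.
have hadm : adm bM phi.
  split=> //; apply/intMP => i j; exists (f i (b j)); rewrite phiE //.
  rewrite !mxE; apply: eq_bigr => l _.
  by rewrite [bM _ _]mxE.
exists m, bM, phi; split=> //; apply/seteqP; split=> v.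
  by move=> Ev; apply/intMP => i j; rewrite (ord1 j); exists (f i v); rewrite phiE.
move=> /(latM_gen v hadm)[c ->].
have -> : bM *m map_mx iota c = lincomb iota (fun j => c j 0) b.
  rewrite lincombE; congr (_ *m _); apply/matrixP => i j.
  by rewrite !mxE (ord1 j).
exact: submodule_lincomb.
Qed.
End OneRing.

Section Change.
Variables (A B A' B' : comPzRingType) (iota : {rmorphism A -> B}) (iota' : {rmorphism A' -> B'}).
Variables (hA : {rmorphism A -> A'}) (h : {rmorphism B -> B'}).
Hypothesis hE : forall a, h (iota a) = iota' (hA a).

Lemma intM_bmap m n (M : 'M[B]_(m, n)) : intM iota M -> intM iota' (map_mx h M).
Proof.
move=> [N ->]; exists (map_mx (hA) N).
by apply/matrixP => i j; rewrite !mxE hE.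
Qed.

Lemma map_iota m n (N : 'M[A]_(m, n)) :
  map_mx h (map_mx (iota) N) = map_mx (iota') (map_mx (hA) N).
Proof. by apply/matrixP => i j; rewrite !mxE hE. Qed.

Lemma adm_bmap n m (b : 'M[B]_(n, m)) phi : adm iota b phi ->
  adm iota' (map_mx h b) (map_mx h phi).
Proof.
move=> [h1 h2]; split; first by rewrite -map_mxM h1 map_mx1.
by rewrite -map_mxM; exact: intM_bmap.
Qed.

(** The images of the columns of [b] generate both sides. *)
Lemma base_change_latM n m (b : 'M[B]_(n, m)) phi : adm iota b phi ->
  mspan iota' ((map_mx h) @` latM iota phi)%classic = latM iota' (map_mx h phi).
Proof.
move=> hb; apply/seteqP; split=> v.
  move=> [l [c [w [hw ->]]]].
  apply: submodule_lincomb; first exact: latM_submodule.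
  move=> j; have [u hu <-] := hw j.
  by rewrite /latM -map_mxM; exact: intM_bmap.
move=> /(latM_gen v (adm_bmap hb))[c ->].
exists m, (fun j => c j 0), (fun j => map_mx h (col j b)); split.
  by move=> j; exists (col j b) => //; exact: latM_col hb.
rewrite lincombE; congr (_ *m _); apply/matrixP => i j; rewrite !mxE //.
by rewrite (ord1 j).
Qed.
End Change.
End LatticeMatrices.

(** * The coefficient rings attached to a perfect algebra *)

Section BringTheory.
Variable D : base_data.
Section OnePalg.
Variable R : palg D.
Local Notation A := (Aring R).
Local Notation B := (Bring R).
Local Notation iota := (AtoB R).

Definition rd : {rmorphism A -> R} := red (j := pa_k R).

Lemma rd_surj r : exists a, rd a = r.
Proof. by exists (WOteich _ r); exact: red_teich. Qed.

Lemma rd_ker a : rd a = 0 -> exists b, a = varpi R * b.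
Proof. exact: (red_ker (pa_perfect R)). Qed.

Lemma rd_varpi a : rd (varpi R * a) = 0.
Proof. exact: red_vpi. Qed.

Lemma rd_unit a r : rd a * r = 1 -> exists b, a * b = 1.
Proof. exact: (WO_unit (pa_perfect R)). Qed.

Lemma varpi_reg a b : varpi R * a = varpi R * b -> a = b.
Proof.
move=> h; apply/eqP; rewrite -subr_eq0; apply/eqP.
by apply: (vpi_reg (pa_perfect R)); rewrite mulrBr [X in X - _]h subrr.
Qed.

Lemma varpiX_reg m a b : varpi R ^+ m * a = varpi R ^+ m * b -> a = b.
Proof. by elim: m => [|m IH]; rewrite ?expr0 ?mul1r // exprS -!mulrA => /varpi_reg. Qed.

Lemma AtoB_inj : injective iota.
Proof. by move=> a b /locfracP[m /=]; rewrite !addn0 => /varpiX_reg. Qed.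

Lemma pizN m : piz R m%:Z = iota (varpi R ^+ m).
Proof. by []. Qed.

Lemma locfrac_mul a m : piz R m%:Z * locfrac (varpi R) a m = iota a.
Proof.
rewrite pizN /iota /= /locin /locfrac [LHS](qpiM (_ : locpre (varpi R))).
by apply/locfracP; apply: loceq_of; rewrite /= expr0 mul1r.
Qed.

Lemma piz_negz m : piz R m.+1%:Z * piz R (Negz m) = 1.
Proof. by rewrite locfrac_mul rmorph1. Qed.

Lemma piz0 : piz R 0 = 1.
Proof. by rewrite (pizN 0) rmorph1. Qed.

Lemma piz1K : piz R 1 * piz R (-1) = 1.
Proof. exact: (piz_negz 0). Qed.

Lemma piz_unit m : exists y, piz R m%:Z * y = 1.
Proof. by exists (locfrac (varpi R) 1 m); rewrite locfrac_mul rmorph1. Qed.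

Lemma piz_reg m x y : piz R m%:Z * x = piz R m%:Z * y -> x = y.
Proof.
by have [z hz] := piz_unit m; exact: mulr_cancel hz.
Qed.

Lemma Bdenom (x : B) : exists m a, piz R m%:Z * x = iota a.
Proof.
rewrite -(qreprK x); case: (qrepr x) => a m; exists m, a; exact: locfrac_mul.
Qed.

End OnePalg.
Section Change.
Variables (R R' : palg D) (f : {rmorphism R -> R'}).
Variable (fk : forall c, f (pa_k R c) = pa_k R' c).
Local Notation h := (Bmap fk).

Lemma BmapA a : h (AtoB R a) = AtoB R' (WOmap fk a).
Proof. exact: locmapE. Qed.

Lemma rd_map a : rd R' (WOmap fk a) = f (rd R a).
Proof. exact: red_map. Qed.

Lemma WOmap_varpi : WOmap fk (varpi R) = varpi R'.
Proof. exact: WOmap_const. Qed.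

Lemma Bmap_piz m : h (piz R m) = piz R' m.
Proof.
case: m => m; last by rewrite [LHS]locmapE rmorph1.
rewrite !pizN BmapA; congr (AtoB R' _).
rewrite -WOmap_varpi; exact: (rmorphXn (WOmap fk)).
Qed.

End Change.
End BringTheory.

Local Open Scope classical_set_scope.

(** * Lattices attached to subspaces *)

(** The features of [Aring R], [Bring R] and [R] on which the linear algebra of lattices relies;
    [ldat] is the instance. Both restriction maps and Frobenius are morphisms of such data. *)
Record lift_data := LiftData {
  ldA : comPzRingType;
  ldB : comPzRingType;
  ldR : comPzRingType;
  ldin : {rmorphism ldA -> ldB};
  ldrd : {rmorphism ldA -> ldR};
  ldw : ldA;
  ldv : ldB;
  ldin_inj : injective ldin;
  ldwv : ldin ldw * ldv = 1;
  lddenom : forall x, exists m a, ldin (ldw ^+ m) * x = ldin a;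
  ldrd_surj : forall r, exists a, ldrd a = r;
  ldrd_ker : forall a, ldrd a = 0 <-> exists b, a = ldw * b;
  ldrd_unit : forall a r, ldrd a * r = 1 -> exists b, a * b = 1 }.

Section ColumnSpaces.
Variable R : comPzRingType.

Definition colspan n m (M : 'M[R]_(n, m)) : set 'cV[R]_n :=
  [set u | exists c, u = M *m c].

Definition coordspan n (g : 'M[R]_n) (P : pred 'I_n) : set 'cV[R]_n :=
  [set u | exists2 c : 'cV[R]_n, (forall i, ~~ P i -> c i 0 = 0) & u = g *m c].

Lemma mx_fixed_colspan n m (e : 'M[R]_n) (M : 'M[R]_(n, m)) :
  (forall c : 'cV_m, e *m (M *m c) = M *m c) -> e *m M = M.
Proof.
move=> h; apply/matrixP => i j; have /matrixP/(_ i 0) := h (delta_mx j 0).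
by rewrite mulmxA -!colE !mxE.
Qed.

Lemma colspan0 n m (M : 'M[R]_(n, m)) : colspan M 0.
Proof. by exists 0; rewrite mulmx0. Qed.

Lemma colspan_idem n (e : 'M[R]_n) u : e *m e = e -> colspan e u <-> e *m u = u.
Proof.
move=> ee; split=> [[c ->]|h]; first by rewrite mulmxA ee.
by exists u.
Qed.

Lemma coordspan_diag n (g : 'M[R]_n) (P : pred 'I_n) :
  coordspan g P = colspan (g *m diag_mx (\row_i (P i)%:R)).
Proof.
apply/seteqP; split=> u.
  move=> [c hc ->]; exists c; rewrite -mulmxA; congr (_ *m _).
  apply/matrixP => i j; rewrite mul_diag_mx !mxE (ord1 j).
  by case hP: (P i); rewrite ?mul1r // mul0r hc // hP.
move=> [c ->]; rewrite -mulmxA; exists (diag_mx (\row_i (P i)%:R) *m c) => // i hi.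
by rewrite mul_diag_mx !mxE (negPf hi) mul0r.
Qed.

(** For [h] inverse to [g], the projector onto the columns of [g] selected by [P], along the other
    columns. *)
Definition coord_idem n (g h : 'M[R]_n) (P : pred 'I_n) : 'M[R]_n :=
  g *m diag_mx (\row_i (P i)%:R) *m h.

Lemma coord_idemE n (g h : 'M[R]_n) (P : pred 'I_n) : h *m g = 1%:M ->
  coord_idem g h P *m coord_idem g h P = coord_idem g h P /\
  coordspan g P = colspan (coord_idem g h P).
Proof.
move=> hg; rewrite /coord_idem; split.
  rewrite !mulmxA -(mulmxA _ h g) hg mulmx1 -(mulmxA g); congr (_ *m _ *m _).
  rewrite mulmx_diag; congr diag_mx; apply/rowP => i; rewrite !mxE.
  by case: (P i); rewrite ?mulr1 ?mulr0.
rewrite coordspan_diag; apply/seteqP; split=> u [c ->].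
  by exists (g *m c); rewrite -!mulmxA (mulmxA h) hg mul1mx.
by exists (h *m c); rewrite !mulmxA.
Qed.

Lemma coordspan_sub n (g : 'M[R]_n) (P Q : pred 'I_n) :
  {subset P <= Q} -> coordspan g P `<=` coordspan g Q.
Proof.
move=> PQ u [c hc ->]; exists c => // i hi; apply: hc.
by apply: contra hi; exact: PQ.
Qed.

Lemma antidiagK n : antidiag n R *m antidiag n R = 1%:M.
Proof.
apply/matrixP => i j; rewrite !mxE (bigD1 (rev_ord i)) //= big1 ?addr0.
  by rewrite !mxE eqxx mul1r rev_ordK eq_sym.
by move=> l /negPf hl; rewrite !mxE hl mul0r.
Qed.

Lemma antidiagT n : (antidiag n R)^T = antidiag n R.
Proof.
apply/matrixP => i j; rewrite !mxE; congr (nat_of_bool _)%:R.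
by rewrite -(inj_eq rev_ord_inj) rev_ordK eq_sym.
Qed.
End ColumnSpaces.

Lemma colspan_map (R S : comPzRingType) (f : {rmorphism R -> S}) n m (M : 'M[R]_(n, m)) :
  mspan (idfun : {rmorphism S -> S}) ((map_mx f) @` colspan M) = colspan (map_mx f M).
Proof.
apply/seteqP; split=> u.
  move=> [l [c [b [hb ->]]]].
  have /choice[d hd] j : exists d, b j = map_mx f M *m d.
    by have [_ [d ->] <-] := hb j; exists (map_mx f d); rewrite map_mxM.
  exists (\sum_j c j *: d j); rewrite mulmx_sumr /lincomb.
  by apply: eq_bigr => j _; rewrite hd -scalemxAr.
move=> [c ->]; exists m, (fun j => c j 0), (fun j => map_mx f (col j M)); split.
  by move=> j; exists (col j M) => //; exists (delta_mx j 0); rewrite -colE.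
apply/matrixP => i j; rewrite (ord1 j) mxE /lincomb summxE.
by apply: eq_bigr => l _; rewrite !mxE mulrC.
Qed.

Lemma map_antidiag (R S : comPzRingType) (f : {rmorphism R -> S}) n :
  map_mx f (antidiag n R) = antidiag n S.
Proof. by apply/matrixP => i j; rewrite !mxE rmorph_nat. Qed.

Section PerpIdempotent.
Variable R : comPzRingType.

(** The adjoint of [1 - e] for the antidiagonal form; for idempotent [e] it projects onto the
    orthogonal of the image of [e]. *)
Definition perp_idem n (e : 'M[R]_n) : 'M[R]_n := antidiag n R *m (1%:M - e^T) *m antidiag n R.

Lemma perp_idemK n (e : 'M[R]_n) : e *m e = e -> perp_idem e *m perp_idem e = perp_idem e.
Proof.
move=> ee; rewrite /perp_idem !mulmxA -(mulmxA _ (antidiag n R) (antidiag n R)) antidiagK mulmx1.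
rewrite -(mulmxA (antidiag n R) (1%:M - _)); congr (_ *m _ *m _).
rewrite mulmxBl mul1mx mulmxBr mulmx1 -trmx_mul ee subrr subr0 //.
Qed.

Lemma perp_idemP n (e : 'M[R]_n) u : e *m e = e ->
  colspan (perp_idem e) u <-> forall x, colspan e x -> u^T *m antidiag n R *m x = 0.
Proof.
move=> ee; rewrite colspan_idem; last exact: perp_idemK.
split=> [<- _ [z ->]|h].
  rewrite /perp_idem !trmx_mul antidiagT linearB /= trmx1 trmxK -!mulmxA.
  rewrite (mulmxA (antidiag n R) (antidiag n R)) antidiagK mul1mx (mulmxA _ e) mulmxBl mul1mx ee subrr.
  by rewrite mul0mx !mulmx0.
have {}h : e^T *m antidiag n R *m u = 0.
  apply: trmx_inj; rewrite !trmx_mul trmxK antidiagT trmx0.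
  apply/matrixP => i j; have := h (e *m delta_mx j 0) (ex_intro _ _ erefl).
  by rewrite mulmxA mulmxA -colE => /matrixP/(_ i 0); rewrite !mxE.
rewrite /perp_idem mulmxBr mulmx1 !mulmxBl antidiagK mul1mx.
by rewrite -!mulmxA (mulmxA e^T) h mulmx0 subr0.
Qed.

End PerpIdempotent.

Section LatticesOfSubspaces.
Variable d : lift_data.
Local Notation A := (ldA d).
Local Notation B := (ldB d).
Local Notation R := (ldR d).
Local Notation iota := (ldin d).
Local Notation rd := (ldrd d).
Local Notation w := (ldw d).
Local Notation v := (ldv d).
Local Notation J S := (antidiag _ S).

Lemma ld_vw : v * iota w = 1.
Proof. by rewrite mulrC ldwv. Qed.

Lemma ldwX m : exists y, iota (w ^+ m) * y = 1.
Proof. by exists (v ^+ m); rewrite rmorphXn -exprMn ldwv expr1n. Qed.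

Lemma ld_wK m n (M : 'M[B]_(m, n)) : iota w *: (v *: M) = M.
Proof. by rewrite scalerA ldwv scale1r. Qed.
Lemma ld_vK m n (M : 'M[B]_(m, n)) : v *: (iota w *: M) = M.
Proof. by rewrite scalerA ld_vw scale1r. Qed.

Lemma map_iota_inj m n : injective (map_mx (m := m) (n := n) iota).
Proof.
move=> M N /matrixP h; apply/matrixP => i j; apply: (@ldin_inj d).
by have := h i j; rewrite !mxE.
Qed.

Lemma rdM_surj m n (M : 'M[R]_(m, n)) : exists N, map_mx rd N = M.
Proof.
have /choice[f hf] (ij : 'I_m * 'I_n) := ldrd_surj (M ij.1 ij.2).
by exists (\matrix_(i, j) f (i, j)); apply/matrixP => i j; rewrite !mxE (hf (i, j)).
Qed.

Lemma rdM_ker m n (M : 'M[A]_(m, n)) : map_mx rd M = 0 <-> exists N, M = w *: N.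
Proof.
split=> [h|[N ->]].
  have /choice[f hf] (ij : 'I_m * 'I_n) : exists b, M ij.1 ij.2 = w * b.
    by apply/ldrd_ker; move/matrixP/(_ ij.1 ij.2): h; rewrite !mxE.
  by exists (\matrix_(i, j) f (i, j)); apply/matrixP => i j; rewrite !mxE (hf (i, j)).
apply/matrixP => i j; rewrite !mxE; apply/ldrd_ker; by eexists.
Qed.

(* [v] stands for the inverse of the uniformizer *)
Lemma intM_v m n (M : 'M[A]_(m, n)) : map_mx rd M = 0 <-> intM iota (v *: map_mx iota M).
Proof.
rewrite rdM_ker; split=> -[N].
  by move=> ->; exists N; rewrite map_mxZ ld_vK.
move=> h; exists N; apply: map_iota_inj.
by rewrite map_mxZ -h ld_wK.
Qed.

Definition latU n (U : set 'cV[R]_n) : set 'cV[B]_n :=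
  [set x | exists a, iota w *: x = map_mx iota a /\ U (map_mx rd a)].

Definition latbar n (E : set 'cV[B]_n) : set 'cV[R]_n :=
  [set u | exists x a, [/\ E x, iota w *: x = map_mx iota a & u = map_mx rd a]].

Lemma latUK n : cancel (@latU n) (@latbar n).
Proof.
move=> U; apply/seteqP; split=> u.
  by move=> [x [a [[b [hb hU]] ha ->]]]; rewrite ha in hb; rewrite (map_iota_inj hb).
move=> hu; have [a ha] := rdM_surj u.
exists (v *: map_mx iota a), a; split=> //; last by rewrite ld_wK.
by exists a; rewrite ld_wK ha.
Qed.

Lemma latU_sub n (U U' : set 'cV[R]_n) : (latU U `<=` latU U') <-> (U `<=` U').
Proof.
split=> [h|h x [a [ha hU]]]; last by exists a; split=> //; exact: h.
rewrite -(latUK U) -(latUK U') => _ [x [a [hx ha ->]]].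
by exists x, a; split=> //; exact: h.
Qed.

Lemma latU_std n (U : set 'cV[R]_n) x : U 0 -> intM iota x -> latU U x.
Proof.
move=> U0 [a ->]; exists (w *: a); rewrite map_mxZ; split=> //.
by have -> : map_mx rd (w *: a) = 0 by apply/rdM_ker; exists a.
Qed.

(** Integrality of [phi] says that the lattice contains the standard one, integrality of [w b] that
    it lies in [w^-1] times it. The subspace is then spanned by the reductions of the generators
    multiplied by [w]. *)
Lemma latM_latU n m (b : 'M[B]_(n, m)) (phi : 'M[B]_(m, n)) (N : 'M[A]_(n, m)) :
  adm iota b phi -> intM iota phi -> iota w *: b = map_mx iota N ->
  latM iota phi = latU (colspan (map_mx rd N)).
Proof.
move=> hadm hphi hb; apply/seteqP; split=> x.
  move=> /(latM_gen x hadm)[c ->]; exists (N *m c); split.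
    by rewrite map_mxM -hb scalemxAl.
  by exists (map_mx rd c); rewrite map_mxM.
move=> [a [ha [c hc]]]; have [c' hc'] := rdM_surj c.
have [e he] : exists e, a - N *m c' = w *: e.
  by apply/rdM_ker; rewrite map_mxB map_mxM hc hc' subrr.
have -> : x = b *m map_mx iota c' + map_mx iota e.
  rewrite -[x]ld_vK ha -(subrK (N *m c') a) he map_mxD map_mxM -hb map_mxZ scalerDr ld_vK.
  by rewrite -scalemxAl ld_vK addrC.
rewrite /latM mulmxDr; apply: intMD.
  by apply/(latM_gen _ hadm); exists c'.
by apply: intMM => //; exact: intM_map.
Qed.

Section Idempotent.
Variables (n : nat) (e : 'M[R]_n) (ee : e *m e = e) (te : 'M[A]_n) (he : map_mx rd te = e).

(** The lattice of the image of [e] is generated by the standard basis and by the columns of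
    [te / w]. Here [te] is an arbitrary lift of [e]; the product [te te] in [idem_phi] makes up for
    its failing to be idempotent. *)
Definition idem_b : 'M[B]_(n, n + n) := row_mx 1%:M (v *: map_mx iota te).
Definition idem_phi : 'M[B]_(n + n, n) :=
  col_mx (1%:M - map_mx iota (te *m te)) (iota w *: map_mx iota te).

Lemma idem_adm : adm iota idem_b idem_phi.
Proof.
rewrite /idem_b /idem_phi; split.
  rewrite mul_row_col mul1mx -scalemxAl -scalemxAr scalerA ld_vw scale1r.
  by rewrite -map_mxM subrK.
rewrite mul_col_row mulmx1.
(* The only block of the product that is not visibly integral: [te - te^3] reduces to [e - e^3 = 0],
   hence is divisible by [w]. *)
have [N hN] : intM iota (v *: map_mx iota (te - te *m te *m te)).
  by apply/intM_v; rewrite map_mxB !map_mxM he !ee subrr.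
exists (block_mx (1%:M - te *m te) N (w *: te) (te *m te)).
rewrite map_block_mx; congr block_mx.
- by rewrite map_mxB map_mx1.
- rewrite -hN -scalemxAr mulmxBl mul1mx map_mxB -map_mxM; congr (_ *: _).
- by rewrite mulmx1 map_mxZ.
- by rewrite -scalemxAl -scalemxAr scalerA ldwv scale1r map_mxM.
Qed.

Lemma latU_idem : latM iota idem_phi = latU (colspan e).
Proof.
have phiE x : idem_phi *m x = col_mx (x - map_mx iota (te *m te) *m x)
    (map_mx iota te *m (iota w *: x)).
  by rewrite /idem_phi mul_col_mx mulmxBl mul1mx -scalemxAl -scalemxAr.
apply/seteqP; split=> x.
  rewrite /latM phiE => -[N hN].
  have [h1 h2] : x - map_mx iota (te *m te) *m x = map_mx iota (usubmx N) /\
      map_mx iota te *m (iota w *: x) = map_mx iota (dsubmx N).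
    by apply: eq_col_mx; rewrite hN -map_col_mx vsubmxK.
  exists (w *: usubmx N + te *m dsubmx N); split.
    rewrite map_mxD map_mxZ [X in _ + X]map_mxM -h1 -h2 mulmxA -map_mxM scalerBr -scalemxAr.
    by rewrite subrK.
  exists (map_mx rd (dsubmx N)); rewrite map_mxD map_mxM he.
  have -> : map_mx rd (w *: usubmx N) = 0 by apply/rdM_ker; eexists.
  by rewrite add0r.
move=> [a [ha [c hc]]]; rewrite /latM phiE.
have [N hN] : intM iota (v *: map_mx iota (a - te *m te *m a)).
  by apply/intM_v; rewrite map_mxB !map_mxM he hc ee !mulmxA !ee subrr.
exists (col_mx N (te *m a)); rewrite map_col_mx -hN; congr col_mx; last first.
  by rewrite ha -map_mxM.
by rewrite map_mxB [map_mx iota (_ *m a)]map_mxM -ha scalerBr scalemxAr !ld_vK.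
Qed.
End Idempotent.

Definition herm_dual n (E : set 'cV[B]_n) : set 'cV[B]_n :=
  [set y | forall x, E x -> intM iota (y^T *m J B *m x)].

(** Pairing with the standard lattice forces [y] to be integral; pairing with the remaining
    generators [te / w] says that its reduction is orthogonal to the subspace. Such [y] form [w]
    times the lattice of the orthogonal. *)
Lemma herm_dual_latU n (e : 'M[R]_n) : e *m e = e ->
  herm_dual (latU (colspan e)) = [set y | latU (colspan (perp_idem e)) (v *: y)].
Proof.
move=> ee; have [te he] := rdM_surj e.
apply/seteqP; split=> y /=.
  move=> h.
  have [a ha] : intM iota y.
    suff [a ha] : intM iota (y^T *m J B).
      exists (J A *m a^T); rewrite map_mxM map_antidiag -map_trmx -ha trmx_mul trmxK antidiagT.
      by rewrite mulmxA antidiagK mul1mx.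
    apply/intMP => i j.
    have /intMP/(_ i 0) : intM iota (y^T *m J B *m (delta_mx j 0 : 'cV_n)).
      apply: h; apply: latU_std; first exact: colspan0.
      by exists (delta_mx j 0); rewrite map_delta_mx.
    by rewrite -colE mxE.
  exists a; rewrite ld_wK ha; split=> //.
  apply/(perp_idemP _ ee) => _ [z ->]; have [z' hz] := rdM_surj z.
  have : intM iota (v *: map_mx iota (a^T *m J A *m (te *m z'))).
    have : latU (colspan e) (v *: map_mx iota (te *m z')).
      by exists (te *m z'); rewrite ld_wK; split=> //; exists z; rewrite map_mxM he hz.
    move=> /h; rewrite ha -scalemxAr map_trmx -(map_antidiag iota) -!map_mxM //.
  move=> /intM_v; rewrite !map_mxM map_antidiag -map_trmx he hz.
  by [].
move=> [a [ha hU]] x [c [hc hx]].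
have hy : y = map_mx iota a by rewrite -ha ld_wK.
have -> : y^T *m J B *m x = v *: map_mx iota (a^T *m J A *m c).
  by rewrite hy -[x]ld_vK hc -scalemxAr map_trmx -(map_antidiag iota) -!map_mxM.
apply/intM_v; rewrite !map_mxM map_antidiag -map_trmx.
by move/(perp_idemP _ ee): hU; apply.
Qed.

Lemma invertible_lift n (G : 'M[A]_n) g : map_mx rd G *m g = 1%:M -> exists H, G *m H = 1%:M.
Proof.
move=> h; have := congr1 determinant h; rewrite det_mulmx det1 det_map_mx.
move=> /ldrd_unit[y hy]; exists (y *: \adj G).
by rewrite -scalemxAr mul_mx_adj scale_scalar_mx mulrC hy.
Qed.

(** The diagonal of the uniformizer raised to the cocharacter that is -1 on [P] and 0 elsewhere. *)
Definition coord_scale n (P : pred 'I_n) (i : 'I_n) : B := if P i then v else 1.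

Lemma lincomb_mx n m (c : 'I_m -> A) (b : 'M[B]_(n, m)) (s : 'I_m -> B) :
  lincomb iota c (fun j => s j *: col j b) = b *m (\col_j (s j * iota (c j))).
Proof.
apply/matrixP => i j; rewrite (ord1 j) /lincomb summxE !mxE.
by apply: eq_bigr => l _; rewrite !mxE; ring.
Qed.

Lemma mbasis_latU n (G H : 'M[A]_n) (P : pred 'I_n) : G *m H = 1%:M ->
  mbasis iota (fun i => coord_scale P i *: col i (map_mx iota G))
    (latU (coordspan (map_mx rd G) P)).
Proof.
move=> GH; have HG := mulmx1C GH; split=> [x|c].
  split.
    move=> [a [ha [c hc hac]]].
    have ea : map_mx rd (H *m a) = c by rewrite map_mxM hac mulmxA -map_mxM HG map_mx1 mul1mx.
    have /choice[q hq] i : exists q, coord_scale P i * iota q = v * iota ((H *m a) i 0).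
      rewrite /coord_scale; case hP: (P i); first by exists ((H *m a) i 0).
      have : rd ((H *m a) i 0) = 0.
        by move/matrixP/(_ i 0): ea; rewrite mxE => ->; apply: hc; rewrite hP.
      by move=> /ldrd_ker[q ->]; exists q; rewrite rmorphM mulrA ld_vw.
    exists q; rewrite lincomb_mx -[x]ld_vK ha -[a]mul1mx -GH -mulmxA map_mxM scalemxAr.
    by congr (_ *m _); apply/matrixP => i j; rewrite (ord1 j) !mxE hq mxE.
  move=> [c ->]; rewrite lincomb_mx.
  exists (G *m \col_i ((if P i then 1 else w) * c i)); split.
    rewrite map_mxM scalemxAr; congr (_ *m _); apply/matrixP => i j; rewrite !mxE mulrA rmorphM.
    by rewrite /coord_scale; case: (P i); rewrite ?ldwv ?mulr1 ?rmorph1.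
  exists (map_mx rd (\col_i ((if P i then 1 else w) * c i))); last by rewrite map_mxM.
  by move=> i hi; rewrite !mxE (negPf hi); apply/ldrd_ker; eexists.
rewrite lincomb_mx => e j.
have : map_mx iota H *m (map_mx iota G *m \col_i (coord_scale P i * iota (c i))) = 0.
  by rewrite e mulmx0.
rewrite mulmxA -map_mxM HG map_mx1 mul1mx => /matrixP/(_ j 0); rewrite !mxE /coord_scale.
case: (P j); rewrite ?mul1r => e'; apply: (@ldin_inj d); rewrite rmorph0 //.
by rewrite -[LHS]mul1r -ldwv -mulrA e' mulr0.
Qed.

Lemma mbasis_std n (e : 'I_n -> 'cV[B]_n) :
  mbasis iota e [set x | intM iota x] ->
  exists G H, G *m H = 1%:M /\ forall i, e i = col i (map_mx iota G).
Proof.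
move=> [h _].
have /choice[G hG] i : exists G : 'cV_n, e i = map_mx iota G.
  apply/(h (e i)); exists (fun j => (i == j)%:R).
  rewrite /lincomb (bigD1 i) //= eqxx rmorph1 scale1r big1 ?addr0 // => j /negPf hj.
  by rewrite eq_sym hj rmorph0 scale0r.
have /choice[C hC] (i : 'I_n) : exists c, delta_mx i 0 = lincomb iota c e.
  by apply/h; exists (delta_mx i 0); rewrite map_delta_mx.
exists (\matrix_(i, j) G j i 0), (\matrix_(i, j) C j i); split; last first.
  by move=> i; rewrite hG; apply/matrixP => s t; rewrite (ord1 t) !mxE.
apply: map_iota_inj; apply/matrixP => i j; rewrite map_mx1 !mxE.
have := congr1 (fun M : 'cV_n => M i 0) (hC j); rewrite /= mxE eqxx andbT => ->.
rewrite rmorph_sum /lincomb summxE; apply: eq_bigr => l _.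
by rewrite !mxE rmorphM hG mxE mulrC.
Qed.

End LatticesOfSubspaces.

Section ChangeOfLattices.
Variables (d d' : lift_data).
Variables (hA : {rmorphism ldA d -> ldA d'}) (hB : {rmorphism ldB d -> ldB d'}).
Variable (hR : {rmorphism ldR d -> ldR d'}).
Hypothesis hAB : forall a, hB (ldin d a) = ldin d' (hA a).
Hypothesis hAR : forall a, ldrd d' (hA a) = hR (ldrd d a).
Hypothesis hw : hA (ldw d) = ldw d'.

Lemma ldv_change : hB (ldv d) = ldv d'.
Proof.
have := congr1 hB (ldwv d); rewrite rmorphM hAB hw rmorph1 => e.
by apply: (mulr_cancel (ldwv d')); rewrite e ldwv.
Qed.

Section Idempotent.
Variables (n : nat) (e : 'M[ldR d]_n) (ee : e *m e = e).

Lemma idem_phi_change (te : 'M[ldA d]_n) :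
  map_mx hB (idem_phi te) = idem_phi (map_mx hA te).
Proof.
have hN q l (N : 'M[ldA d]_(q, l)) :
    map_mx hB (map_mx (ldin d) N) = map_mx (ldin d') (map_mx hA N).
  by apply/matrixP => i j; rewrite !mxE hAB.
by rewrite /idem_phi map_col_mx map_mxB map_mx1 map_mxZ !hN hAB hw map_mxM.
Qed.

Lemma idem_lift_change (te : 'M[ldA d]_n) : map_mx (ldrd d) te = e ->
  map_mx (ldrd d') (map_mx hA te) = map_mx hR e.
Proof. by move=> <-; apply/matrixP => i j; rewrite !mxE hAR. Qed.

Lemma idem_change : map_mx hR e *m map_mx hR e = map_mx hR e.
Proof. by rewrite -map_mxM ee. Qed.

Lemma latU_change :
  mspan (ldin d') ((map_mx hB) @` latU (d := d) (colspan e)) =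
  latU (d := d') (colspan (map_mx hR e)).
Proof.
have [te he] := rdM_surj e.
rewrite -(latU_idem ee he) (base_change_latM hAB (idem_adm ee he)) idem_phi_change.
exact: (latU_idem idem_change (idem_lift_change he)).
Qed.

(** Dual lattices occur multiplied by the uniformizer, and this is the form in which Frobenius is
    applied to them. *)
Lemma latU_scaled_change :
  mspan (ldin d') ((map_mx hB) @` [set y | latU (d := d) (colspan e) (ldv d *: y)]) =
  [set y | latU (d := d') (colspan (map_mx hR e)) (ldv d' *: y)].
Proof.
have sc (q : lift_data) l (phi : 'M[ldB q]_(l, n)) :
    [set y | latM (ldin q) phi (ldv q *: y)] = latM (ldin q) (ldv q *: phi).
  by apply/seteqP; split=> y; rewrite /latM /= -scalemxAr scalemxAl.
have [te he] := rdM_surj e.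
have hadm : adm (ldin d) (ldin d (ldw d) *: idem_b te) (ldv d *: idem_phi te).
  have [h1 h2] := idem_adm ee he.
  by split; rewrite -!(scalemxAl, scalemxAr) ?ld_wK ?ld_vK.
rewrite -(latU_idem ee he) sc (base_change_latM hAB hadm).
rewrite map_mxZ idem_phi_change ldv_change -sc.
by rewrite (latU_idem idem_change (idem_lift_change he)).
Qed.
End Idempotent.
End ChangeOfLattices.

(** * Ranks and minors over fields *)

Definition hasdim (S : comPzRingType) n (U : set 'cV[S]_n) (s : nat) :=
  exists b : 'I_s -> 'cV[S]_n, mbasis (idfun : {rmorphism S -> S}) b U.

Lemma lincomb_id (S : comPzRingType) n m (c : 'I_m -> S) (b : 'I_m -> 'cV[S]_n) :
  lincomb (idfun : {rmorphism S -> S}) c b = (\matrix_(i, j) b j i 0) *m \col_j c j.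
Proof.
apply/matrixP => i j; rewrite (ord1 j) /lincomb summxE !mxE.
by apply: eq_bigr => l _; rewrite !mxE mulrC.
Qed.

Lemma hasdim_factor (S : comPzRingType) n m (M : 'M[S]_(n, m)) s : hasdim (colspan M) s ->
  exists (a : 'M[S]_(n, s)) (c : 'M[S]_(s, m)), M = a *m c.
Proof.
move=> [b [bE _]].
have /choice[c hc] (j : 'I_m) : exists c, col j M = lincomb (idfun : {rmorphism S -> S}) c b.
  by apply/bE; exists (delta_mx j 0); rewrite colE.
exists (\matrix_(i, j) b j i 0), (\matrix_(i, j) c j i).
apply/matrixP => i j; have /matrixP/(_ i 0) := hc j; rewrite lincomb_id !mxE => ->.
by apply: eq_bigr => l _; rewrite !mxE.
Qed.

(** A dominant cocharacter with coordinates 0 and -1 has its -1 in the last positions. *)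
Definition lastp n s : pred 'I_n := [pred i : 'I_n | n - s <= i]%N.
Arguments lastp : clear implicits.

Section FieldColumnSpaces.
Variable F : fieldType.

Lemma colspan_subm n m m' (M : 'M[F]_(n, m)) (N : 'M[F]_(n, m')) :
  (colspan M `<=` colspan N) <-> (M^T <= N^T)%MS.
Proof.
split=> [h|/submxP[D hD] _ [c ->]].
  apply/row_subP => i; apply/submxP.
  have [|d hd] := h (col i M); first by exists (delta_mx i 0); rewrite colE.
  by exists d^T; rewrite -trmx_mul -hd tr_col.
exists (D^T *m c); rewrite mulmxA; congr (_ *m _).
by apply: trmx_inj; rewrite trmx_mul trmxK.
Qed.

Lemma hasdim_rank n m (M : 'M[F]_(n, m)) s : hasdim (colspan M) s <-> \rank M = s.
Proof.
split.
  move=> [b [bE bI]]; pose N : 'M[F]_(n, s) := \matrix_(i, j) b j i 0.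
  have e : colspan M = colspan N.
    apply/seteqP; split=> u.
      by move=> /bE[c ->]; rewrite lincomb_id; eexists.
    move=> [c ->]; apply/bE; exists (fun j => c j 0); rewrite lincomb_id.
    by congr (_ *m _); apply/matrixP => i j; rewrite (ord1 j) mxE.
  have -> : \rank M = \rank N.
    rewrite -[LHS]mxrank_tr -[RHS]mxrank_tr; apply/eqP.
    by rewrite eqn_leq !mxrankS //; apply/colspan_subm; rewrite e.
  rewrite -mxrank_tr; apply/eqP; rewrite -/(row_free _) -kermx_eq0.
  apply/eqP/row_matrixP => i; rewrite row0; set x := row _ _.
  have : N *m x^T = 0.
    apply: trmx_inj; rewrite trmx_mul trmxK trmx0; apply/sub_kermxP; exact: row_sub.
  have -> : x^T = \col_j (x 0 j).
    by apply/matrixP => u v; rewrite (ord1 v) !mxE.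
  rewrite -lincomb_id => /bI h; apply/rowP => j.
  by rewrite h mxE.
move=> <-; exists (fun j => col j (col_base M)).
have e : \matrix_(i, j) col j (col_base M) i 0 = col_base M.
  by apply/matrixP => i j; rewrite !mxE.
split=> [u|c].
  split.
    move=> [c ->]; exists (fun j => (row_base M *m c) j 0); rewrite lincomb_id e.
    rewrite -{1}(mulmx_base M) -mulmxA; congr (_ *m _).
    by apply/matrixP => i j; rewrite (ord1 j) [RHS]mxE.
  move=> [c ->]; rewrite lincomb_id e.
  have /row_freeP[X hX] := row_base_free M.
  have := congr1 (mulmx^~ X) (mulmx_base M); rewrite /= -mulmxA hX mulmx1 => eM.
  by exists (X *m \col_j c j); rewrite mulmxA -eM.
rewrite lincomb_id e => h j.
have /row_fullP[X hX] := col_base_full M.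
have : X *m (col_base M *m \col_j c j) = 0 by rewrite h mulmx0.
by rewrite mulmxA hX mul1mx => /matrixP/(_ j 0); rewrite !mxE.
Qed.

Lemma mxsub_sel n m s (f : 'I_s -> 'I_n) (g : 'I_s -> 'I_m) (M : 'M[F]_(n, m)) :
  mxsub f g M = rowsub f 1%:M *m M *m colsub g 1%:M.
Proof. by rewrite -rowsubE mulmx_colsub mulmx1 -mxsubcr. Qed.

Lemma rank_minor n m (M : 'M[F]_(n, m)) s : (s <= \rank M)%N ->
  exists (f : 'I_s -> 'I_n) (g : 'I_s -> 'I_m), \det (mxsub f g M) <> 0.
Proof.
move=> le; pose f i := maxrankfun M (widen_ord le i).
pose N := rowsub f M.
have rN : \rank N^T = s.
  have -> : N = pid_mx s *m rowsub (maxrankfun M) M.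
    have -> : N = rowsub (widen_ord le) (rowsub (maxrankfun M) M).
      by apply/matrixP => i j; rewrite !mxE.
    rewrite rowsubE; congr (_ *m _); apply/matrixP => i j; rewrite !mxE.
    by rewrite ltn_ord andbT.
  rewrite mxrank_tr mxrankMfree ?maxrowsub_free // rank_pid_mx //.
have fN : \rank N^T == s by rewrite rN.
exists f, (fullrankfun fN).
have := fullrowsub_unit fN; rewrite unitmxE unitfE -det_tr => /eqP.
by congr (_ <> _); congr determinant; apply/matrixP => i j; rewrite !mxE.
Qed.

Lemma minor_rank n m (M : 'M[F]_(n, m)) s (f : 'I_s -> 'I_n) (g : 'I_s -> 'I_m) :
  \det (mxsub f g M) <> 0 -> (s <= \rank M)%N.
Proof.
move=> /eqP h; have : mxsub f g M \in unitmx by rewrite unitmxE unitfE.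
move=> /mxrank_unit <-; rewrite mxsub_sel.
by apply: leq_trans (mxrankM_maxl _ _) _; exact: mxrankM_maxr.
Qed.

Lemma exact_rank n m q (M : 'M[F]_(n, m)) (N : 'M[F]_(q, n)) :
  (forall u, N *m u = 0 <-> colspan M u) -> (\rank M + \rank N = n)%N.
Proof.
move=> h.
have -> : \rank M = \rank (kermx N^T).
  rewrite -mxrank_tr; apply/eqP; rewrite eqn_leq !mxrankS //.
    rewrite -[kermx _]trmxK; apply/colspan_subm => _ [c ->]; apply/h.
    rewrite mulmxA (_ : N *m _ = 0) ?mul0mx //.
    by apply: trmx_inj; rewrite trmx_mul trmxK trmx0 mulmx_ker.
  apply/sub_kermxP; apply: trmx_inj; rewrite trmx_mul !trmxK trmx0.
  apply/matrixP => i j.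
  have /matrixP/(_ i 0) : N *m (M *m (delta_mx j 0 : 'cV_m)) = 0 by apply/h; eexists.
  by rewrite mulmxA -colE !mxE.
by rewrite mxrank_ker mxrank_tr subnK // rank_leq_col.
Qed.

Lemma row_cases n r0 r1 r2 (P : 'rV[F]_n -> Prop) (X0 : 'M_(r0, n)) (X1 : 'M_(r1, n))
    (X2 : 'M_(r2, n)) (k : 'I_(r0 + (r1 + r2))) :
  ((k < r0)%N -> forall i, P (row i X0)) -> ((r0 <= k < r0 + r1)%N -> forall i, P (row i X1)) ->
  ((r0 + r1 <= k)%N -> forall i, P (row i X2)) ->
  P (row k (col_mx X0 (col_mx X1 X2))).
Proof.
move=> h0 h1 h2; case: (split_ordP k) => i ei.
  by rewrite ei rowKu; apply: h0; rewrite ei /=.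
rewrite ei rowKd; case: (split_ordP i) => l el; rewrite el.
  rewrite rowKu; apply: h1; rewrite ei el /=; have := ltn_ord l; lia.
by rewrite rowKd; apply: h2; rewrite ei el /=; lia.
Qed.

(** The basis consists of a complement of the large space, then a complement of the small one in the
    large one, then the small one, so that both spaces are spanned by final segments. Transposes
    appear since [mxalgebra] works with row spaces. *)
Lemma flag_basis n m1 m2 (M1 : 'M[F]_(n, m1)) (M2 : 'M[F]_(n, m2)) :
  colspan M1 `<=` colspan M2 -> exists g : 'M[F]_n, [/\ g \in unitmx,
    colspan M1 = coordspan g (lastp n (\rank M1)) &
    colspan M2 = coordspan g (lastp n (\rank M2))].
Proof.
move=> /colspan_subm sA; rewrite -(mxrank_tr M1) -(mxrank_tr M2).
move: sA; set A1 := M1^T; set A2 := M2^T => sA.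
pose C := (A2^C)%MS; pose E := (A2 :\: A1)%MS.
have rC : \rank C = (n - \rank A2)%N := mxrank_compl A2.
have capA : (A2 :&: A1 :=: A1)%MS by exact: capmx_idPr.
have rE : (\rank A1 + \rank E = \rank A2)%N by rewrite -(mxrank_cap_compl A2 A1) capA.
have sE : (A2 <= E + A1)%MS by rewrite -(addsmx_diff_cap_eq A2 A1) addsmxS // capA.
have le2 : (\rank A2 <= n)%N by exact: rank_leq_col.
have en : n = (\rank C + (\rank E + \rank A1))%N by lia.
pose X := col_mx (row_base C) (col_mx (row_base E) (row_base A1)).
pose gT : 'M_n := \matrix_(i < n) row (cast_ord en i) X.
pose msk s : 'M[F]_n := diag_mx (\row_(i < n) ((lastp n s i))%:R).
have rowM s i : row i (msk s *m gT) = (lastp n s i)%:R *: row (cast_ord en i) X.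
  by rewrite row_mul row_diag_mx mxE -scalemxAl -rowE rowK.
have up s (k : 'I_(\rank C + (\rank E + \rank A1))) : (n - s <= k)%N -> (row k X <= msk s *m gT)%MS.
  move=> hk; apply: submx_trans (row_sub (cast_ord (esym en) k) _).
  by rewrite rowM /lastp /= hk scale1r cast_ordKV.
have s2 : (A2 :=: msk (\rank A2) *m gT)%MS.
  apply/eqmxP/andP; split.
    apply: (submx_trans sE); rewrite addsmx_sub; apply/andP; split.
      rewrite -(eq_row_base E); apply/row_subP => i.
      have -> : row i (row_base E) = row (rshift _ (lshift _ i)) X by rewrite rowKd rowKu.
      by apply: up => /=; lia.
    rewrite -(eq_row_base A1); apply/row_subP => i.
    have -> : row i (row_base A1) = row (rshift _ (rshift _ i)) X by rewrite rowKd rowKd.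
    by apply: up => /=; lia.
  apply/row_subP => i; rewrite rowM /lastp /=; case: leqP => hi; last by rewrite scale0r sub0mx.
  rewrite scale1r; apply: (@row_cases _ _ _ _ (fun v => (v <= A2)%MS)) => /= hk j.
  - by lia.
  - apply: (submx_trans (row_sub _ _)); rewrite eq_row_base; exact: diffmxSl.
  - by apply: (submx_trans (row_sub _ _)); rewrite eq_row_base.
have s1 : (A1 :=: msk (\rank A1) *m gT)%MS.
  apply/eqmxP/andP; split.
    rewrite -(eq_row_base A1); apply/row_subP => i.
    have -> : row i (row_base A1) = row (rshift _ (rshift _ i)) X by rewrite rowKd rowKd.
    by apply: up => /=; lia.
  apply/row_subP => i; rewrite rowM /lastp /=; case: leqP => hi; last by rewrite scale0r sub0mx.
  rewrite scale1r; apply: (@row_cases _ _ _ _ (fun v => (v <= A1)%MS)) => /= hk j; try lia.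
  by apply: (submx_trans (row_sub _ _)); rewrite eq_row_base.
have gU : gT \in unitmx.
  rewrite -row_full_unit -sub1mx.
  apply: (submx_trans (_ : _ <= A2 + C)%MS); first by rewrite sub1mx addsmx_compl_full.
  rewrite addsmx_sub s2 submxMl /= -(eq_row_base C); apply/row_subP => i.
  have -> : row i (row_base C) = row (cast_ord (esym en) (lshift _ i)) gT.
    by rewrite rowK cast_ordKV rowKu.
  exact: row_sub.
exists gT^T; split; first by rewrite unitmx_tr.
- rewrite coordspan_diag; apply/seteqP; split; apply/colspan_subm;
    by rewrite trmx_mul trmxK tr_diag_mx -/A1 s1.
- rewrite coordspan_diag; apply/seteqP; split; apply/colspan_subm;
    by rewrite trmx_mul trmxK tr_diag_mx -/A2 s2.
Qed.
End FieldColumnSpaces.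

(** * Transfer to rings in which nonzero elements are invertible *)

Definition fieldlike (S : comPzRingType) :=
  (1 : S) <> 0 /\ forall x : S, x <> 0 -> exists y, x * y = 1.

(** The equality is one of ring structures, so after substitution the theory of matrices over fields
    applies to [S] itself. *)
Lemma field_structure (S : comPzRingType) : fieldlike S ->
  exists F : fieldType, F = S :> comPzRingType.
Proof.
(* Taking [S] apart makes the ring underlying the new field convertible to [S]. *)
case: S => T [m1 m2 m3 m4 m5 m6 m7 m8 m9 m10 m11].
set S := GRing.ComPzRing.Pack _; move=> fS.
have n10 : (1 : S) != 0 by apply/eqP; exact: fS.1.
pose inv (x : S) : S :=
  if pselect (exists y, x * y = 1) is left h then sval (cid h) else x.
have mulVx : forall x : S, x != 0 -> inv x * x = 1.
  move=> x /eqP/fS.2 h; rewrite /inv; case: pselect => // h'.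
  by rewrite mulrC; case: cid.
have inv0 : inv 0 = 0.
  rewrite /inv; case: pselect => // h; have [y] := h.
  by rewrite mul0r => /esym/fS.1.
pose N : comNzRingType := HB.pack (GRing.ComPzRing.sort S)
  (GRing.ComPzRing.class S) (GRing.PzSemiRing_isNonZero.Build S n10).
pose F : fieldType := HB.pack (GRing.ComNzRing.sort N) (GRing.ComNzRing.class N)
  (GRing.ComNzRing_isField.Build N mulVx inv0).
exists F; reflexivity.
Qed.

Lemma hasdim_colspan (S : comPzRingType) n (U : set 'cV[S]_n) s : hasdim U s ->
  exists N : 'M[S]_(n, s), U = colspan N.
Proof.
move=> [b [bE _]]; exists (\matrix_(i, j) b j i 0); apply/seteqP; split=> u.
  by move=> /bE[c ->]; rewrite lincomb_id; eexists.
move=> [c ->]; apply/bE; exists (fun j => c j 0); rewrite lincomb_id.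
by congr (_ *m _); apply/matrixP => i j; rewrite (ord1 j) mxE.
Qed.

Section Fieldlike.
Variables (S : comPzRingType) (fS : fieldlike S).

Lemma fieldlike_flag n (U1 U2 : set 'cV[S]_n) s1 s2 :
  hasdim U1 s1 -> hasdim U2 s2 -> U1 `<=` U2 -> exists g h : 'M[S]_n,
  [/\ g *m h = 1%:M, U1 = coordspan g (lastp n s1) & U2 = coordspan g (lastp n s2)].
Proof.
have [F e] := field_structure fS; subst S.
move=> d1; have [N1 e1] := hasdim_colspan d1; move: d1; rewrite e1 => /hasdim_rank d1.
move=> d2; have [N2 e2] := hasdim_colspan d2; move: d2; rewrite e2 => /hasdim_rank d2.
move=> /flag_basis[g [gU]]; rewrite d1 d2 => h1 h2.
by exists g, (invmx g); rewrite mulmxV.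
Qed.

Lemma hasdim_minor n m (M : 'M[S]_(n, m)) s : hasdim (colspan M) s ->
  exists (f : 'I_s -> 'I_n) (g : 'I_s -> 'I_m), \det (mxsub f g M) <> 0.
Proof.
have [F e] := field_structure fS; subst S.
by move=> /hasdim_rank d; apply: rank_minor; rewrite d.
Qed.

Lemma hasdim_big_minor n m (M : 'M[S]_(n, m)) s (f : 'I_s.+1 -> 'I_n) (g : 'I_s.+1 -> 'I_m) :
  hasdim (colspan M) s -> \det (mxsub f g M) = 0.
Proof.
have [F e] := field_structure fS; subst S.
move=> /hasdim_rank d; apply: contrapT => /minor_rank; rewrite d.
by rewrite ltnn.
Qed.

(** Vanishing minors bound ranks only from above. Exactness makes the two ranks add up to
    [n = s + t], so the two bounds are equalities; in this way an exact rank becomes a closed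
    condition. *)
Lemma hasdim_of_minors n m q (M : 'M[S]_(n, m)) (N : 'M[S]_(q, n)) s t :
  (s + t = n)%N -> (forall u, N *m u = 0 <-> colspan M u) ->
  (forall (f : 'I_s.+1 -> 'I_n) (g : 'I_s.+1 -> 'I_m), \det (mxsub f g M) = 0) ->
  (forall (f : 'I_t.+1 -> 'I_q) (g : 'I_t.+1 -> 'I_n), \det (mxsub f g N) = 0) ->
  hasdim (colspan M) s.
Proof.
have [F e] := field_structure fS; subst S.
move=> st /exact_rank e hM hN; apply/hasdim_rank.
have h1 : (\rank M <= s)%N.
  by rewrite leqNgt; apply/negP => /rank_minor[f [g]]; apply; exact: hM.
have h2 : (\rank N <= t)%N.
  by rewrite leqNgt; apply/negP => /rank_minor[f [g]]; apply; exact: hN.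
lia.
Qed.

Lemma hasdim_exact n m q (M : 'M[S]_(n, m)) (N : 'M[S]_(q, n)) s t :
  (s + t = n)%N -> (forall u, N *m u = 0 <-> colspan M u) ->
  hasdim (colspan M) s -> hasdim (colspan N) t.
Proof.
have [F e] := field_structure fS; subst S.
move=> st /exact_rank e /hasdim_rank h; apply/hasdim_rank; lia.
Qed.

Lemma hasdim_trmx n m (M : 'M[S]_(n, m)) s : hasdim (colspan M) s -> hasdim (colspan M^T) s.
Proof.
have [F e] := field_structure fS; subst S.
by move=> /hasdim_rank h; apply/hasdim_rank; rewrite mxrank_tr.
Qed.

Lemma hasdim_unitl n m (g h : 'M[S]_n) (M : 'M[S]_(n, m)) s : g *m h = 1%:M ->
  hasdim (colspan M) s -> hasdim (colspan (g *m M)) s.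
Proof.
have [F e] := field_structure fS; subst S.
move=> gh /hasdim_rank d; apply/hasdim_rank; rewrite -d.
have hg := mulmx1C gh.
apply/eqP; rewrite eqn_leq mxrankM_maxr /=.
by rewrite -{1}[M]mul1mx -hg -mulmxA mxrankM_maxr.
Qed.

Lemma hasdim_unitr n m (g h : 'M[S]_m) (M : 'M[S]_(n, m)) s : g *m h = 1%:M ->
  hasdim (colspan M) s -> hasdim (colspan (M *m g)) s.
Proof.
move=> gh; have -> // : colspan (M *m g) = colspan M.
apply/seteqP; split=> u [c ->].
  by exists (g *m c); rewrite mulmxA.
by exists (h *m c); rewrite mulmxA -[M *m g *m h]mulmxA gh mulmx1.
Qed.

(** With [N = X M Y] invertible, [Y N^-1 X] is a generalized inverse of [M] of rank [s]. Multiplying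
    by the squared determinant removes the division and makes both sides vanish when [N] is
    singular, so the identity can be descended from fields. *)
Lemma pseudo_inverse n m (M : 'M[S]_(n, m)) s (X : 'M[S]_(s, n)) (Y : 'M[S]_(m, s)) :
  hasdim (colspan M) s ->
  M *m (Y *m (\det (X *m M *m Y) *: \adj (X *m M *m Y)) *m X) *m M =
  (\det (X *m M *m Y) ^+ 2) *: M.
Proof.
move=> /hasdim_factor[a [c ->]]; set N := X *m (a *m c) *m Y.
have [->|/fS.2[z hz]] := pselect (\det N = 0).
  by rewrite scale0r mulmx0 mul0mx mulmx0 mul0mx expr0n scale0r.
pose p := X *m a; pose q := c *m Y.
have eN : N = p *m q by rewrite /N /p /q !mulmxA.
have pq : p *m (z *: (q *m \adj N)) = 1%:M.
  by rewrite -scalemxAr mulmxA -eN mul_mx_adj scale_scalar_mx mulrC hz.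
have := mulmx1C pq; rewrite -scalemxAl => qp.
have {}qp : q *m \adj N *m p = (\det N)%:M.
  by rewrite -[LHS]scale1r -hz -scalerA qp scalemx1.
rewrite -scalemxAr -scalemxAl -scalemxAr -scalemxAl expr2 -scalerA; congr (_ *: _).
have -> : a *m c *m (Y *m \adj N *m X) *m (a *m c) = a *m (q *m \adj N *m p) *m c.
  by rewrite /q /p !mulmxA.
by rewrite qp mul_mx_scalar -scalemxAl.
Qed.
End Fieldlike.

(** * Descent from perfect fields *)

Section PalgLattices.
Variable D : base_data.

Section OnePalg.
Variable R : palg D.

Definition ldat : lift_data.
Proof.
refine (@LiftData (Aring R) (Bring R) R (AtoB R) (rd R) (varpi R) (piz R (-1))
  (@AtoB_inj D R) (piz1K R) _ (@rd_surj D R) _ (@rd_unit D R)).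
- by move=> x; have [m [a e]] := Bdenom x; exists m, a; rewrite -e.
- move=> a; split; first exact: rd_ker.
  by move=> [b ->]; exact: rd_varpi.
Defined.

Lemma lattice_latM n m (b : 'M[Bring R]_(n, m)) (phi : 'M[Bring R]_(m, n)) :
  adm (AtoB R) b phi -> lattice (latM (AtoB R) phi).
Proof.
move=> h; split; first exact: latM_submodule.
  exact: (latM_fg_projective (@AtoB_inj D R) h).
exact: (latM_absorb (@lddenom ldat)).
Qed.

Lemma latticeP n (E : set 'cV[Bring R]_n) : lattice E ->
  exists m (b : 'M[Bring R]_(n, m)) (phi : 'M[Bring R]_(m, n)),
    adm (AtoB R) b phi /\ E = latM (AtoB R) phi.
Proof.
move=> [smE fgE absE].
exact: (fg_projective_latM (@ldwX ldat) (@lddenom ldat) smE fgE absE).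
Qed.

Lemma std_latticeE n : std_lattice R n = [set v | intM (AtoB R) v].
Proof.
apply/seteqP; split=> v; rewrite /= intMP => h; last by move=> i; exact: h.
by move=> i j; rewrite (ord1 j); exact: h.
Qed.

Lemma std_latM n : std_lattice R n = latM (AtoB R) 1%:M.
Proof. by rewrite std_latticeE; apply/seteqP; split=> v; rewrite /latM mul1mx. Qed.

Lemma adm1 n : adm (AtoB R) (1%:M : 'M_n) 1%:M.
Proof. by rewrite /adm mulmx1; split=> //; exact: intM1. Qed.

Lemma WOmap_id (a : Aring R) : WOmap (palg_hom_k (hom_id R)) a = a.
Proof.
apply: invlim_inj => m /=; elim/tensorW: (il_proj a m) => [|x y hx hy|w c].
- exact: rmorph0.
- by rewrite rmorphD; congr (_ + _); [exact: hx|exact: hy].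
- rewrite [LHS]tmap_pure; congr (tpure _ _ _ _); exact: witt_inj.
Qed.
End OnePalg.

Lemma Bmap_ext (R R' : palg D) (h h' : {rmorphism Bring R -> Bring R'}) :
  (forall a, h (AtoB R a) = h' (AtoB R a)) -> (forall m : nat, h (piz R m%:Z) = piz R' m%:Z) ->
  h =1 h'.
Proof.
move=> e hp x; have [m [a ha]] := Bdenom x.
have hp' : h' (piz R m%:Z) = piz R' m%:Z by rewrite -(hp m) pizN e.
apply: (@piz_reg D R' m); rewrite -{1}(hp m) -hp' -rmorphM ha e -ha rmorphM //.
Qed.

Lemma resB_id (R : palg D) x : resB (hom_id R) x = x.
Proof.
apply: (@Bmap_ext R R (resB (hom_id R)) (idfun : {rmorphism Bring R -> Bring R})).
  by move=> a; rewrite BmapA WOmap_id.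
by move=> m; exact: Bmap_piz.
Qed.

Section Change.
Variables (R R' : palg D) (f : {rmorphism R -> R'}).
Variable (fk : forall c, f (pa_k R c) = pa_k R' c).

Lemma base_change_adm n m (b : 'M[Bring R]_(n, m)) phi : adm (AtoB R) b phi ->
  base_change (Bmap fk) (latM (AtoB R) phi) = latM (AtoB R') (map_mx (Bmap fk) phi).
Proof. by move=> h; exact: (base_change_latM (BmapA fk) h). Qed.

Lemma base_change_std n : base_change (Bmap fk) (std_lattice R n) = std_lattice R' n.
Proof. by rewrite std_latM (base_change_adm (@adm1 R n)) map_mx1 std_latM. Qed.

Lemma base_change_latU n (e : 'M[R]_n) : e *m e = e ->
  base_change (Bmap fk) (latU (d := ldat R) (colspan e)) =
  latU (d := ldat R') (colspan (map_mx f e)).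
Proof.
move=> ee.
exact: (@latU_change (ldat R) (ldat R') _ _ _ (BmapA fk) (rd_map fk) (WOmap_varpi fk) _ _ ee).
Qed.
End Change.

(** Write [x] as [a / pi^m]. Subtracting from the numerator the Teichmuller lift of its reduction
    and dividing by [pi], [m] times, yields [m] reductions, which are the equations. The last
    quotient represents [x] over every algebra where these equations vanish. *)
Lemma polar_part (R : palg D) (x : Bring R) : exists (I : set R) (a : Aring R),
  forall (R' : palg D) (f : palg_hom R R'),
    (integral (AtoB R') (resB f x) <-> forall i, I i -> f i = 0) /\
    (integral (AtoB R') (resB f x) -> resB f x = AtoB R' (WOmap (palg_hom_k f) a)).
Proof.
have [m [a ha]] := Bdenom x.
suff [I [b hb]] : exists (I : set R) (b : Aring R),
    forall (R' : palg D) (f : palg_hom R R'),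
    ((exists c, WOmap (palg_hom_k f) a = varpi R' ^+ m * c) <-> forall i, I i -> f i = 0) /\
    ((exists c, WOmap (palg_hom_k f) a = varpi R' ^+ m * c) ->
     WOmap (palg_hom_k f) a = varpi R' ^+ m * WOmap (palg_hom_k f) b).
  exists I, b => R' f.
  have fE y : resB f x = AtoB R' y <-> WOmap (palg_hom_k f) a = varpi R' ^+ m * y.
    have e : piz R' m%:Z * resB f x = AtoB R' (WOmap (palg_hom_k f) a).
      by rewrite -(Bmap_piz (palg_hom_k f) m%:Z) -BmapA -ha rmorphM.
    split=> [h|h].
      by apply: (@AtoB_inj D R'); rewrite -e h rmorphM.
    by apply: (@piz_reg D R' m); rewrite e h rmorphM.
  have eq : integral (AtoB R') (resB f x) <->
      exists c, WOmap (palg_hom_k f) a = varpi R' ^+ m * c.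
    by split=> -[c /fE hc]; exists c.
  by rewrite eq; have [h1 h2] := hb R' f; split=> // /h2 /fE.
elim: m a {x ha} => [|m IH] a.
  exists set0, a => R' f; split; last by rewrite expr0 mul1r.
  split=> // _; exists (WOmap (palg_hom_k f) a); rewrite expr0 mul1r //.
have [a1 ha1] := WO_decomp (pa_perfect R) a.
have [I [b hb]] := IH a1.
exists (fun i => i = rd R a \/ I i), b => R' f.
set h := WOmap (palg_hom_k f).
have fa : h a = WOteich _ (f (rd R a)) + varpi R' * h a1.
  rewrite {1}ha1 rmorphD rmorphM.
  congr (_ + _ * _); first exact: WOmap_teich.
  exact: WOmap_varpi.
have fa0 : f (rd R a) = 0 -> h a = varpi R' * h a1.
  by move=> e; rewrite fa e [WOteich _ 0]WOteich0 add0r.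
have red0 c : h a = varpi R' ^+ m.+1 * c -> f (rd R a) = 0.
  move=> e; have <- : rd R' (h a) = f (rd R a) by exact: rd_map.
  by rewrite e exprS -mulrA rd_varpi.
have eqc c : f (rd R a) = 0 -> h a = varpi R' ^+ m.+1 * c <-> h a1 = varpi R' ^+ m * c.
  move=> /fa0 ->; rewrite exprS -mulrA; split=> [/varpi_reg //|->] //.
have [h1 h2] := hb R' f.
split; last first.
  move=> [c hc]; apply/(eqc _ (red0 _ hc)); apply: h2; exists c; exact/eqc/hc/red0/hc.
split=> [[c hc] i [->|Ii]|hI]; first exact: red0 hc.
  apply: (h1.1 _ i Ii); exists c; apply/eqc => //; exact: red0 hc.
have f0 : f (rd R a) = 0 by apply: hI; left.
have [c hc] : exists c, h a1 = varpi R' ^+ m * c.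
  by apply/h1 => i Ii; apply: hI; right.
by exists c; apply/eqc.
Qed.

Lemma polar_partM (R : palg D) m n (M : 'M[Bring R]_(m, n)) :
  exists (I : set R) (N : 'M[Aring R]_(m, n)), forall (R' : palg D) (f : palg_hom R R'),
    (intM (AtoB R') (map_mx (resB f) M) <-> forall i, I i -> f i = 0) /\
    (intM (AtoB R') (map_mx (resB f) M) ->
     map_mx (resB f) M = map_mx (AtoB R') (map_mx (WOmap (palg_hom_k f)) N)).
Proof.
have /choice[I hI] (ij : 'I_m * 'I_n) := polar_part (M ij.1 ij.2).
have {hI} /choice[N hN] := hI.
exists (fun r => exists ij, I ij r), (\matrix_(i, j) N (i, j)) => R' f.
split; last first.
  move=> /intMP h; apply/matrixP => i j; rewrite !mxE.
  have [_ h2] := hN (i, j) R' f; apply: h2.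
  by have := h i j; rewrite mxE.
rewrite intMP; split=> [h r [[i j] Ir]|h i j].
  have [h1 _] := hN (i, j) R' f; apply: (h1.1 _ r Ir).
  by have := h i j; rewrite mxE.
rewrite mxE; have [h1 _] := hN (i, j) R' f; apply/h1 => r Ir.
by apply: h; exists (i, j).
Qed.

Lemma intM_descent (R : palg D) m n (M : 'M[Bring R]_(m, n)) :
  (forall (K : palg D) (f : palg_hom R K), is_field K -> intM (AtoB K) (map_mx (resB f) M)) ->
  intM (AtoB R) M.
Proof.
move=> h; have [I [N hN]] := polar_partM M.
have [h1 _] := hN R (hom_id R).
have e : map_mx (resB (hom_id R)) M = M by apply/matrixP => i j; rewrite mxE resB_id.
rewrite -e; apply/h1 => i Ii; apply: field_descent => K f Kf.
have [h2 _] := hN K f; apply: (h2.1 _ i Ii); exact: h.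
Qed.

Lemma mx_descent (R : palg D) m n (M N : 'M[R]_(m, n)) :
  (forall (K : palg D) (f : palg_hom R K), is_field K -> map_mx f M = map_mx f N) -> M = N.
Proof.
move=> h; apply/matrixP => i j; apply/eqP; rewrite -subr_eq0; apply/eqP.
apply: field_descent => K f /(h K f)/matrixP/(_ i j); rewrite !mxE rmorphB => ->.
by rewrite subrr.
Qed.

(** The scalars [r] for which [r M] has the form [M G M] are an ideal. Were it proper, it would
    vanish in some perfect field, where [M] has a nonzero minor of size [s]; but the square of every
    such minor is in the ideal. So [M = M G M] for some [G], and [M G] is the projector. *)
Lemma constant_rank_idem (R : palg D) n m (M : 'M[R]_(n, m)) s :
  (forall (K : palg D) (f : palg_hom R K), is_field K -> hasdim (colspan (map_mx f M)) s) ->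
  exists (e : 'M[R]_n) (G : 'M[R]_(m, n)), [/\ e *m e = e, e *m M = M & e = M *m G].
Proof.
move=> hM; suff [G hG] : exists G, M *m G *m M = M.
  by exists (M *m G), G; split=> //; rewrite mulmxA hG.
pose I (r : R) := exists G, M *m G *m M = r *: M.
suff [G hG] : I 1 by exists G; rewrite hG scale1r.
apply: contrapT => I1.
have [||K [f [Kf fI]]] := @palg_residue_field D R I.
- split=> // [x y [G hG] [H hH]|c x [G hG]].
    by exists (G + H); rewrite mulmxDr mulmxDl hG hH scalerDl.
  by exists (c *: G); rewrite -scalemxAr -scalemxAl hG scalerA.
- by exists 0; rewrite mulmx0 mul0mx scale0r.
have [g1 [g2]] := hasdim_minor Kf (hM K f Kf).
rewrite -map_mxsub det_map_mx; set dt := \det _; apply.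
pose X : 'M[R]_(s, n) := rowsub g1 1%:M; pose Y : 'M[R]_(m, s) := colsub g2 1%:M.
have sel : X *m M *m Y = mxsub g1 g2 M.
  by rewrite /X /Y -rowsubE mulmx_colsub mulmx1 -mxsubcr.
(* The identity of [pseudo_inverse] holds at every perfect field because the rank is [s] there,
   hence it holds over [R]. *)
have : f (dt ^+ 2) = 0.
  apply: fI; exists (Y *m (dt *: \adj (X *m M *m Y)) *m X).
  apply: mx_descent => L g Lf.
  have := pseudo_inverse Lf (map_mx g X) (map_mx g Y) (hM L g Lf).
  rewrite -!map_mxM -map_mx_adj det_map_mx sel -/dt => e.
  by rewrite !(map_mxM, map_mxZ) rmorphXn -e.
by rewrite rmorphXn => /palg_nilp.
Qed.
End PalgLattices.

(** * Minuscule relative positions *)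

Lemma hasdim_left_inverse (S : comPzRingType) n t (N : 'M[S]_(n, t)) L :
  L *m N = 1%:M -> hasdim (colspan N) t.
Proof.
move=> LN; exists (fun j => col j N).
have e : \matrix_(i, j) col j N i 0 = N by apply/matrixP => i j; rewrite !mxE.
split=> [u|c].
  split=> [[c ->]|[c ->]]; last by rewrite lincomb_id e; eexists.
  exists (fun j => c j 0); rewrite lincomb_id e; congr (_ *m _).
  by apply/matrixP => i j; rewrite (ord1 j) mxE.
rewrite lincomb_id e => h j.
have : L *m (N *m \col_j c j) = 0 by rewrite h mulmx0.
by rewrite mulmxA LN mul1mx => /matrixP/(_ j 0); rewrite !mxE.
Qed.

Lemma hasdim_coordspan (S : comPzRingType) n (g h : 'M[S]_n) (P : pred 'I_n) t a :
  g *m h = 1%:M -> (a + t <= n)%N -> (forall i : 'I_n, P i = (a <= i < a + t)%N) ->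
  hasdim (coordspan g P) t.
Proof.
move=> gh le hP; have hg := mulmx1C gh.
have lt_emb (j : 'I_t) : (a + j < n)%N by have := ltn_ord j; lia.
pose emb j := Ordinal (lt_emb j).
pose E : 'M[S]_(n, t) := \matrix_(i, j) (i == emb j)%:R.
have emb_inj j l : (emb j == emb l) = (j == l).
  by apply/eqP/eqP => [/(congr1 val) /= e|-> //]; apply: val_inj => /=; lia.
have EE : E^T *m E = 1%:M.
  apply/matrixP => j l; rewrite !mxE (bigD1 (emb j)) //= big1 ?addr0 => [|i /negPf hi].
    by rewrite !mxE eqxx mul1r emb_inj.
  by rewrite !mxE hi mul0r.
have -> : coordspan g P = colspan (g *m E).
  apply/seteqP; split=> u.
    move=> [c hc ->]; exists (\col_j c (emb j) 0); rewrite -mulmxA; congr (_ *m _).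
    apply/matrixP => i j; rewrite (ord1 j) mxE.
    case hPi : (P i); last first.
      rewrite hc ?hPi // big1 // => l _; rewrite !mxE; case: eqP => [e|_]; last by rewrite mul0r.
      by move: hPi; rewrite hP e /=; have := ltn_ord l; lia.
    have lti : (i - a < t)%N by move: hPi; rewrite hP; lia.
    have ei : i = emb (Ordinal lti) by apply: val_inj => /=; move: hPi; rewrite hP; lia.
    rewrite (bigD1 (Ordinal lti)) //= big1 ?addr0 => [|l hl].
      by rewrite !mxE -ei eqxx mul1r.
    rewrite !mxE; have -> : (i == emb l) = false; last by rewrite mul0r.
    by rewrite {1}ei emb_inj eq_sym (negPf hl).
  move=> [c ->]; rewrite -mulmxA; exists (E *m c) => // i hi.
  rewrite mxE big1 // => l _; rewrite mxE; case: eqP => [e|_]; last by rewrite mul0r.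
  by move: hi; rewrite hP e /=; have := ltn_ord l; lia.
apply: (hasdim_left_inverse (L := E^T *m h)).
by rewrite mulmxA -(mulmxA _ h) hg mulmx1.
Qed.

Lemma lastpE n s (i : 'I_n) : (s <= n)%N -> lastp n s i = (n - s <= i < n - s + s)%N.
Proof. by move=> h; rewrite /lastp /=; have := ltn_ord i; lia. Qed.

Lemma hasdim_lastp (S : comPzRingType) n (g h : 'M[S]_n) s :
  g *m h = 1%:M -> (s <= n)%N -> hasdim (coordspan g (lastp n s)) s.
Proof.
move=> gh le; apply: (hasdim_coordspan (a := n - s) gh) => [|i]; first by rewrite subnK.
exact: lastpE.
Qed.

Section Minuscule.
Variable n : nat.

(** The common shape of the three bounds: [s] is [r - 1], 2 and [n - (r - 1)], with [c] equal to 0,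
    -1 and -1. *)
Definition mlast s (c : int) : cochar n := (c, \row_i - (lastp n s i : nat)%:Z).

Lemma sum_eps2 (P : pred 'I_n) j : (\sum_(i < n | P i) eps i).2 0 j = (P j : nat)%:Z.
Proof.
have -> : (\sum_(i < n | P i) eps i).2 = \sum_(i < n | P i) (eps i).2.
  by elim/big_rec2: _ => // i x y _ <-.
rewrite summxE /=; case hP : (P j); last first.
  rewrite big1 // => i hi; rewrite mxE /=; case: eqP => // e.
  by move: hi; rewrite -e hP.
rewrite (bigD1 j) //= big1 ?addr0 ?mxE ?eqxx // => i /andP[_ /negPf hi].
by rewrite mxE eq_sym hi.
Qed.

Lemma sum_eps1 (P : pred 'I_n) : (\sum_(i < n | P i) eps i).1 = 0.
Proof.
have -> : (\sum_(i < n | P i) eps i).1 = \sum_(i < n | P i) (eps i).1.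
  by elim/big_rec2: _ => // i x y _ <-.
by rewrite big1.
Qed.

Lemma star_nu r : (r.-1 <= n)%N -> star (nu n r) = mlast r.-1 0.
Proof.
move=> le; rewrite /star /nu sum_eps1 oppr0; congr (_, _); apply/rowP => i.
rewrite !mxE sum_eps2 /lastp /=; congr (- (nat_of_bool _)%:Z).
have := ltn_ord i; lia.
Qed.

Lemma star_mu : (2 <= n)%N -> star (mu n) = mlast 2 (-1).
Proof.
move=> le; rewrite /star /mu /=; congr (_, _).
  by rewrite sum_eps1 addr0.
apply/rowP => i; rewrite !mxE sum_eps2 /lastp /= add0r; congr (- (nat_of_bool _)%:Z).
have := ltn_ord i; lia.
Qed.

Lemma star_tau : star (tau n) = (-1, \row_i -1).
Proof.
rewrite /star /tau /=; congr (_, _); first by rewrite sum_eps1 addr0.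
by apply/rowP => i; rewrite !mxE sum_eps2 /= add0r.
Qed.

Lemma nu_star_tau r : (r.-1 <= n)%N -> nu n r + star (tau n) = mlast (n - r.-1) (-1).
Proof.
move=> le; rewrite star_tau /nu /mlast.
apply: (congr2 pair); first by rewrite /= sum_eps1 add0r.
apply/rowP => i; rewrite [LHS]mxE sum_eps2 !mxE /lastp /= subKn //.
by case: ltnP.
Qed.

(** Coroots vanish on the similitude factor and have sum 0, and a positive coroot never lowers the
    first coordinate nor raises the last one. *)
Lemma coch_le_prefix (l l' : cochar n) : coch_le l' l ->
  [/\ l'.1 = l.1, \sum_i l'.2 0 i = \sum_i l.2 0 i,
   forall i0 : 'I_n, (forall i : 'I_n, i0 <= i)%N -> (l'.2 0 i0 <= l.2 0 i0)%R &
   forall i0 : 'I_n, (forall i : 'I_n, i <= i0)%N -> (l.2 0 i0 <= l'.2 0 i0)%R].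
Proof.
move=> [c e].
pose t (i j : 'I_n) : cochar n := (eps i - eps j) *+ c i j.
have {}e : l = l' + \sum_(i < n) \sum_(j < n | (i < j)%N) t i j := e.
have sum1 (f : cochar n -> int) : f 0 = 0 -> {morph f : x y / x + y} ->
    f l = f l' + \sum_(i < n) \sum_(j < n | (i < j)%N) f (t i j).
  move=> f0 fD; rewrite e fD; congr (_ + _).
  rewrite (big_morph f fD f0); apply: eq_bigr => i _; exact: (big_morph f fD f0).
have fMn (f : cochar n -> int) (x : cochar n) m : f 0 = 0 -> {morph f : x y / x + y} -> f (x *+ m) = f x *+ m.
  by move=> f0 fD; elim: m => [|m IH]; rewrite ?mulr0n // !mulrS fD IH.
have fB (f : cochar n -> int) (x y : cochar n) : f 0 = 0 -> {morph f : x y / x + y} -> f (x - y) = f x - f y.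
  by move=> f0 fD; apply/(canRL (addrK _)); rewrite -fD subrK.
have epsE (k i : 'I_n) : (eps i).2 0 k = (i == k)%:R by rewrite mxE /= eq_sym.
split.
- rewrite (sum1 (fun x => x.1)) // [X in _ + X]big1 ?addr0 // => i _.
  rewrite big1 // => j _; rewrite (fMn (fun x => x.1)) //=.
  by rewrite subrr mul0rn.
- pose f (x : cochar n) := \sum_i x.2 0 i.
  have f0 : f 0 = 0 by rewrite /f big1 // => i _; rewrite mxE.
  have fD : {morph f : x y / x + y}.
    by move=> x y; rewrite /f -big_split; apply: eq_bigr => i _; rewrite mxE.
  rewrite -/(f l) -/(f l') (sum1 f) // [X in _ + X]big1 ?addr0 // => i _.
  rewrite big1 // => j _; rewrite (fMn f) // (fB f) //.
  have h k : f (eps k) = 1.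
    rewrite /f (bigD1 k) //= epsE eqxx big1 ?addr0 // => u /negPf hu.
    by rewrite epsE eq_sym hu.
  by rewrite !h subrr mul0rn.
- move=> i0 h0; pose f (x : cochar n) := x.2 0 i0.
  have f0 : f 0 = 0 by rewrite /f mxE.
  have fD : {morph f : x y / x + y} by move=> x y; rewrite /f mxE.
  rewrite -/(f l) -/(f l') (sum1 f) // Num.Theory.lerDl.
  apply: Num.Theory.sumr_ge0 => i _; apply: Num.Theory.sumr_ge0 => j ij.
  rewrite (fMn f) // (fB f) // /f !epsE.
  have -> : (j == i0) = false.
    by apply/negbTE/eqP => ej; have := h0 i; rewrite -ej leqNgt ij.
  by rewrite subr0; apply: Num.Theory.mulrn_wge0; rewrite Num.Theory.ler0n.
- move=> i0 h0; pose f (x : cochar n) := x.2 0 i0.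
  have f0 : f 0 = 0 by rewrite /f mxE.
  have fD : {morph f : x y / x + y} by move=> x y; rewrite /f mxE.
  rewrite -/(f l) -/(f l') (sum1 f) // Num.Theory.gerDl.
  apply: Num.Theory.sumr_le0 => i _; apply: Num.Theory.sumr_le0 => j ij.
  rewrite (fMn f) // (fB f) // /f !epsE.
  have -> : (i == i0) = false.
    by apply/negbTE/eqP => ej; have := h0 j; rewrite -ej leqNgt ij.
  rewrite sub0r mulNrn Num.Theory.oppr_le0.
  by apply: Num.Theory.mulrn_wge0; rewrite Num.Theory.ler0n.
Qed.

(** Dominance squeezes all coordinates between the last and the first one, so they are 0 or -1; a
    nonincreasing sequence of such values is determined by its sum. *)
Lemma minuscule_le s c (l' : cochar n) : (0 < n)%N -> (s <= n)%N ->
  dominant l' -> coch_le l' (mlast s c) -> l' = mlast s c.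
Proof.
move=> n0 sn dom /coch_le_prefix[e1 e2 hfst hlst].
pose fst := Ordinal n0.
have ltl : (n.-1 < n)%N by rewrite prednK.
pose lst := Ordinal ltl.
pose y i := l'.2 0 i.
have mE i : (mlast s c).2 0 i = - (lastp n s i : nat)%:Z by rewrite mxE.
have y0 i : (y i <= 0)%R.
  apply: Order.POrderTheory.le_trans (dom fst i _) _; first exact: leq0n.
  by apply: Order.POrderTheory.le_trans (hfst fst _) _ => //; rewrite mE; lia.
have y1 i : (-1 <= y i)%R.
  apply: Order.POrderTheory.le_trans (dom i lst _); last by have := ltn_ord i; rewrite /=; lia.
  apply: Order.POrderTheory.le_trans (hlst lst _); first by rewrite mE; case: lastp.
  by move=> i'; have := ltn_ord i'; rewrite /=; lia.
have sum_le (u v : 'I_n -> int) : \sum_i u i = \sum_i v i -> (forall i, u i <= v i)%R -> u =1 v.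
  move=> es le i; apply/eqP; rewrite eq_sym -subr_eq0; apply/eqP; move: i.
  have h : \sum_i (v i - u i) = 0 by rewrite sumrB es subrr.
  move=> i; apply: (Num.Theory.psumr_eq0P _ h) => // j _.
  by rewrite Num.Theory.subr_ge0.
pose m i := (mlast s c).2 0 i.
have em : \sum_i y i = \sum_i m i := e2.
(* If the sequences differ at [i], monotonicity of both makes one of them dominate the other
   everywhere, and equality of the sums then makes them equal. *)
have ym i : y i = m i.
  have := y0 i; have := y1 i; case mi : (lastp n s i).
    have [yi _ _|yi h1 h2] := eqVneq (y i) 0; last by rewrite /m mE mi; lia.
    apply/esym; apply: sum_le => // j; rewrite /m mE.
    case: (leqP i j) => ij.
      have -> : lastp n s j by move: mi; rewrite /lastp /=; lia.
      exact: y1.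
    by have := dom j i (ltnW ij); rewrite -/(y i) -/(y j) yi; case: lastp; lia.
  have [yi _ _|yi h1 h2] := eqVneq (y i) (-1); last by rewrite /m mE mi; lia.
  apply: sum_le => // j; rewrite /m mE.
  case: (leqP i j) => ij.
    by have := dom i j ij; rewrite -/(y i) -/(y j) yi; case: lastp; lia.
  have -> : lastp n s j = false by move: mi; rewrite /lastp /=; lia.
  exact: y0.
rewrite [l']surjective_pairing e1; congr (_, _); apply/rowP => i.
by rewrite -[LHS]/(y i) ym.
Qed.
End Minuscule.

Lemma dominant_mlast n s c : dominant (mlast n s c).
Proof.
move=> i j ij; rewrite !mxE /lastp /=.
by case: (leqP (n - s) i) => h; case: (leqP (n - s) j) => h' //; lia.
Qed.

Lemma coch_le_refl n (l : cochar n) : coch_le l l.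
Proof.
exists (fun _ _ => 0%N); rewrite big1 ?addr0 // => i _.
by rewrite big1 // => j _; rewrite mulr0n.
Qed.

(** * Bases of lattices adapted to a flag *)

Section FlagLattices.
Variable d : lift_data.
Local Notation A := (ldA d).
Local Notation B := (ldB d).
Local Notation iota := (ldin d).
Local Notation v := (ldv d).

Lemma intM_coordspan n (G H : 'M[A]_n) : G *m H = 1%:M ->
  mbasis iota (fun i => col i (map_mx iota G)) [set x | intM iota x].
Proof.
move=> GH; have HG := mulmx1C GH.
have e : \matrix_(i, j) col j (map_mx iota G) i 0 = map_mx iota G.
  by apply/matrixP => i j; rewrite !mxE.
split=> [x|c].
  split=> [[a ->]|[c ->]]; last first.
    by rewrite lincombE e -map_mxM; exists (G *m \col_j c j).
  exists (fun i => (H *m a) i 0); rewrite lincombE e -map_mxM.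
  have -> : \col_j (H *m a) j 0 = H *m a.
    by apply/matrixP => i j; rewrite (ord1 j) mxE.
  by rewrite mulmxA GH mul1mx.
rewrite lincombE e -map_mxM -(map_mx0 iota) => /map_iota_inj h j.
have : H *m (G *m \col_i c i) = 0 by rewrite h mulmx0.
by rewrite mulmxA HG mul1mx => /matrixP/(_ j 0); rewrite !mxE.
Qed.

Lemma mbasis_unique n m (b : 'I_m -> 'cV[B]_n) E E' :
  mbasis iota b E -> mbasis iota b E' -> E = E'.
Proof.
by move=> [h _] [h' _]; apply/seteqP; split=> x; [move=> /h/h'|move=> /h'/h].
Qed.

Lemma mbasis_mul n m (g h : 'M[B]_n) (b : 'I_m -> 'cV[B]_n) E : h *m g = 1%:M ->
  mbasis iota b E -> mbasis iota (fun i => g *m b i) ((mulmx g) @` E).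
Proof.
move=> hg [bE bI].
have e c : lincomb iota c (fun i => g *m b i) = g *m lincomb iota c b.
  by rewrite /lincomb mulmx_sumr; apply: eq_bigr => i _; rewrite scalemxAr.
split=> [x|c].
  split=> [[y /bE[c ->] <-]|[c ->]]; first by exists c; rewrite e.
  by rewrite e; exists (lincomb iota c b) => //; apply/bE; exists c.
rewrite e => h0; apply: bI; rewrite -[LHS]mul1mx -hg -mulmxA.
by move: h0 => ->; rewrite mulmx0.
Qed.

(** Dividing the columns of [G] in [P1] by the uniformizer gives a matrix [g] that carries the
    standard lattice to that of [P1]. Pulled back by [g], the lattice of [P2] keeps only the indices
    outside [P1]. This replaces a position relative to another lattice by one relative to the
    standard lattice. *)
Lemma latU_coordspan_mul n (G H : 'M[A]_n) (P1 P2 : pred 'I_n) : G *m H = 1%:M ->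
  {subset P1 <= P2} ->
  exists g h : 'M[B]_n, [/\ g *m h = 1%:M,
    latU (coordspan (map_mx (ldrd d) G) P1) = (mulmx g) @` [set x | intM iota x] &
    latU (coordspan (map_mx (ldrd d) G) P2) =
      (mulmx g) @` latU (coordspan 1%:M [pred i | P2 i && ~~ P1 i])].
Proof.
move=> GH sP; pose s1 := diag_mx (\row_i coord_scale d P1 i).
pose s1' := diag_mx (\row_i if P1 i then iota (ldw d) else 1).
have s1V : s1 *m s1' = 1%:M.
  rewrite mulmx_diag -diag_const_mx; congr diag_mx; apply/rowP => i; rewrite !mxE /coord_scale.
  by case: (P1 i); rewrite ?mulr1 // mulrC ldwv.
pose g := map_mx iota G *m s1; pose h := s1' *m map_mx iota H.
have gh : g *m h = 1%:M.
  by rewrite /g /h mulmxA -(mulmxA _ s1) s1V mulmx1 -map_mxM GH map_mx1.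
have colg i (y : B) : y *: col i g = (coord_scale d P1 i * y) *: col i (map_mx iota G).
  by apply/matrixP => j l; rewrite /g mul_mx_diag !mxE; ring.
have std1 : (1%:M : 'M[A]_n) *m 1%:M = 1%:M by rewrite mulmx1.
have mcol i : g *m col i (map_mx iota 1%:M) = col i g.
  by rewrite map_mx1 !colE mul1mx.
exists g, h; split=> //.
  apply: (mbasis_unique (mbasis_latU P1 GH)).
  have := mbasis_mul (mulmx1C gh) (intM_coordspan std1).
  congr mbasis; apply/funext => i; rewrite mcol -[LHS]scale1r colg mulr1 //.
apply: (mbasis_unique (mbasis_latU P2 GH)).
have := mbasis_mul (mulmx1C gh) (mbasis_latU [pred i | P2 i && ~~ P1 i] std1).
rewrite !map_mx1; congr mbasis; apply/funext => i.
rewrite -scalemxAr -[1%:M](map_mx1 iota) mcol colg; congr (_ *: _).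
rewrite /coord_scale /=; case P1i : (P1 i); first by rewrite andbF (_ : P2 i) ?mulr1 //; exact: sP.
by rewrite andbT mul1r.
Qed.

Lemma mbasis_coord_latU n (P : pred 'I_n) (e : 'I_n -> 'cV[B]_n) E :
  mbasis iota e [set x | intM iota x] ->
  mbasis iota (fun i => coord_scale d P i *: e i) E ->
  exists g h : 'M_n, g *m h = 1%:M /\ E = latU (coordspan g P).
Proof.
move=> /mbasis_std[G [H [GH eG]]] hE.
exists (map_mx (ldrd d) G), (map_mx (ldrd d) H); split.
  by rewrite -map_mxM GH map_mx1.
apply: mbasis_unique hE _; have := mbasis_latU P GH.
have -> // : (fun i => coord_scale d P i *: col i (map_mx iota G)) =
  (fun i => coord_scale d P i *: e i).
by apply/funext => i; rewrite eG.
Qed.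

Lemma latU_coord_mbasis n (P : pred 'I_n) (g h : 'M_n) : g *m h = 1%:M ->
  exists e : 'I_n -> 'cV[B]_n, mbasis iota e [set x | intM iota x] /\
    mbasis iota (fun i => coord_scale d P i *: e i) (latU (coordspan g P)).
Proof.
move=> gh; have [G hG] := rdM_surj g.
have [|H GH] := @invertible_lift d _ G h; first by rewrite hG.
exists (fun i => col i (map_mx iota G)); split; first exact: (intM_coordspan GH).
by rewrite -hG; exact: (mbasis_latU P GH).
Qed.

Lemma mbasis_scale n m (c c' : B) (b : 'I_m -> 'cV[B]_n) S : c' * c = 1 -> mbasis iota b S ->
  mbasis iota (fun i => c *: b i) ((fun u => c *: u) @` S).
Proof.
move=> cc hb.
have cE : (fun u => c *: u) @` S = mulmx c%:M @` S.
  by apply/seteqP; split=> x [u hu <-]; exists u => //; rewrite mul_scalar_mx.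
have c1 : c'%:M *m c%:M = 1%:M :> 'M_n by rewrite -scalar_mxM cc.
have -> : (fun i => c *: b i) = (fun i => c%:M *m b i).
  by apply/funext => i; rewrite mul_scalar_mx.
by rewrite cE; exact: (mbasis_mul c1 hb).
Qed.
End FlagLattices.

Section Positions.
Variables (D : base_data) (n : nat).
Local Notation lat R := (latU (d := ldat R)).

Definition scaled_std (R : palg D) (c : int) : set 'cV[Bring R]_1 :=
  (fun u => piz R c *: u) @` std_lattice R 1.
Arguments scaled_std : clear implicits.

Lemma piz_opp (R : palg D) c : piz R c * piz R (- c) = 1.
Proof.
case: c => [[|m]|m]; last by rewrite mulrC; exact: piz_negz.
  by rewrite oppr0 piz0 mulr1.
exact: piz_negz.
Qed.

Lemma piz_mlast (R : palg D) s c i :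
  piz R ((mlast n s c).2 0 i) = coord_scale (ldat R) (lastp n s) i.
Proof. by rewrite mxE /coord_scale; case: lastp; rewrite /= ?oppr0 ?piz0. Qed.

Lemma invertible_map (S S' : comPzRingType) (f : {rmorphism S -> S'}) m (G H : 'M[S]_m) :
  G *m H = 1%:M -> map_mx f G *m map_mx f H = 1%:M.
Proof. by move=> e; rewrite -map_mxM e map_mx1. Qed.

Lemma rel_pos_mlast (R : palg D) s c (x : ps_pt (Pt D n) R) :
  rel_pos (mlast n s c) x (std n R) <->
  x.2 = scaled_std R c /\
  exists g h : 'M[R]_n, g *m h = 1%:M /\ x.1 = lat R (coordspan g (lastp n s)).
Proof.
have pE (e : 'I_n -> 'cV[Bring R]_n) : (fun i => piz R ((mlast n s c).2 0 i) *: e i) =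
    (fun i => coord_scale (ldat R) (lastp n s) i *: e i).
  by apply/funext => i; rewrite piz_mlast.
split.
  move=> [e [e0 []]]; rewrite pE [(std n R).1]std_latticeE => h1 h2 h3 h4.
  have h4' := mbasis_scale (d := ldat R) (etrans (mulrC _ _) (piz_opp R c)) h3.
  split; first exact: (mbasis_unique (d := ldat R) h4 h4').
  exact: (mbasis_coord_latU (d := ldat R) h1 h2).
move=> [hx2 [g [h [gh hx1]]]].
have [e [h1 h2]] := latU_coord_mbasis (d := ldat R) (lastp n s) gh.
have std1 : (1%:M : 'M[R]_1) *m 1%:M = 1%:M by rewrite mulmx1.
have [e0 [h3 _]] := latU_coord_mbasis (d := ldat R) xpred0 std1.
have {}h3 : mbasis (AtoB R) e0 (std_lattice R 1) by rewrite std_latticeE.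
exists e, e0; split.
- by rewrite [(std n R).1]std_latticeE.
- by rewrite pE hx1.
- exact: h3.
- by rewrite hx2; exact: (mbasis_scale (d := ldat R) (etrans (mulrC _ _) (piz_opp R c)) h3).
Qed.

Lemma rel_pos_act (R : palg D) (l : cochar n) (x y : ps_pt (Pt D n) R) g h c c' :
  h *m g = 1%:M -> c' * c = 1 -> rel_pos l x y -> rel_pos l (grp_act g c x) (grp_act g c y).
Proof.
move=> hg cc [e [e0 [h1 h2 h3 h4]]].
exists (fun i => g *m e i), (fun i => c *: e0 i); split.
- exact: (mbasis_mul (d := ldat R) hg h1).
- have -> : (fun i => piz R (l.2 0 i) *: (g *m e i)) = (fun i => g *m (piz R (l.2 0 i) *: e i)).
    by apply/funext => i; rewrite scalemxAr.
  exact: (mbasis_mul (d := ldat R) hg h2).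
- exact: (mbasis_scale (d := ldat R) cc h3).
- have -> : (fun i => piz R l.1 *: (c *: e0 i)) = (fun i => c *: (piz R l.1 *: e0 i)).
    by apply/funext => i; rewrite !scalerA mulrC.
  exact: (mbasis_scale (d := ldat R) cc h4).
Qed.

Lemma image_mulmx (S : comPzRingType) m (e : 'M[S]_m) : (mulmx e) @` [set: 'cV_m] = colspan e.
Proof. by apply/seteqP; split=> u; [move=> [c _ <-]; exists c|move=> [c ->]; exists c]. Qed.

Definition const_rank (R : palg D) m q (M : 'M[R]_(m, q)) s :=
  forall (K : palg D) (f : palg_hom R K), is_field K -> hasdim (colspan (map_mx f M)) s.

Lemma subbundleE (R : palg D) s (U : set 'cV[R]_n) :
  subbundle s U <-> exists e : 'M[R]_n, [/\ e *m e = e, U = colspan e & const_rank e s].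
Proof.
split=> -[e [ee eU er]]; exists e; split=> //.
- by rewrite eU image_mulmx.
- by move=> K f Kf; have := er K f Kf; rewrite image_mulmx.
- by rewrite eU image_mulmx.
- by move=> K f Kf; have := er K f Kf; rewrite image_mulmx.
Qed.
End Positions.
Arguments scaled_std {D} R c _.

Lemma colspan_factor (S : comPzRingType) n m (e : 'M[S]_n) (M : 'M[S]_(n, m)) G :
  e *m M = M -> e = M *m G -> colspan e = colspan M.
Proof.
move=> eM eG; apply/seteqP; split=> u [c ->].
  by exists (G *m c); rewrite eG mulmxA.
by exists (M *m c); rewrite mulmxA eM.
Qed.

Section LatticeBounds.
Variable d : lift_data.
Local Notation A := (ldA d).
Local Notation B := (ldB d).
Local Notation iota := (ldin d).

Lemma latM_sup n m (phi : 'M[B]_(m, n)) (c : B) :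
  (forall x, intM iota x -> latM iota phi (c *: x)) -> intM iota (c *: phi).
Proof.
move=> h; apply/intMP => i j.
have := h (delta_mx j 0) (ex_intro _ (delta_mx j 0) (esym (map_delta_mx _ _ _))).
by rewrite /latM -scalemxAr -colE => /intMP/(_ i 0); rewrite !mxE.
Qed.

Lemma latM_sub n m (b : 'M[B]_(n, m)) (phi : 'M[B]_(m, n)) (c : B) : adm iota b phi ->
  (forall x, latM iota phi x -> intM iota (c *: x)) -> intM iota (c *: b).
Proof.
move=> hb h; apply/intMP => i j.
by have /intMP/(_ i 0) := h _ (latM_col j hb); rewrite !mxE.
Qed.

Lemma latM_scaledP n m (b : 'M[B]_(n, m)) (phi : 'M[B]_(m, n)) (c c' : B) :
  c * c' = 1 -> adm iota b phi ->
  latM iota phi = (fun u => c *: u) @` [set x | intM iota x] <->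
  intM iota (c *: phi) /\ intM iota (c' *: b).
Proof.
move=> cc hb; have cc' : c' * c = 1 by rewrite mulrC.
split=> [e|[h1 h2]].
  split.
    by apply: latM_sup => x hx; rewrite e; exists x.
  apply: (latM_sub hb) => x; rewrite e => -[u hu <-].
  by rewrite scalerA cc' scale1r.
apply/seteqP; split=> x.
  move=> /(latM_gen x hb)[a ->]; exists (c' *: (b *m map_mx iota a)).
    by rewrite /= scalemxAl; apply: intMM h2 _; exact: intM_map.
  by rewrite scalerA cc scale1r.
by move=> [u hu <-]; rewrite /latM -scalemxAr scalemxAl; exact: intMM.
Qed.

Lemma mbasis_coord_sub n m (P : pred 'I_m) (b : 'I_m -> 'cV[B]_n) E E' :
  mbasis iota b E -> (forall s : 'I_m -> B, (forall i, s i = if P i then ldv d else 1) ->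
    mbasis iota (fun i => s i *: b i) E') -> E `<=` E'.
Proof.
move=> [bE _] h; have {h} [bE' _] := h _ (fun=> erefl).
move=> _ /bE[c ->]; apply/bE'; exists (fun i => (if P i then ldw d else 1) * c i).
rewrite /lincomb; apply: eq_bigr => i _; rewrite scalerA rmorphM; congr (_ *: _).
by case: (P i); rewrite ?mulr1 ?rmorph1 ?mul1r // mulrAC ldwv mul1r.
Qed.
End LatticeBounds.

(** * Points of minuscule position as idempotent matrices *)

Section FlagPoints.
Variables (D : base_data) (n : nat).
Local Notation lat R := (latU (d := ldat R)).

(** The subbundle is carried by a projector onto it, so that restriction acts on matrix entries and
    inclusions become equations between matrices. *)
Record flagpt (R : palg D) s c (e : 'M[R]_n) (x : ps_pt (Pt D n) R) : Prop := FlagPt {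
  fp_idem : e *m e = e;
  fp_rank : const_rank e s;
  fp_lat : x.1 = lat R (colspan e);
  fp_scale : x.2 = scaled_std R c }.

Lemma scaled_stdE (R : palg D) c :
  scaled_std R c = (fun u => piz R c *: u) @` [set x | intM (AtoB R) x].
Proof. by rewrite /scaled_std std_latticeE. Qed.

Lemma adm_scaled (R : palg D) c m :
  adm (AtoB R) ((piz R c)%:M : 'M_m) (piz R (- c))%:M.
Proof.
split; first by rewrite -scalar_mxM piz_opp.
by rewrite -scalar_mxM mulrC piz_opp; exact: intM1.
Qed.

Lemma scaled_std_latM (R : palg D) c : scaled_std R c = latM (AtoB R) (piz R (- c))%:M.
Proof.
rewrite scaled_stdE; apply/esym/(latM_scaledP (d := ldat R) (piz_opp R c) (adm_scaled R c 1)).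
by rewrite !scale_scalar_mx piz_opp [piz R (- c) * _]mulrC piz_opp; split; exact: intM1.
Qed.

Lemma base_change_scaled (R R' : palg D) (f : {rmorphism R -> R'})
    (fk : forall c, f (pa_k R c) = pa_k R' c) c :
  base_change (Bmap fk) (scaled_std R c) = scaled_std R' c.
Proof.
rewrite scaled_std_latM (base_change_adm fk (adm_scaled R c 1)) scaled_std_latM.
by congr latM; rewrite map_scalar_mx; congr (_%:M); exact: Bmap_piz.
Qed.

Lemma scaled_std0 (R : palg D) : scaled_std R 0 = std_lattice R 1.
Proof.
apply/seteqP; split=> x; first by move=> [u hu <-]; rewrite piz0 scale1r.
by move=> hx; exists x => //; rewrite piz0 scale1r.
Qed.

Lemma ps_res_std (R R' : palg D) (f : palg_hom R R') :
  ps_res f (std n R : ps_pt (Pt D n) R) = std n R'.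
Proof. by congr (_, _); exact: base_change_std. Qed.

Lemma const_rank_map (R R' : palg D) (f : palg_hom R R') m q (M : 'M[R]_(m, q)) s :
  const_rank M s -> const_rank (map_mx f M) s.
Proof.
move=> h K g Kf; have := h K (hom_comp g f) Kf.
by congr (hasdim (colspan _) _); apply/matrixP => i j; rewrite !mxE.
Qed.

Lemma flagpt_res (R R' : palg D) (f : palg_hom R R') s c e x :
  flagpt s c e x -> flagpt s c (map_mx f e) (ps_res f x).
Proof.
move=> [ee er e1 e2]; split.
- by rewrite -map_mxM ee.
- exact: const_rank_map.
- by rewrite /= e1; exact: base_change_latU.
- by rewrite /= e2; exact: base_change_scaled.
Qed.

Lemma flagpt_Gr (R : palg D) s c e (x : ps_pt (Pt D n) R) : flagpt s c e x -> Gr x.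
Proof.
move=> [ee er e1 e2]; split.
  have [te he] := @rdM_surj (ldat R) _ _ e.
  rewrite e1 -(latU_idem (d := ldat R) ee he).
  exact: (lattice_latM (idem_adm (d := ldat R) ee he)).
by rewrite e2 scaled_std_latM; exact: (lattice_latM (adm_scaled R c 1)).
Qed.

Lemma flagpt_field (K : palg D) s c e (x : ps_pt (Pt D n) K) : is_field K ->
  flagpt s c e x -> hasdim (colspan e) s.
Proof.
move=> Kf [_ er _ _]; have := er K (hom_id K) Kf.
by congr (hasdim (colspan _) _); apply/matrixP => i j; rewrite mxE.
Qed.

Lemma flagpt_exact (R : palg D) s c e (x : ps_pt (Pt D n) R) : flagpt s c e x ->
  exact (mlast n s c) x (std n R).
Proof.
move=> h K f Kf; rewrite ps_res_std; have hK := flagpt_res f h.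
apply/rel_pos_mlast; split; first exact: fp_scale hK.
have hd := flagpt_field Kf hK.
have [g [g' [gg hg _]]] := fieldlike_flag Kf hd hd (@subset_refl _ _).
by exists g, g'; rewrite (fp_lat hK) hg.
Qed.

(** The position is known only at perfect fields. There [phi] and [varpi b] are integral, hence they
    are integral over [R], which places the lattice between the standard one and its multiple by the
    inverse uniformizer. The corresponding span has constant rank, hence is the image of a
    projector. *)
Lemma exact_flagpt (R : palg D) s c (x : ps_pt (Pt D n) R) : (s <= n)%N -> Gr x ->
  exact (mlast n s c) x (std n R) -> exists e, flagpt s c e x.
Proof.
move=> sn [/latticeP[m [b [phi [hb x1]]]] /latticeP[m2 [b2 [phi2 [hb2 x2]]]]] hx.
have hK (K : palg D) (f : palg_hom R K) : is_field K ->
    (latM (AtoB K) (map_mx (resB f) phi2) = scaled_std K c) /\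
    exists g h : 'M[K]_n, g *m h = 1%:M /\
      latM (AtoB K) (map_mx (resB f) phi) = lat K (coordspan g (lastp n s)).
  move=> Kf; have := hx K f Kf; rewrite ps_res_std => /rel_pos_mlast.
  by rewrite /= x1 x2 (base_change_adm _ hb) (base_change_adm _ hb2).
have admK (K : palg D) (f : palg_hom R K) :
    adm (AtoB K) (map_mx (resB f) b) (map_mx (resB f) phi).
  exact: (adm_bmap (BmapA (palg_hom_k f)) hb).
have admK2 (K : palg D) (f : palg_hom R K) :
    adm (AtoB K) (map_mx (resB f) b2) (map_mx (resB f) phi2).
  exact: (adm_bmap (BmapA (palg_hom_k f)) hb2).
have pizE (K : palg D) (f : palg_hom R K) c0 m' n' (M : 'M_(m', n')) :
    map_mx (resB f) (piz R c0 *: M) = piz K c0 *: map_mx (resB f) M.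
  by rewrite map_mxZ (_ : resB f (piz R c0) = piz K c0) //; exact: (Bmap_piz (palg_hom_k f) c0).
have hx2 : x.2 = scaled_std R c.
  rewrite x2 scaled_stdE.
  apply/(latM_scaledP (d := ldat R) (piz_opp R c) hb2); split.
    apply: intM_descent => K f Kf; rewrite pizE.
    have [h2 _] := hK K f Kf; move: h2; rewrite scaled_stdE.
    by move=> /(latM_scaledP (d := ldat K) (piz_opp K c) (admK2 K f))[].
  apply: intM_descent => K f Kf; rewrite pizE.
  have [h2 _] := hK K f Kf; move: h2; rewrite scaled_stdE.
  by move=> /(latM_scaledP (d := ldat K) (piz_opp K c) (admK2 K f))[].
have hphiK (K : palg D) (f : palg_hom R K) : is_field K ->
    intM (AtoB K) (map_mx (resB f) phi).
  move=> Kf; have [_ [g [h [_ e]]]] := hK K f Kf.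
  rewrite -[map_mx _ _]scale1r; apply: (@latM_sup (ldat K)) => u hu; rewrite scale1r e.
  apply: latU_std => //; exists 0 => [i _|]; first by rewrite mxE.
  by rewrite mulmx0.
have hphi : intM (AtoB R) phi by apply: intM_descent; exact: hphiK.
have [N hN] : intM (AtoB R) (AtoB R (varpi R) *: b).
  apply: intM_descent => K f Kf; rewrite (pizE K f 1).
  apply: (latM_sub (d := ldat K) (admK K f)) => u.
  have [_ [g [h [_ e]]]] := hK K f Kf.
  by rewrite e => -[a [ha _]]; exists a.
have x1U := latM_latU (d := ldat R) hb hphi hN.
have rN : const_rank (map_mx (rd R) N) s.
  move=> K f Kf; have [_ [g [h [gh e]]]] := hK K f Kf.
  have hNK : AtoB K (varpi K) *: map_mx (resB f) b =
      map_mx (AtoB K) (map_mx (WOmap (palg_hom_k f)) N).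
    by rewrite -(pizE K f 1) [piz R 1 *: b]hN; exact: (map_iota (BmapA (palg_hom_k f))).
  have := latM_latU (d := ldat K) (admK K f) (hphiK K f Kf) hNK.
  rewrite e => /(congr1 (latbar (d := ldat K) (n := n))); rewrite !latUK => e'.
  have -> : map_mx f (map_mx (rd R) N) = map_mx (rd K) (map_mx (WOmap (palg_hom_k f)) N).
    by apply/matrixP => i j; rewrite !mxE rd_map.
  by rewrite -e'; exact: hasdim_lastp gh sn.
have [e [G [ee eN eG]]] := constant_rank_idem rN.
exists e; split=> //; last by rewrite x1 x1U (colspan_factor eN eG).
move=> K f Kf; rewrite (colspan_factor (M := map_mx f (map_mx (rd R) N)) (G := map_mx f G)).
- exact: rN.
- by rewrite -map_mxM eN.
- by rewrite -map_mxM -eG.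
Qed.

Lemma bounded_exact (R : palg D) s c (x x0 : ps_pt (Pt D n) R) : (0 < n)%N -> (s <= n)%N ->
  bounded (mlast n s c) x x0 <-> exact (mlast n s c) x x0.
Proof.
move=> n0 sn; split=> h K f Kf.
  by have [l' [dl cl rl]] := h K f Kf; rewrite -(minuscule_le n0 sn dl cl).
exists (mlast n s c); split; [exact: dominant_mlast|exact: coch_le_refl|exact: h].
Qed.

Lemma Gr_eq_flagpt (R : palg D) s c (x : ps_pt (Pt D n) R) : (s <= n)%N ->
  Gr_eq (mlast n s c) x <-> exists e, flagpt s c e x.
Proof.
move=> sn; split=> [[hx ex]|[e he]]; first exact: exact_flagpt ex.
by split; [exact: flagpt_Gr he|exact: flagpt_exact he].
Qed.

Lemma Gr_le_flagpt (R : palg D) s c (x : ps_pt (Pt D n) R) : (0 < n)%N -> (s <= n)%N ->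
  Gr_le (mlast n s c) x <-> exists e, flagpt s c e x.
Proof.
move=> n0 sn; rewrite -Gr_eq_flagpt //; split=> -[hx ex]; split=> //; exact/bounded_exact.
Qed.

(** Inclusion of subbundles can be tested at fields, where the position exhibits the first lattice
    inside the second. Conversely, a basis adapted to the flag moves the first lattice to the
    standard one and the second to the lattice of a coordinate subspace of dimension [t]. *)
Lemma exact_flag_pair (R : palg D) s1 s2 t c e1 e2 (x1 x2 : ps_pt (Pt D n) R) :
  (s1 + t = s2)%N -> (s2 <= n)%N -> flagpt s1 0 e1 x1 -> flagpt s2 c e2 x2 ->
  exact (mlast n t c) x2 x1 <-> e2 *m e1 = e1.
Proof.
move=> st s2n h1 h2; split=> h.
  apply: mx_descent => K f Kf; rewrite map_mxM.
  have hK1 := flagpt_res f h1; have hK2 := flagpt_res f h2.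
  have [b [b0 [hb hb' _ _]]] := h K f Kf.
  have : lat K (colspan (map_mx f e1)) `<=` lat K (colspan (map_mx f e2)).
    rewrite -(fp_lat hK1) -(fp_lat hK2).
    apply: (mbasis_coord_sub (d := ldat K) (P := lastp n t) hb) => sc hsc.
    have -> // : (fun i => sc i *: b i) = (fun i => piz K ((mlast n t c).2 0 i) *: b i).
    by apply/funext => i; rewrite piz_mlast hsc.
  move=> /latU_sub sub; apply: mx_fixed_colspan => u.
  by apply/(colspan_idem _ (fp_idem hK2))/sub; eexists.
move=> K f Kf; have hK1 := flagpt_res f h1; have hK2 := flagpt_res f h2.
have sub : colspan (map_mx f e1) `<=` colspan (map_mx f e2).
  by move=> _ [u ->]; exists (map_mx f e1 *m u); rewrite mulmxA -map_mxM h.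
have [g [g' [gg hg1 hg2]]] :=
  fieldlike_flag Kf (flagpt_field Kf hK1) (flagpt_field Kf hK2) sub.
have [G hG] := @rdM_surj (ldat K) _ _ g.
have [|H GH] := @invertible_lift (ldat K) _ G g'; first by rewrite hG.
have sP : {subset lastp n s1 <= lastp n s2}.
  by move=> i; rewrite /lastp !unfold_in /=; lia.
have [a [a' [aa ha1 ha2]]] := latU_coordspan_mul (d := ldat K) GH sP.
set Q := [pred i | _] in ha2.
have one : (1%:M : 'M[K]_n) *m 1%:M = 1%:M by rewrite mulmx1.
have dQ : hasdim (coordspan (1%:M : 'M[K]_n) Q) t.
  apply: (hasdim_coordspan (a := n - s2) one) => [|i]; first by lia.
  by rewrite /Q /lastp /=; have := ltn_ord i; lia.
(* The indices in [Q] form a middle interval, whereas [rel_pos_mlast] expects final ones; a second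
   basis moves them to the end. *)
have [p [p' [pp hp _]]] := fieldlike_flag Kf dQ dQ (@subset_refl _ _).
have rp : rel_pos (mlast n t c) ((lat K (coordspan 1%:M Q), scaled_std K c) : ps_pt (Pt D n) K)
    (std n K).
  by apply/rel_pos_mlast; split=> //; exists p, p'; rewrite -hp.
have := rel_pos_act (mulmx1C aa) (mulr1 1) rp.
have id1 (S : set 'cV[Bring K]_1) : (fun v => 1 *: v) @` S = S.
  by apply/seteqP; split=> [v [u hu <-]|v hv]; [rewrite scale1r|exists v; rewrite ?scale1r].
have -> : grp_act a 1 (std n K : ps_pt (Pt D n) K) = ps_res f x1.
  rewrite /grp_act id1 [RHS]surjective_pairing (fp_lat hK1) (fp_scale hK1) scaled_std0.
  by congr (_, _); rewrite hg1 -hG ha1 /= std_latticeE.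
have -> // : grp_act a 1 ((lat K (coordspan 1%:M Q), scaled_std K c) : ps_pt (Pt D n) K)
    = ps_res f x2.
rewrite /grp_act id1 [RHS]surjective_pairing (fp_lat hK2) (fp_scale hK2).
by congr (_, _); rewrite hg2 -hG ha2.
Qed.
End FlagPoints.

(** * Frobenius and duality *)

Lemma hasdim_map (S : comPzRingType) (fS : fieldlike S) (phi : {rmorphism S -> S}) n m
    (M : 'M[S]_(n, m)) s : hasdim (colspan M) s -> hasdim (colspan (map_mx phi M)) s.
Proof.
have [F e] := field_structure fS; subst S.
by move=> /hasdim_rank h; apply/hasdim_rank; rewrite mxrank_map.
Qed.

Lemma colspan_eq_factor (S : comPzRingType) n m (e : 'M[S]_n) (M : 'M[S]_(n, m)) :
  e *m e = e -> colspan e = colspan M -> e *m M = M /\ exists G, e = M *m G.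
Proof.
move=> ee eM; split.
  by apply: mx_fixed_colspan => c; apply/(colspan_idem _ ee); rewrite eM; eexists.
have /choice[G hG] (j : 'I_n) : exists c, col j e = M *m c.
  have : colspan e (col j e) by exists (delta_mx j 0); rewrite colE.
  by rewrite eM.
exists (\matrix_(i, j) G j i 0); apply/matrixP => i j.
have /matrixP/(_ i 0) := hG j; rewrite !mxE => ->.
by apply: eq_bigr => l _; rewrite mxE.
Qed.

Lemma map_perp_idem (R S : comPzRingType) (f : {rmorphism R -> S}) n (e : 'M[R]_n) :
  map_mx f (perp_idem e) = perp_idem (map_mx f e).
Proof.
by rewrite /perp_idem !map_mxM map_antidiag map_mxB map_mx1 map_trmx.
Qed.

Lemma perp_idem_fix (R : comPzRingType) n (e1 e : 'M[R]_n) : e1 *m e1 = e1 ->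
  perp_idem e1 *m e = e <-> e^T *m antidiag n R *m e1 = 0.
Proof.
move=> ee; split=> h.
  apply/matrixP => i j.
  have : (col i e)^T *m antidiag n R *m (e1 *m (delta_mx j 0 : 'cV_n)) = 0.
    apply: (perp_idemP _ ee).1; last by eexists.
    by apply/(colspan_idem _ (perp_idemK ee)); rewrite colE mulmxA h.
  rewrite tr_col -row_mul mulmxA -row_mul -colE => /matrixP/(_ 0 0).
  by rewrite [LHS]mxE [LHS]mxE [RHS]mxE => ->; rewrite mxE.
apply: mx_fixed_colspan => c; apply/(colspan_idem _ (perp_idemK ee))/(perp_idemP _ ee).
move=> _ [z ->]; rewrite trmx_mul -!mulmxA (mulmxA (antidiag n R)) (mulmxA e^T).
by rewrite (mulmxA e^T) h mul0mx mulmx0.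
Qed.

Section KernelImage.
Variable d : lift_data.

(** If [Phi a = w c], then [a = b Phi a = w b c = P c]; conversely [Phi P] is [w] times the integral
    matrix [phi b]. The subspace is thus both an image and a kernel, as [hasdim_of_minors]
    requires. *)
Lemma lattice_exact n m (b : 'M[ldB d]_(n, m)) phi (Phi : 'M[ldA d]_(m, n)) P :
  adm (ldin d) b phi -> phi = map_mx (ldin d) Phi ->
  ldin d (ldw d) *: b = map_mx (ldin d) P ->
  forall u : 'cV_n, map_mx (ldrd d) Phi *m u = 0 <-> colspan (map_mx (ldrd d) P) u.
Proof.
move=> [b1 [E hE]] hphi hb u; split.
  have [a <-] := rdM_surj u.
  rewrite -map_mxM => /rdM_ker[c hc].
  have : map_mx (ldin d) a = map_mx (ldin d) (P *m c).
    rewrite map_mxM -hb -scalemxAl scalemxAr -map_mxZ -hc map_mxM -hphi mulmxA b1 mul1mx //.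
  by move=> /map_iota_inj ->; rewrite map_mxM; eexists.
move=> [c ->]; rewrite mulmxA -map_mxM.
have -> : Phi *m P = ldw d *: E.
  apply: map_iota_inj; rewrite map_mxM -hphi -hb map_mxZ -hE.
  by rewrite -scalemxAr.
have -> : map_mx (ldrd d) (ldw d *: E) = 0 by apply/rdM_ker; eexists.
by rewrite mul0mx.
Qed.
End KernelImage.

Lemma image_scale_preim (S : comPzRingType) n (c c' : S) (E : set 'cV[S]_n) : c * c' = 1 ->
  (fun v => c *: v) @` [set y | E (c *: y)] = E.
Proof.
move=> cc; apply/seteqP; split=> u; first by move=> [v hv <-].
by move=> hu; exists (c' *: u); rewrite /= scalerA cc scale1r.
Qed.

Section Frobenius.
Variables (D : base_data) (n : nat).
Local Notation lat R := (latU (d := ldat R)).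
Local Notation frob R := (frobq (pa_k R)).

Definition frob_perp (R : palg D) (e : 'M[R]_n) : 'M[R]_n := map_mx (frob R) (perp_idem e).

Lemma frob_idem (R : palg D) (e : 'M[R]_n) : e *m e = e ->
  map_mx (frob R) e *m map_mx (frob R) e = map_mx (frob R) e.
Proof. by move=> ee; rewrite -map_mxM ee. Qed.

Lemma frob_perpE (R : palg D) (e : 'M[R]_n) : frob_perp e = perp_idem (map_mx (frob R) e).
Proof. exact: map_perp_idem. Qed.

Lemma frob_perpK (R : palg D) (e : 'M[R]_n) : e *m e = e ->
  frob_perp e *m frob_perp e = frob_perp e.
Proof. by move=> ee; rewrite frob_perpE; apply: perp_idemK; exact: frob_idem. Qed.

Lemma frob_map (R R' : palg D) (f : palg_hom R R') m q (M : 'M[R]_(m, q)) :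
  map_mx f (map_mx (frob R) M) = map_mx (frob R') (map_mx f M).
Proof. by apply/matrixP => i j; rewrite !mxE /frobq rmorphXn. Qed.

Lemma frob_perp_map (R R' : palg D) (f : palg_hom R R') (e : 'M[R]_n) :
  map_mx f (frob_perp e) = frob_perp (map_mx f e).
Proof. by rewrite /frob_perp frob_map map_perp_idem. Qed.

(** The kernel of [1 - e^T] is the image of [e^T], of dimension [s]; multiplication by the
    antidiagonal matrix and Frobenius preserve rank. *)
Lemma frob_perp_rank (R : palg D) (e : 'M[R]_n) s : (s <= n)%N -> e *m e = e ->
  const_rank e s -> const_rank (frob_perp e) (n - s).
Proof.
move=> sn ee er K f Kf; rewrite frob_perp_map; apply: (hasdim_map Kf).
have := er K f Kf; set eK := map_mx f e => hd.
have eeK : eK *m eK = eK by rewrite -map_mxM ee.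
rewrite /perp_idem; apply: hasdim_unitr (antidiagK _ _) _.
apply: (hasdim_unitl Kf (antidiagK _ _)).
apply: (hasdim_exact Kf (M := eK^T) (subnKC sn)); last exact: hasdim_trmx.
move=> u; rewrite colspan_idem -?trmx_mul ?eeK // mulmxBl mul1mx.
by split=> [/eqP|->]; rewrite ?subrr // subr_eq0 => /eqP.
Qed.

Lemma hdual_latU (R : palg D) (e : 'M[R]_n) : e *m e = e ->
  hdual (lat R (colspan e)) (std_lattice R 1) =
  [set y | lat R (colspan (perp_idem e)) (piz R (-1) *: y)].
Proof.
move=> ee; apply: etrans (herm_dual_latU (d := ldat R) ee).
by rewrite /hdual std_latticeE.
Qed.

Lemma F_dual_latU (R : palg D) (e : 'M[R]_n) : e *m e = e ->
  F_dual (lat R (colspan e)) =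
  [set y | lat R (colspan (frob_perp e)) (piz R (-1) *: y)].
Proof.
move=> ee; rewrite /F_dual hdual_latU //.
exact: (latU_scaled_change (d := ldat R) (d' := ldat R) (BmapA (frobq_over (pa_k R)))
  (rd_map (frobq_over (pa_k R))) (WOmap_varpi (frobq_over (pa_k R))) (perp_idemK ee)).
Qed.

Lemma sigma_std (R : palg D) m : base_change (sigmaB R) (std_lattice R m) = std_lattice R m.
Proof. exact: (base_change_std (frobq_over (pa_k R))). Qed.

Lemma tau_scale (R : palg D) :
  (fun v : 'cV[Bring R]_n => \col_i (piz R ((star (tau n)).2 0 i) * v i 0)) =
  (fun v => piz R (-1) *: v).
Proof.
apply: functional_extensionality_dep => v; apply/matrixP => i j.
have e : (star (tau n)).2 0 i = -1 by rewrite star_tau mxE.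
by rewrite [in LHS]mxE e (ord1 j) mxE.
Qed.

Definition frob_tau (R : palg D) (x : ps_pt (Pt D n) R) : ps_pt (Pt D n) R :=
  cochar_act (star (tau n)) (frobPt x).

(** The dual lattice is the uniformizer times the lattice of the orthogonal, and the central
    cocharacter [star (tau n)] removes exactly this factor while shifting the similitude to -1. *)
Lemma frob_tau_flagpt (R : palg D) s e (x : ps_pt (Pt D n) R) : (s <= n)%N ->
  flagpt s 0 e x -> flagpt (n - s) (-1) (frob_perp e) (frob_tau x).
Proof.
move=> sn [ee er e1 e2]; split.
- exact: frob_perpK.
- exact: frob_perp_rank.
- rewrite /frob_tau /cochar_act /frobPt e1 e2 scaled_std0.
  rewrite -[base_change _ _]/(F_dual (lat R (colspan e))) F_dual_latU //.
  rewrite tau_scale.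
  rewrite -[LHS]/((fun v => piz R (-1) *: v) @`
    [set y | lat R (colspan (frob_perp e)) (piz R (-1) *: y)]).
  have cc : piz R (-1) * piz R 1 = 1 by rewrite mulrC piz1K.
  by rewrite (image_scale_preim _ cc).
- rewrite -[LHS]/((fun v => piz R (star (tau n)).1 *: v) @` base_change (sigmaB R) x.2).
  have e3 : (star (tau n)).1 = -1 by rewrite star_tau.
  rewrite e2 scaled_std0 sigma_std e3 /scaled_std; reflexivity.
Qed.

Lemma F_perp_colspan (R : palg D) (e : 'M[R]_n) : e *m e = e ->
  F_perp (colspan e) = colspan (frob_perp e).
Proof.
move=> ee; rewrite /F_perp /frob_perp -colspan_map.
have -> // : [set y : 'cV[R]_n | forall x, colspan e x -> y^T *m antidiag n R *m x = 0] =
  colspan (perp_idem e).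
by apply/seteqP; split=> u /(perp_idemP _ ee).
Qed.

Definition isotropic_pt s (R : palg D) (x : ps_pt (Pt D n) R) :=
  exists e, flagpt s 0 e x /\ frob_perp e *m e = e.

Lemma frob_perp_sub (R : palg D) (e : 'M[R]_n) : e *m e = e ->
  frob_perp e *m e = e <-> colspan e `<=` colspan (frob_perp e).
Proof.
move=> ee; split=> [h _ [c ->]|h].
  by apply/(colspan_idem _ (frob_perpK ee)); rewrite mulmxA h.
by apply: mx_fixed_colspan => c; apply/(colspan_idem _ (frob_perpK ee))/h; eexists.
Qed.

(** The uniformizer in the inclusion cancels the one that separates [F_dual] from the lattice of
    [F(U^perp)]. *)
Lemma isotropic_ptE s (R : palg D) (x : ps_pt (Pt D n) R) : (0 < n)%N -> (s <= n)%N ->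
  isotropic_pt s x <->
  Gr_le (mlast n s 0) x /\ forall v, x.1 v -> F_dual x.1 (piz R 1 *: v).
Proof.
move=> n0 sn.
have FE e v : e *m e = e ->
    F_dual (lat R (colspan e)) (piz R 1 *: v) <-> lat R (colspan (frob_perp e)) v.
  by move=> ee; rewrite F_dual_latU //= scalerA mulrC piz1K scale1r.
split=> [[e [he fe]]|[/(Gr_le_flagpt _ _ n0 sn)[e he] hF]].
  split; first by apply/Gr_le_flagpt => //; exists e.
  rewrite (fp_lat he) => v hv; apply/FE; first exact: fp_idem he.
  have sub : lat R (colspan e) `<=` lat R (colspan (frob_perp e)).
    by apply/(@latU_sub (ldat R))/(frob_perp_sub (fp_idem he)).
  exact: sub.
exists e; split=> //; apply/(frob_perp_sub (fp_idem he))/(@latU_sub (ldat R)) => v hv.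
by apply/(FE _ _ (fp_idem he)); move: hF; rewrite (fp_lat he); apply.
Qed.
End Frobenius.

(** * The isotropic locus is closed *)

Lemma image_mulK (S : comPzRingType) n (g h : 'M[S]_n) (E : set 'cV[S]_n) : h *m g = 1%:M ->
  (mulmx h) @` ((mulmx g) @` E) = E.
Proof.
move=> hg; apply/seteqP; split=> u.
  by move=> [_ [v hv <-] <-]; rewrite mulmxA hg mul1mx.
by move=> hu; exists (g *m u); [exists u|rewrite mulmxA hg mul1mx].
Qed.

Lemma image_scale1 (S : comPzRingType) n (E : set 'cV[S]_n) : (fun v => 1 *: v) @` E = E.
Proof. by apply/seteqP; split=> [v [u hu <-]|v hv]; [rewrite scale1r|exists v; rewrite ?scale1r]. Qed.

Section Isotropic.
Variables (D : base_data) (n : nat).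
Local Notation lat R := (latU (d := ldat R)).
Local Notation frob R := (frobq (pa_k R)).

Lemma resB_varpi (R R' : palg D) (f : palg_hom R R') :
  resB f (AtoB R (varpi R)) = AtoB R' (varpi R').
Proof. exact: (Bmap_piz (palg_hom_k f) 1). Qed.

Lemma map_resB_varpi (R R' : palg D) (f : palg_hom R R') p q (M : 'M[Bring R]_(p, q)) :
  map_mx (resB f) (AtoB R (varpi R) *: M) = AtoB R' (varpi R') *: map_mx (resB f) M.
Proof. by rewrite map_mxZ resB_varpi. Qed.

Lemma isotropic_res s (R R' : palg D) (f : palg_hom R R') (x : ps_pt (Pt D n) R) :
  isotropic_pt s x -> isotropic_pt s (ps_res f x).
Proof.
move=> [e [he fe]]; exists (map_mx f e); split; first exact: flagpt_res.
by rewrite -frob_perp_map -map_mxM fe.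
Qed.

Lemma coord_flagpt (R : palg D) t a c (Q : pred 'I_n) : (a + t <= n)%N ->
  (forall i : 'I_n, Q i = (a <= i < a + t)%N) ->
  flagpt t c (coord_idem 1%:M 1%:M Q)
    ((lat R (coordspan 1%:M Q), scaled_std R c) : ps_pt (Pt D n) R).
Proof.
move=> le hQ; have one (S : comPzRingType) : (1%:M : 'M[S]_n) *m 1%:M = 1%:M.
  by rewrite mulmx1.
have [ee eQ] := coord_idemE Q (one R).
split=> //; last by rewrite /= eQ.
move=> K f Kf.
have -> : map_mx f (coord_idem 1%:M 1%:M Q) = coord_idem 1%:M 1%:M Q.
  rewrite /coord_idem !map_mxM !map_mx1 map_diag_mx; congr (_ *m diag_mx _ *m _).
  by apply/rowP => i; rewrite !mxE rmorph_nat.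
have [_ <-] := coord_idemE Q (one K).
exact: hasdim_coordspan (one K) le hQ.
Qed.

(** At a field, the basis adapted to the inclusion of [U] in [F(U^perp)] provides the representative
    [g]. Translated by its inverse, the twisted point is the lattice of a coordinate plane, the
    dimension being [(n - s) - s = 2]; so it lies already in the open orbit. *)
Lemma isotropic_X_mu_tau s (R : palg D) (x : ps_pt (Pt D n) R) : (s + s + 2 = n)%N ->
  isotropic_pt s x -> X_mu_tau x.
Proof.
move=> sn hx; split; first by have [e [he _]] := hx; exact: flagpt_Gr he.
move=> K f Kf; have [e [he fe]] := isotropic_res f hx.
have sln : (s <= n)%N by lia.
have ht := frob_tau_flagpt sln he.
have [g [g' [gg hg1 hg2]]] := fieldlike_flag Kf (flagpt_field Kf he)
  (flagpt_field Kf ht) ((frob_perp_sub (fp_idem he)).1 fe).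
have [G hG] := @rdM_surj (ldat K) _ _ g.
have [|H GH] := @invertible_lift (ldat K) _ G g'; first by rewrite hG.
have sP : {subset lastp n s <= lastp n (n - s)}.
  by move=> i; rewrite /lastp !unfold_in /=; lia.
have [a [a' [aa ha1 ha2]]] := latU_coordspan_mul (d := ldat K) GH sP.
set Q := [pred i | _] in ha2.
exists a, a', 1, 1; split=> //; first exact: mulmx1C.
- by rewrite mulr1.
- rewrite [LHS]surjective_pairing (fp_lat he) (fp_scale he) scaled_std0 /grp_act image_scale1.
  by congr (_, _); rewrite hg1 -hG ha1 -std_latticeE.
have -> : grp_act a' 1 (cochar_act (star (tau n)) (frobPt (ps_res f x))) =
    (lat K (coordspan 1%:M Q), scaled_std K (-1)).
  rewrite -/(frob_tau (ps_res f x)) [frob_tau _]surjective_pairing (fp_lat ht) (fp_scale ht).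
  rewrite /grp_act image_scale1; congr (_, _).
  by rewrite [colspan _]hg2 -hG ha2; exact: image_mulK (mulmx1C aa).
have hQ : flagpt 2 (-1) (coord_idem 1%:M 1%:M Q)
    ((lat K (coordspan 1%:M Q), scaled_std K (-1)) : ps_pt (Pt D n) K).
  apply: (@coord_flagpt K 2 s (-1) Q) => [|i]; first by lia.
  by rewrite /Q /lastp /=; have := ltn_ord i; lia.
split; first exact: flagpt_Gr hQ.
move=> Z _; apply; rewrite star_mu; last by lia.
by apply/Gr_eq_flagpt; [lia|eexists; exact: hQ].
Qed.

(** The sets [I1] and [I2] confine the lattice between the standard one and its multiple by the
    inverse uniformizer; [I3] and [I4] make the similitude part standard. The minors of [psi] and
    [rho] together fix the rank, and the matrix product expresses isotropy. *)
Lemma isotropic_closed s t (X : subfunctor (Pt D n)) : (s + t = n)%N -> (0 < n)%N ->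
  subfun X (Gr (D := D) (n := n)) -> subfun (@isotropic_pt D n s) X ->
  closed_in X (@isotropic_pt D n s).
Proof.
move=> st n0 XGr YX; split=> // R x /XGr[/latticeP[m [b [phi [hb x1]]]]
  /latticeP[m2 [b2 [phi2 [hb2 x2]]]]].
have [I1 [Phi hPhi]] := polar_partM phi.
have [I2 [P hP]] := polar_partM (AtoB R (varpi R) *: b).
have [I3 [N3 hI3]] := polar_partM phi2.
have [I4 [N4 hI4]] := polar_partM b2.
(* Where the polar parts vanish, the columns of [psi] span the subspace and [rho] has it as kernel;
   elsewhere these matrices need have no such meaning, and the point is excluded by [I1] or [I2]. *)
pose psi := map_mx (rd R) P; pose rho := map_mx (rd R) Phi.
exists (fun r => [\/ I1 r, I2 r, I3 r | I4 r] \/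
  [\/ exists (g1 : 'I_s.+1 -> 'I_n) (g2 : 'I_s.+1 -> 'I_m), r = \det (mxsub g1 g2 psi),
      exists (g1 : 'I_t.+1 -> 'I_m) (g2 : 'I_t.+1 -> 'I_n), r = \det (mxsub g1 g2 rho) |
      exists i j, r = (psi^T *m antidiag n R *m map_mx (frob R) psi) i j]) => R' f.
have [p1 p1'] := hPhi R' f; have [p2 p2'] := hP R' f.
have [p3 _] := hI3 R' f; have [p4 _] := hI4 R' f.
rewrite map_resB_varpi in p2 p2'.
have admf := adm_bmap (BmapA (palg_hom_k f)) hb.
have admf2 := adm_bmap (BmapA (palg_hom_k f)) hb2.
have xf1 : (ps_res f x).1 = latM (AtoB R') (map_mx (resB f) phi).
  rewrite -[LHS]/(base_change (resB f) x.1) x1.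
  exact: (base_change_adm (palg_hom_k f) hb).
have xf2 : (ps_res f x).2 = latM (AtoB R') (map_mx (resB f) phi2).
  rewrite -[LHS]/(base_change (resB f) x.2) x2.
  exact: (base_change_adm (palg_hom_k f) hb2).
pose psi' := map_mx f psi; pose rho' := map_mx f rho.
have psiE : map_mx (rd R') (map_mx (WOmap (palg_hom_k f)) P) = psi'.
  by apply/matrixP => i j; rewrite !mxE rd_map.
have rhoE : map_mx (rd R') (map_mx (WOmap (palg_hom_k f)) Phi) = rho'.
  by apply/matrixP => i j; rewrite !mxE rd_map.
have stdP : (ps_res f x).2 = scaled_std R' 0 <->
    intM (AtoB R') (map_mx (resB f) phi2) /\ intM (AtoB R') (map_mx (resB f) b2).
  rewrite xf2 scaled_stdE piz0.
  have := latM_scaledP (d := ldat R') (mulr1 1) admf2.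
  by rewrite !scale1r.
have exactK (K : palg D) (h : palg_hom R' K) : intM (AtoB R') (map_mx (resB f) phi) ->
    intM (AtoB R') (AtoB R' (varpi R') *: map_mx (resB f) b) ->
    forall u : 'cV_n, map_mx h rho' *m u = 0 <-> colspan (map_mx h psi') u.
  move=> /p1' e1 /p2' e2.
  have admK := adm_bmap (BmapA (palg_hom_k h)) admf.
  have := lattice_exact (d := ldat K) admK
    (Phi := map_mx (WOmap (palg_hom_k h)) (map_mx (WOmap (palg_hom_k f)) Phi))
    (P := map_mx (WOmap (palg_hom_k h)) (map_mx (WOmap (palg_hom_k f)) P)).
  have -> : map_mx (rd K) (map_mx (WOmap (palg_hom_k h)) (map_mx (WOmap (palg_hom_k f)) Phi))
      = map_mx h rho'.
    by rewrite -rhoE; apply/matrixP => i j; rewrite !mxE rd_map.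
  have -> : map_mx (rd K) (map_mx (WOmap (palg_hom_k h)) (map_mx (WOmap (palg_hom_k f)) P))
      = map_mx h psi'.
    by rewrite -psiE; apply/matrixP => i j; rewrite !mxE rd_map.
  apply.
    by rewrite e1; exact: (map_iota (BmapA (palg_hom_k h))).
  have e3 := map_iota (BmapA (palg_hom_k h)) (map_mx (WOmap (palg_hom_k f)) P).
  by rewrite -e3 -e2; exact/esym/map_resB_varpi.
have latE : intM (AtoB R') (map_mx (resB f) phi) ->
    intM (AtoB R') (AtoB R' (varpi R') *: map_mx (resB f) b) ->
    (ps_res f x).1 = lat R' (colspan psi').
  move=> h1 /p2' h2; rewrite xf1 -psiE.
  exact: (latM_latU (d := ldat R') admf h1 h2).
(* Isotropy has to be expressed by [psi], since the projector [e] exists only where the rank is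
   constant. The two matrices are multiples of each other, so the pairing vanishes for both or for
   neither. *)
have formE (e : 'M[R']_n) G : e *m psi' = psi' -> e = psi' *m G -> e *m e = e ->
    frob_perp e *m e = e <-> psi'^T *m antidiag n R' *m map_mx (frob R') psi' = 0.
  move=> e1 e2 ee; rewrite frob_perpE perp_idem_fix; last exact: frob_idem.
  split=> h.
    rewrite -e1 map_mxM trmx_mul !mulmxA -(mulmxA _ (e^T)) -(mulmxA _ (e^T *m _)) h.
    by rewrite mulmx0 mul0mx.
  rewrite e2 map_mxM trmx_mul !mulmxA -(mulmxA _ (psi'^T)) -(mulmxA _ (psi'^T *m _)) h.
  by rewrite mulmx0 mul0mx.
have entE i j : f ((psi^T *m antidiag n R *m map_mx (frob R) psi) i j) =
    (psi'^T *m antidiag n R' *m map_mx (frob R') psi') i j.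
  have <- : map_mx f (psi^T *m antidiag n R *m map_mx (frob R) psi) =
      psi'^T *m antidiag n R' *m map_mx (frob R') psi'.
    by rewrite !map_mxM map_antidiag -map_trmx frob_map.
  by rewrite [RHS]mxE.
split.
  move=> [e [he fe]]; have [ee er e1 e2] := he.
  have i1 : intM (AtoB R') (map_mx (resB f) phi).
    rewrite -[map_mx _ _]scale1r; apply: (@latM_sup (ldat R')) => u hu; rewrite scale1r -xf1 e1.
    by apply: latU_std => //; exact: colspan0.
  have i2 : intM (AtoB R') (AtoB R' (varpi R') *: map_mx (resB f) b).
    by apply: (latM_sub (d := ldat R') admf) => u; rewrite -xf1 e1 => -[c [hc _]]; exists c.
  have [i3 i4] := stdP.1 e2.
  have eqU : colspan e = colspan psi'.
    have := latE i1 i2; rewrite e1 => /(congr1 (latbar (d := ldat R') (n := n))).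
    by rewrite !latUK.
  have [epsi [G eG]] := colspan_eq_factor ee eqU.
  have dK (K : palg D) (h : palg_hom R' K) : is_field K -> hasdim (colspan (map_mx h psi')) s.
    move=> Kf; have <- : colspan (map_mx h e) = colspan (map_mx h psi').
      by apply: (colspan_factor (G := map_mx h G)); rewrite -map_mxM ?epsi -?eG.
    exact: er.
  move=> r [[]|[]].
  - exact: p1.1.
  - exact: p2.1.
  - exact: p3.1.
  - exact: p4.1.
  - move=> [g1 [g2 ->]]; rewrite -det_map_mx map_mxsub -/psi'; apply: field_descent => K h Kf.
    rewrite -det_map_mx map_mxsub; exact: (hasdim_big_minor Kf g1 g2 (dK K h Kf)).
  - move=> [g1 [g2 ->]]; rewrite -det_map_mx map_mxsub -/rho'; apply: field_descent => K h Kf.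
    rewrite -det_map_mx map_mxsub; apply: (hasdim_big_minor Kf).
    exact: (hasdim_exact Kf st (exactK K h i1 i2) (dK K h Kf)).
  - by move=> [i [j ->]]; rewrite entE ((formE e G epsi eG ee).1 fe) mxE.
move=> hI.
have i1 : intM (AtoB R') (map_mx (resB f) phi).
  by apply/p1 => r hr; apply: hI; left; apply: Or41.
have i2 : intM (AtoB R') (AtoB R' (varpi R') *: map_mx (resB f) b).
  by apply/p2 => r hr; apply: hI; left; apply: Or42.
have i3 : intM (AtoB R') (map_mx (resB f) phi2).
  by apply/p3 => r hr; apply: hI; left; apply: Or43.
have i4 : intM (AtoB R') (map_mx (resB f) b2).
  by apply/p4 => r hr; apply: hI; left; apply: Or44.
have rk : const_rank psi' s.
  move=> K h Kf; apply: (hasdim_of_minors Kf st (exactK K h i1 i2)) => g1 g2.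
    rewrite -map_mxsub det_map_mx /psi' -map_mxsub det_map_mx (hI (\det _)) ?rmorph0 //.
    by right; apply: Or31; exists g1, g2.
  rewrite -map_mxsub det_map_mx /rho' -map_mxsub det_map_mx (hI (\det _)) ?rmorph0 //.
  by right; apply: Or32; exists g1, g2.
have [e [G [ee epsi eG]]] := constant_rank_idem rk.
exists e; split; last first.
  apply/(formE e G epsi eG ee); apply/matrixP => i j; rewrite -entE [RHS]mxE.
  by apply: hI; right; apply: Or33; exists i, j.
split=> //.
- move=> K h Kf; have -> : colspan (map_mx h e) = colspan (map_mx h psi').
    by apply: (colspan_factor (G := map_mx h G)); rewrite -map_mxM ?epsi -?eG.
  exact: rk.
- by rewrite (latE i1 i2) (colspan_factor epsi eG).
- exact/stdP.
Qed.
End Isotropic.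

(** * The generic matrix *)

Section Perfection.
Variables (D : base_data) (S : comPzRingType) (j0 : {rmorphism lf_k D -> S}).
Local Notation p := (lf_p D).

Definition frobX m (x : S) : S := x ^+ (p ^ m).

Lemma frobX0 x : frobX 0 x = x.
Proof. by rewrite /frobX expn0 expr1. Qed.

Lemma frobXX l m x : frobX l (frobX m x) = frobX (l + m) x.
Proof. by rewrite /frobX -exprM -expnD addnC. Qed.

Fact frobX_rmorph m : zmod_morphism (frobX m) /\ monoid_morphism (frobX m).
Proof.
apply: rmorph_build => [x y|x y|]; rewrite /frobX ?exprMn ?expr1n //.
elim: m => [|m IH]; first by rewrite !expr1.
rewrite expnSr !exprM IH.
by have [z ->] := binom_p (lf_p_prime D) (x ^+ (p ^ m)) (y ^+ (p ^ m));
  rewrite (charR j0) addr0.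
Qed.
HB.instance Definition _ m := GRing.isZmodMorphism.Build S S (frobX m) (frobX_rmorph m).1.
HB.instance Definition _ m := GRing.isMonoidMorphism.Build S S (frobX m) (frobX_rmorph m).2.

(* [(x, i)] stands for the root of [x] of order [p ^ i] *)
Definition perfeq (x y : S * nat) :=
  exists N, frobX (N + y.2) x.1 = frobX (N + x.2) y.1.

Lemma perfeq_of (x y : S * nat) : frobX y.2 x.1 = frobX x.2 y.1 -> perfeq x y.
Proof. by exists 0%N; rewrite !add0n. Qed.

(** Roots of orders [p ^ i] and [p ^ k] are first rewritten as roots of order [p ^ (i + k)];
    Frobenius being additive, sums and products then take the same form. *)
Definition perfpre : preRing.
Proof.
refine (@PreRing (S * nat)%type perfeq (0, 0%N) (1, 0%N) (fun x => (- x.1, x.2))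
  (fun x y => (frobX y.2 x.1 + frobX x.2 y.1, (x.2 + y.2)%N))
  (fun x y => (frobX y.2 x.1 * frobX x.2 y.1, (x.2 + y.2)%N))
  _ _ _ _ _ _ _ _ _ _ _ _ _ _).
- by move=> x; exact: perfeq_of.
- by move=> x y [N h]; exists N.
- move=> [y j] [x i] [z k] [N /= h] [M /= h']; exists (N + M + j)%N => /=.
  have -> : (N + M + j + k = (M + k) + (N + j))%N by lia.
  have -> : (N + M + j + i = (N + i) + (M + j))%N by lia.
  rewrite -[LHS]frobXX -[RHS]frobXX h -h' !frobXX; congr frobX; lia.
- by move=> [x i] [y j] [N /= h]; exists N; rewrite /= !rmorphN; congr (- _).
- move=> [x i] [x' i'] [y j] [y' j'] [N /= h] [M /= h']; exists (N + M)%N => /=.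
  rewrite !rmorphD /= !frobXX; congr (_ + _).
    have -> : (N + M + (i' + j') + j = (M + j' + j) + (N + i'))%N by lia.
    have -> : (N + M + (i + j) + j' = (M + j' + j) + (N + i))%N by lia.
    by rewrite -[LHS]frobXX -[RHS]frobXX h.
  have -> : (N + M + (i' + j') + i = (N + i + i') + (M + j'))%N by lia.
  have -> : (N + M + (i + j) + i' = (N + i + i') + (M + j))%N by lia.
  by rewrite -[LHS]frobXX -[RHS]frobXX h'.
- move=> [x i] [x' i'] [y j] [y' j'] [N /= h] [M /= h']; exists (N + M)%N => /=.
  rewrite !rmorphM /= !frobXX; congr (_ * _).
    have -> : (N + M + (i' + j') + j = (M + j' + j) + (N + i'))%N by lia.
    have -> : (N + M + (i + j) + j' = (M + j' + j) + (N + i))%N by lia.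
    by rewrite -[LHS]frobXX -[RHS]frobXX h.
  have -> : (N + M + (i' + j') + i = (N + i + i') + (M + j'))%N by lia.
  have -> : (N + M + (i + j) + i' = (N + i + i') + (M + j))%N by lia.
  by rewrite -[LHS]frobXX -[RHS]frobXX h'.
- move=> [x i] [y j] [z k]; apply: perfeq_of => /=; rewrite addnA; congr frobX.
  rewrite !rmorphD /= !frobXX addrA; congr (frobX _ _ + frobX _ _ + frobX _ _); lia.
- by move=> [x i] [y j]; apply: perfeq_of => /=; rewrite addnC addrC.
- by move=> [x i]; apply: perfeq_of => /=; rewrite rmorph0 add0r add0n frobX0.
- by move=> [x i]; apply: perfeq_of => /=; rewrite rmorphN addNr !rmorph0.
- move=> [x i] [y j] [z k]; apply: perfeq_of => /=; rewrite addnA; congr frobX.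
  rewrite !rmorphM /= !frobXX mulrA; congr (frobX _ _ * frobX _ _ * frobX _ _); lia.
- by move=> [x i] [y j]; apply: perfeq_of => /=; rewrite addnC mulrC.
- by move=> [x i]; apply: perfeq_of => /=; rewrite rmorph1 mul1r add0n frobX0.
- move=> [x i] [y j] [z k]; apply: perfeq_of => /=.
  rewrite !(rmorphM, rmorphD, mulrDl) /= !frobXX.
  congr (frobX _ _ * frobX _ _ + frobX _ _ * frobX _ _); lia.
Defined.

Definition perfection : comPzRingType := quot perfpre.
Definition perfroot (x : S) i : perfection := qpi ((x, i) : perfpre).
Definition perfin (x : S) : perfection := perfroot x 0.

Lemma perfrootP x i y k : perfroot x i = perfroot y k <-> perfeq (x, i) (y, k).
Proof. exact: (qpiP ((x, i) : perfpre)). Qed.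

Lemma perfW (P : perfection -> Prop) : (forall x i, P (perfroot x i)) -> forall z, P z.
Proof. by move=> h z; rewrite -(qreprK z); case: (qrepr z) => x i; exact: h. Qed.

Fact perfin_rmorph : zmod_morphism perfin /\ monoid_morphism perfin.
Proof.
apply: rmorph_build => // x y; rewrite /perfin /perfroot ?qpiD ?qpiM /=.
  by rewrite !frobX0.
by rewrite !frobX0.
Qed.
HB.instance Definition _ := GRing.isZmodMorphism.Build S perfection perfin perfin_rmorph.1.
HB.instance Definition _ := GRing.isMonoidMorphism.Build S perfection perfin perfin_rmorph.2.

Lemma perfrootM x y i : perfroot x i * perfroot y i = perfroot (x * y) i.
Proof.
rewrite /perfroot [LHS](qpiM ((x, i) : perfpre)); apply/perfrootP/perfeq_of => /=.
by rewrite -rmorphM /= frobXX.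
Qed.

Lemma perfrootX x i m : perfroot x i ^+ m = perfroot (x ^+ m) i.
Proof.
elim: m => [|m IH]; last by rewrite !exprS IH perfrootM.
rewrite !expr0 -(rmorph1 perfin); apply/perfrootP/perfeq_of => /=.
by rewrite !rmorph1.
Qed.

Lemma perfroot_p x i : perfroot x i.+1 ^+ p = perfroot x i.
Proof.
rewrite perfrootX; apply/perfrootP/perfeq_of => /=.
by rewrite /frobX -exprM -expnS.
Qed.

Lemma perfroot_eq0 x i : perfroot x i = 0 <-> exists m, frobX m x = 0.
Proof.
rewrite -(rmorph0 perfin) perfrootP; split=> [[N /=]|[m h]].
  by rewrite addn0 rmorph0 => e; exists N.
by exists m; rewrite /= addn0 rmorph0.
Qed.

Lemma perfection_perfect : bijective (fun x : perfection => x ^+ p).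
Proof.
apply: expp_bij.
- exact: (charR (perfin \o j0)).
- elim/perfW=> x i; rewrite perfrootX => /perfroot_eq0[m h].
  apply/perfroot_eq0; exists m.+1; rewrite -h /frobX -exprM -expnS //.
- by elim/perfW=> x i; exists (perfroot x i.+1); rewrite perfroot_p.
Qed.

Section Lift.
Variables (T : comPzRingType) (g : {rmorphism S -> T}).
Hypothesis perfT : bijective (fun x : T => x ^+ p).

Lemma exppX_inj m : injective (fun x : T => x ^+ (p ^ m)).
Proof.
elim: m => [|m IH] x y /=; first by rewrite expn0 !expr1.
by rewrite expnSr !exprM => /(bij_inj perfT)/IH.
Qed.

(** A root must go to the root of the image, which exists and is unique in the perfect [T];
    uniqueness also yields compatibility with the operations. *)
Lemma perf_lift : exists h : {rmorphism perfection -> T}, forall x, h (perfin x) = g x.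
Proof.
have root (y : T) m : exists t, t ^+ (p ^ m) = y.
  have [r rK Kr] := perfT; elim: m y => [|m IH] y; first by exists y; rewrite expr1.
  by have [t ht] := IH (r y); exists t; rewrite expnSr exprM ht Kr.
pose h0 (z : perfection) : T := sval (cid (root (g (qrepr z).1) (qrepr z).2)).
have h0E x i : h0 (perfroot x i) ^+ (p ^ i) = g x.
  rewrite /h0; case: cid => t /=; have := qpiK ((x, i) : perfpre).
  rewrite -/(perfroot x i); case: (qrepr _) => y k [N /= e] ht.
  have := congr1 g e; rewrite /frobX !rmorphXn -ht -exprM => e'.
  apply: (@exppX_inj (N + k)%N); rewrite /= -[RHS]e' -exprM -!expnD.
  by congr (_ ^+ (p ^ _)); lia.
have hu x i t : t ^+ (p ^ i) = g x -> h0 (perfroot x i) = t.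
  by move=> e; apply: (@exppX_inj i); rewrite /= h0E e.
have hr : zmod_morphism h0 /\ monoid_morphism h0.
  have chT (z : T) : z *+ p = 0 by exact: (charR (g \o j0)).
  have addX m (x y : T) : (x + y) ^+ (p ^ m) = x ^+ (p ^ m) + y ^+ (p ^ m).
    elim: m => [|m IH]; first by rewrite !expr1.
    rewrite expnSr !exprM IH.
    by have [z ->] := binom_p (lf_p_prime D) (x ^+ (p ^ m)) (y ^+ (p ^ m)); rewrite chT addr0.
  apply: rmorph_build.
  - elim/perfW=> x i; elim/perfW=> y k.
    rewrite {1}/perfroot (qpiD ((x, i) : perfpre)) -/(perfroot _ _); apply: hu => /=.
    rewrite rmorphD addX; congr (_ + _).
      by rewrite [RHS]rmorphXn -(h0E x i) -exprM -expnD.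
    by rewrite [RHS]rmorphXn -(h0E y k) -exprM -expnD addnC.
  - elim/perfW=> x i; elim/perfW=> y k.
    rewrite {1}/perfroot (qpiM ((x, i) : perfpre)) -/(perfroot _ _); apply: hu => /=.
    rewrite rmorphM exprMn; congr (_ * _).
      by rewrite [RHS]rmorphXn -(h0E x i) -exprM -expnD.
    by rewrite [RHS]rmorphXn -(h0E y k) -exprM -expnD addnC.
  - by rewrite -(rmorph1 perfin); apply: hu; rewrite expr1n rmorph1.
pose h : {rmorphism perfection -> T} := HB.pack h0
  (GRing.isZmodMorphism.Build _ _ h0 hr.1) (GRing.isMonoidMorphism.Build _ _ h0 hr.2).
by exists h => x; apply: hu; rewrite expr1.
Qed.
End Lift.

Definition domainlike (R : comPzRingType) := forall x y : R, x * y = 0 -> x = 0 \/ y = 0.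

Lemma perfection_domain : domainlike S -> domainlike perfection.
Proof.
move=> dS.
(* The induction is on an arbitrary exponent and starts at exponent 0, whence the alternative of the
   zero ring. *)
have dX m (x : S) : frobX m x = 0 -> (1 : S) = 0 \/ x = 0.
  rewrite /frobX; elim: (p ^ m)%N => [|l IH]; first by rewrite expr0; left.
  by rewrite exprS => /dS[|/IH]; [right|].
elim/perfW=> x i; elim/perfW=> y k.
rewrite {1}/perfroot (qpiM ((x, i) : perfpre)) -/(perfroot _ _) => /perfroot_eq0[m] /=.
have tr : (1 : S) = 0 -> x = 0 by move=> e; rewrite -[x]mul1r e mul0r.
have x0 : x = 0 -> perfroot x i = 0.
  by move=> ->; apply/perfroot_eq0; exists 0%N; rewrite frobX0.
have y0 : y = 0 -> perfroot y k = 0.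
  by move=> ->; apply/perfroot_eq0; exists 0%N; rewrite frobX0.
rewrite rmorphM /= !frobXX => /dS[] /dX[/tr e|e]; [left|left|left|right]; by [exact: x0|exact: y0].
Qed.
End Perfection.

Module GenericMatrix.
Import mpoly.

Lemma generic_matrix (D : base_data) (n : nat) :
  exists (U : palg D) (G H : 'M[U]_n), [/\ (1 : U) <> 0, domainlike U, G *m H = 1%:M &
    forall (K : palg D) (g h : 'M[K]_n), is_field K -> g *m h = 1%:M ->
      exists f : palg_hom U K, map_mx f G = g].
Proof.
pose kb := bd_kbar D; pose S : comPzRingType := {mpoly kb[n * n]}.
pose cS : {rmorphism kb -> S} := @mpolyC (n * n) kb.
pose jS : {rmorphism lf_k D -> S} := cS \o bd_iota D.
pose P := perfection jS.
pose pin : {rmorphism S -> P} := @perfin D S jS.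
pose U0 := @PAlg D P (pin \o cS) (perfection_perfect jS).
pose X : 'M[S]_n := \matrix_(i, j) ('X_(mxvec_index i j) : {mpoly kb[n * n]}).
have dS : domainlike S.
  move=> x y /eqP; rewrite mulf_eq0.
  by move=> /orP[/eqP ->|/eqP ->]; [left|right].
have dP : domainlike P by exact: perfection_domain.
have ev (T : comPzRingType) (g : 'M[T]_n) (c : {rmorphism kb -> T}) : (1 : T) <> 0 ->
    exists f : {rmorphism S -> T}, (forall a, f (cS a) = c a) /\ map_mx f X = g.
  move=> /eqP T1.
  pose T' : comNzRingType := HB.pack (GRing.ComPzRing.sort T)
    (GRing.ComPzRing.class T) (GRing.PzSemiRing_isNonZero.Build T T1).
  pose c' : {rmorphism kb -> T'} := c.
  pose hm : {rmorphism {mpoly kb[n * n]} -> T'} :=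
    mmap (c' : kb -> T') (fun i : 'I_(n * n) => mxvec g 0 i : T').
  exists hm; split=> [a|]; first exact: (@mmapC (n * n) kb T' _ c' a).
  by apply/matrixP => i j; rewrite !mxE [LHS](@mmapX (n * n) kb T' _ c') mmap1U mxvecE.
(* The determinant takes the value 1 when the variables are specialized to the identity matrix. *)
have dX : \det X <> 0.
  have one0 : (1 : kb) <> 0 by apply/eqP; exact: oner_neq0.
  have [f [_ fX]] := ev kb 1%:M idfun one0.
  move=> /(congr1 f); rewrite -det_map_mx fX det1 rmorph0.
  exact: one0.
have pin0 x : pin x = 0 -> x = 0.
  move=> /perfroot_eq0[m]; rewrite /frobX; elim: (lf_p D ^ m)%N => [|l IH].
    by rewrite expr0 => e; rewrite -[x]mul1r e mul0r.
  by rewrite exprS => /dS[|/IH].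
(* Inverting the determinant after perfecting stays among perfect algebras. The point given by [g]
   then extends by evaluation of the variables, by unique roots, and finally by the inverse of
   [\det g], which is [\det h]. *)
have [U [u [[v hv] u0 uf uU]]] := @palg_localization D U0 (pin (\det X)).
pose um : {rmorphism S -> U} := u \o pin.
have detG : \det (map_mx um X) * v = 1 by rewrite det_map_mx.
have um0 x : um x = 0 -> x = 0.
  move=> /u0[m]; rewrite -rmorphXn -[pin _ * _](rmorphM pin) => /pin0.
  elim: m => [|m IH]; first by rewrite expr0 mul1r.
  by rewrite exprS -mulrA => /dS[/dX|/IH].
exists U, (map_mx um X), (v *: \adj (map_mx um X)); split.
- by rewrite -(rmorph1 um) => /um0 /eqP; rewrite oner_eq0.
- have cancel m z : u (pin (\det X)) ^+ m * z = 0 -> z = 0.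
    move=> h; rewrite -[z]mul1r -(expr1n _ m) -hv exprMn [_ ^+ m * v ^+ m]mulrC.
    by rewrite -mulrA h mulr0.
  move=> x y xy; have [x' [m hx]] := uf x; have [y' [l hy]] := uf y.
  have : u (x' * y') = 0 by rewrite rmorphM -hx -hy mulrACA xy mulr0.
  move=> /u0[q]; rewrite -rmorphXn => e.
  have {}e : (x' * y' : P) = 0.
    have [|//] := dP _ _ e => /pin0; elim: (q) => [|q' IH].
      by rewrite expr0 => /eqP; rewrite oner_eq0.
    by rewrite exprS => /dS[/dX|/IH].
  have [x0|y0] := dP _ _ e; [left|right].
    by apply: (cancel m); rewrite hx x0 rmorph0.
  by apply: (cancel l); rewrite hy y0 rmorph0.
- by rewrite -scalemxAr mul_mx_adj scale_scalar_mx mulrC detG.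
move=> K g h Kf gh.
have [f0 [f0c f0X]] := ev K g (pa_str K) Kf.1.
have [f1 hf1] := perf_lift jS f0 (pa_perfect K).
have f1c c : f1 (pa_str U0 c) = pa_str K c by rewrite -f0c -hf1.
pose f2 : palg_hom U0 K := @PAlgHom D U0 K f1 f1c.
have [|f3 hf3] := uU K f2 (\det h).
  by rewrite [f2 _]hf1 -det_map_mx f0X -det_mulmx gh det1.
exists f3; rewrite -f0X; apply/matrixP => i j; rewrite !mxE.
by rewrite [LHS]hf3 [LHS]hf1.
Qed.
End GenericMatrix.

(** * Two-step flags *)

Section TwoStepFlags.
Variables (D : base_data) (n s1 s2 : nat).
Hypotheses (n_gt0 : (0 < n)%N) (s12 : (s1 + 2 = s2)%N) (s2n : (s2 <= n)%N).
Local Notation lat R := (latU (d := ldat R)).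
Local Notation P2 := (Pt2 D n).

Definition flag_pair : subfunctor P2 := fun R x =>
  exists e1 e2, [/\ flagpt s1 0 e1 x.1, flagpt s2 (-1) e2 x.2 & e2 *m e1 = e1].

Definition std_flag (R : palg D) (g : 'M[R]_n) : ps_pt P2 R :=
  ((lat R (coordspan g (lastp n s1)), scaled_std R 0),
   (lat R (coordspan g (lastp n s2)), scaled_std R (-1))).

Lemma lastp_sub : {subset lastp n s1 <= lastp n s2}.
Proof. by move=> i; rewrite /lastp !unfold_in /=; lia. Qed.

Lemma coord_flag (R : palg D) (g h : 'M[R]_n) s c : g *m h = 1%:M -> (s <= n)%N ->
  flagpt s c (coord_idem g h (lastp n s))
    ((lat R (coordspan g (lastp n s)), scaled_std R c) : ps_pt (Pt D n) R).
Proof.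
move=> gh sn; have hg := mulmx1C gh.
have [ee eE] := coord_idemE (lastp n s) hg.
split=> //; last by rewrite /= eE.
move=> K f Kf.
have -> : map_mx f (coord_idem g h (lastp n s)) =
    coord_idem (map_mx f g) (map_mx f h) (lastp n s).
  rewrite /coord_idem !map_mxM map_diag_mx; congr (_ *m diag_mx _ *m _).
  by apply/rowP => i; rewrite !mxE rmorph_nat.
have [_ <-] := coord_idemE (lastp n s) (invertible_map f hg).
exact: hasdim_lastp (invertible_map f gh) sn.
Qed.

Lemma std_flagP (R : palg D) (g h : 'M[R]_n) : g *m h = 1%:M -> flag_pair (std_flag g).
Proof.
move=> gh; have hg := mulmx1C gh.
exists (coord_idem g h (lastp n s1)), (coord_idem g h (lastp n s2)); split.
- by apply: coord_flag => //; lia.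
- exact: coord_flag.
have [_ E1] := coord_idemE (lastp n s1) hg; have [ee E2] := coord_idemE (lastp n s2) hg.
apply: mx_fixed_colspan => c; apply/(colspan_idem _ ee); rewrite -E2.
by apply: (coordspan_sub lastp_sub); rewrite E1; eexists.
Qed.

Lemma flag_pair_res (R R' : palg D) (f : palg_hom R R') (x : ps_pt P2 R) :
  flag_pair x -> flag_pair (ps_res f x).
Proof.
move=> [e1 [e2 [h1 h2 e]]]; exists (map_mx f e1), (map_mx f e2); split.
- exact: (flagpt_res f h1).
- exact: (flagpt_res f h2).
- by rewrite -map_mxM e.
Qed.

Lemma std_flag_res (R R' : palg D) (f : palg_hom R R') (g h : 'M[R]_n) : g *m h = 1%:M ->
  ps_res f (std_flag g) = std_flag (map_mx f g).
Proof.
move=> gh; have hg := mulmx1C gh.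
have key s c : (s <= n)%N ->
    ps_res f ((lat R (coordspan g (lastp n s)), scaled_std R c) : ps_pt (Pt D n) R) =
    (lat R' (coordspan (map_mx f g) (lastp n s)), scaled_std R' c).
  move=> sn; have h1 := flagpt_res f (coord_flag c gh sn).
  rewrite [LHS]surjective_pairing (fp_lat h1) (fp_scale h1); congr (lat R' _, _).
  have -> : map_mx f (coord_idem g h (lastp n s)) =
      coord_idem (map_mx f g) (map_mx f h) (lastp n s).
    rewrite /coord_idem !map_mxM map_diag_mx; congr (_ *m diag_mx _ *m _).
    by apply/rowP => i; rewrite !mxE rmorph_nat.
  by have [_ <-] := coord_idemE (lastp n s) (invertible_map f hg).
have sn1 : (s1 <= n)%N by lia.
by congr (_, _); [exact: (key s1 0 sn1)|exact: (key s2 (-1) s2n)].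
Qed.

Lemma field_flag_pair (K : palg D) (x : ps_pt P2 K) : is_field K -> flag_pair x ->
  exists g h : 'M[K]_n, g *m h = 1%:M /\ x = std_flag g.
Proof.
move=> Kf [e1 [e2 [h1 h2 e]]].
have sub : colspan e1 `<=` colspan e2.
  by move=> _ [c ->]; exists (e1 *m c); rewrite mulmxA e.
have [g [h [gh g1 g2]]] :=
  fieldlike_flag Kf (flagpt_field Kf h1) (flagpt_field Kf h2) sub.
exists g, h; split=> //.
rewrite [x]surjective_pairing [x.1]surjective_pairing [x.2]surjective_pairing.
by rewrite (fp_lat h1) (fp_scale h1) (fp_lat h2) (fp_scale h2) g1 g2.
Qed.

(** Restriction takes the span of the image, so even along the identity it fixes only sets that are
    already submodules. *)
Lemma ps_res_id (R : palg D) (x : ps_pt (Pt D n) R) : Gr x -> ps_res (hom_id R) x = x.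
Proof.
move=> [/latticeP[m [b [phi [hb x1]]]] /latticeP[m2 [b2 [phi2 [hb2 x2]]]]].
have idE p q (M : 'M[Bring R]_(p, q)) : map_mx (resB (hom_id R)) M = M.
  by apply/matrixP => i j; rewrite mxE resB_id.
rewrite [RHS]surjective_pairing; congr (_, _).
  rewrite x1; apply: etrans (base_change_adm (palg_hom_k (hom_id R)) hb) _.
  by congr latM; exact: idE.
rewrite x2; apply: etrans (base_change_adm (palg_hom_k (hom_id R)) hb2) _.
by congr latM; exact: idE.
Qed.

Lemma flag_pair_irreducible : irreducible_in flag_pair flag_pair.
Proof.
have [U [G [H [U1 dU GH GU]]]] := GenericMatrix.generic_matrix D n.
have hG := std_flagP GH.
split.
- split=> // R x hx; exists set0 => R' f; split=> // _; exact: flag_pair_res.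
- have [K [f [Kf _]]] := field_point U1.
  by exists K, (ps_res f (std_flag G)); split=> //; exact: flag_pair_res.
move=> Z1 Z2 [Z1s Z1c] [Z2s Z2c] cov.
have [I1 hI1] := Z1c U _ hG; have [I2 hI2] := Z2c U _ hG.
(* Every flag over a perfect field is a specialization of the generic one. A closed subset
   containing the generic flag thus contains all of these, its equations at any flag vanish at all
   perfect fields, and so they vanish. *)
have key (Z : subfunctor P2) (I : set U) : closed_in flag_pair Z ->
    (forall R' (f : palg_hom U R'), Z R' (ps_res f (std_flag G)) <-> (forall a, I a -> f a = 0)) ->
    (forall a, I a -> a = 0) -> subfun flag_pair Z.
  move=> [_ Zc] hI I0 R x hx; have [I' hI'] := Zc R x hx.
  have : Z R (ps_res (hom_id R) x).
    apply/hI' => a Ia; apply: field_descent => K f Kf; apply: (hI' K f).1 Ia.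
    have [g [h [gh ->]]] := field_flag_pair Kf (flag_pair_res f hx).
    have [f' <-] := GU K g h Kf gh.
    rewrite -(std_flag_res f' GH); apply/hI => a' /I0 ->; exact: rmorph0.
  have [e1 [e2 [h1 h2 _]]] := hx.
  have -> // : ps_res (hom_id R) x = x.
  rewrite [RHS]surjective_pairing -[in RHS](ps_res_id (flagpt_Gr h1)).
  by rewrite -[in RHS](ps_res_id (flagpt_Gr h2)).
(* Nonzero equations [a1] of [Z1] and [a2] of [Z2] at the generic flag have a nonzero product, as
   [U] is a domain; a field point where the product survives gives a flag outside both. *)
have [I10|/existsNP[a1 /not_implyP[Ia1 a10]]] := pselect (forall a, I1 a -> a = 0).
  by left; exact: key I10.
right; apply: (key Z2 I2) => // a2 Ia2.
have [//|a20] := pselect (a2 = 0).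
have a12 : a1 * a2 <> 0 by move=> /dU[].
have [K [f [Kf fa]]] := field_point a12; exfalso; apply: fa; rewrite rmorphM.
have [/hI1 h|/hI2 h] := cov K _ Kf (flag_pair_res f hG).
  by rewrite h // mul0r.
by rewrite (h a2) // mulr0.
Qed.

Lemma Gr0_flag_pair r : r.-1 = s1 -> (n - s1 = s2)%N -> forall R (x : ps_pt P2 R),
  Gr0 r x <-> flag_pair x.
Proof.
move=> rs ns R x; rewrite /Gr0 star_nu ?rs; last by lia.
rewrite star_mu; last by lia.
rewrite nu_star_tau ?rs; last by lia.
rewrite ns; split.
  move=> [/(Gr_le_flagpt _ _ n_gt0) h1 _ h2 /(Gr_le_flagpt _ _ n_gt0) h3].
  have [|e1 he1] := h1; first by lia.
  have [|e2 he2] := h3; first by lia.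
  exists e1, e2; split=> //; apply/(exact_flag_pair s12 s2n he1 he2).
  by apply/(bounded_exact _ _ _ n_gt0) => //; lia.
move=> [e1 [e2 [h1 h2 e]]]; split.
- by apply/Gr_le_flagpt => //; [lia|exists e1].
- exact: flagpt_Gr h2.
- by apply/bounded_exact => //; [lia|apply/(exact_flag_pair s12 s2n h1 h2)].
- by apply/Gr_le_flagpt => //; exists e2.
Qed.

Lemma Gr0_open_flag_pair r : r.-1 = s1 -> (n - s1 = s2)%N -> forall R (x : ps_pt P2 R),
  Gr0_open r x <-> flag_pair x.
Proof.
move=> rs ns R x; rewrite -(Gr0_flag_pair rs ns) /Gr0_open /Gr0 star_nu ?rs; last by lia.
rewrite star_mu; last by lia.
rewrite nu_star_tau ?rs; last by lia.
have sn1 : (s1 <= n)%N by lia.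
have two : (2 <= n)%N by lia.
have sn2 : (n - s1 <= n)%N by lia.
have leq s c (y : ps_pt (Pt D n) R) : (s <= n)%N ->
    Gr_eq (mlast n s c) y <-> Gr_le (mlast n s c) y.
  by move=> sn; rewrite Gr_eq_flagpt // Gr_le_flagpt.
split=> -[h1 h2 h3 h4]; split=> //; by [apply/leq|apply/bounded_exact].
Qed.
End TwoStepFlags.

(** * The component, its fiber product and the Deligne-Lusztig variety *)

Lemma irr_component_self (D : base_data) (P : presheaf D) (X C : subfunctor P) :
  irreducible_in X X -> irr_component X C -> forall R x, C R x <-> X R x.
Proof.
move=> irrX [[[CX _] _ _] maxC] R x; split; first exact: CX.
exact: (maxC X irrX CX).
Qed.

Lemma irreducible_iff (D : base_data) (P : presheaf D) (X Y : subfunctor P) :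
  (forall R x, X R x <-> Y R x) -> irreducible_in X X -> irreducible_in Y Y.
Proof.
by move=> XY; have -> : X = Y
  by apply: functional_extensionality_dep => R; apply/seteqP; split=> x /XY.
Qed.

Lemma flagpt_colspan (D : base_data) n (R : palg D) s s' c c' e e' (x : ps_pt (Pt D n) R) :
  flagpt s c e x -> flagpt s' c' e' x -> colspan e = colspan e'.
Proof.
move=> h h'; have := fp_lat h; rewrite (fp_lat h').
by move=> /(congr1 (latbar (d := ldat R) (n := n))); rewrite !latUK.
Qed.

Section Main.
Variables (D : base_data) (n : nat).
Hypotheses (n_gt0 : (0 < n)%N) (n_even : ~~ odd n).
Local Notation r := (n./2).
Local Notation s1 := (r.-1).
Local Notation lat R := (latU (d := ldat R)).
Variable C : subfunctor (Pt2 D n).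
Hypothesis C_comp : irr_component (Gr0 r) (@C).

(** Equivalently [s1 + 2 = n - s1]: the rank prescribed for the second lattice is the rank of the
    orthogonal of the first subspace. *)
Fact half_even : (s1 + s1 + 2 = n)%N.
Proof. by have := odd_double_half n; rewrite (negbTE n_even); lia. Qed.

Lemma component_all R (x : ps_pt (Pt2 D n) R) : @C R x <-> Gr0 r x.
Proof.
have e := half_even.
apply: (irr_component_self _ C_comp).
have e1 : (s1 + 2 = n - s1)%N by lia.
have e2 : (n - s1 <= n)%N by lia.
apply: (irreducible_iff _ (flag_pair_irreducible D n_gt0 e1 e2)) => S y.
by have := Gr0_flag_pair n_gt0 e1 e2 (r := r) erefl erefl y; tauto.
Qed.

Lemma Xb_open_isotropic R (x : ps_pt (Pt D n) R) : Xb_open r (@C) x <-> isotropic_pt s1 x.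
Proof.
have e := half_even.
have e1 : (s1 + 2 = n - s1)%N by lia.
have e2 : (n - s1 <= n)%N by lia.
have sn : (s1 <= n)%N by lia.
have openP := Gr0_open_flag_pair n_gt0 e1 e2 (r := r) erefl erefl.
have allP := Gr0_flag_pair n_gt0 e1 e2 (r := r) erefl erefl.
rewrite /Xb_open star_nu // Gr_eq_flagpt //; split.
  move=> [[a ha] [_ /openP[b [c [hb hc bc]]]]].
  exists b; split; [exact: hb|apply/(frob_perp_sub (fp_idem hb))].
  (* The flag comes with its own projector [c] for the twisted lattice; a lattice determines its
     subspace, so [c] and [frob_perp b] have the same image. *)
  rewrite (flagpt_colspan (frob_tau_flagpt sn hb) hc) => _ [u ->].
  by exists (b *m u); rewrite mulmxA bc.
move=> [a [ha fa]]; split; first by exists a.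
have hp : flag_pair s1 (n - s1) ((x, frob_tau x) : ps_pt (Pt2 D n) R).
  exists a, (frob_perp a); split; [exact: ha|exact: (frob_tau_flagpt sn ha)|exact: fa].
by split; [apply/component_all/allP|apply/openP].
Qed.

Lemma Xb_isotropic R (x : ps_pt (Pt D n) R) : Xb r (@C) x <-> isotropic_pt s1 x.
Proof.
have e := half_even.
have st : (s1 + (n - s1) = n)%N by lia.
have YX : subfun (@isotropic_pt D n s1) (X_mu_tau (D := D) (n := n)).
  by move=> S y; exact: isotropic_X_mu_tau.
split=> [[_ h]|h].
  apply: h => [|S y /Xb_open_isotropic //].
  by apply: (isotropic_closed st n_gt0) => // S y [].
split; first exact: YX.
by move=> Z _ XZ; apply: XZ; apply/Xb_open_isotropic.
Qed.

(** The map keeps only the subspace of the first component; no information is lost, since the second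
    component of a point is the standard lattice. *)
Lemma isotropic_DL : isomorphic (Xb r (@C)) (@DL D n s1).
Proof.
exists (fun R x => latbar (d := ldat R) x.1); split.
- move=> R x /Xb_isotropic[e [[ee er e1 e2] fe]]; rewrite e1 latUK; split.
    by apply/subbundleE; exists e.
  by rewrite F_perp_colspan //; exact/frob_perp_sub.
- move=> R x x' /Xb_isotropic[e [h _]] /Xb_isotropic[e' [h' _]].
  rewrite [x]surjective_pairing [x']surjective_pairing (fp_lat h) (fp_lat h').
  by rewrite (fp_scale h) (fp_scale h') /= !latUK => ->.
- move=> R U [/subbundleE[e [ee eU er]]]; rewrite eU F_perp_colspan // => sub.
  exists ((lat R (colspan e), scaled_std R 0) : ps_pt (Pt D n) R); last first.
    exact: (@latUK (ldat R) n (colspan e)).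
  by apply/Xb_isotropic; exists e; split=> //; exact/frob_perp_sub.
move=> R R' f x /Xb_isotropic[e [h _]].
rewrite (fp_lat (flagpt_res f h)) (fp_lat h) !latUK; exact/esym/colspan_map.
Qed.
End Main.

Theorem proposition8p3 (D : base_data) (n : nat)
    (n_gt0 : (0 < n)%N) (n_even : ~~ odd n)
    (C : subfunctor (Pt2 D n)) (d : nat)
    (C_comp : irr_component (Gr0 (n./2)) C)
    (C_dim : krull_dim (Gr0 (n./2)) C d)
    (d_eq : d.*2%:Z =
      two_rho (star (nu n (n./2)) + star (mu n) + nu n (n./2) + star (tau n))) :
  (forall (R : palg D) (x : ps_pt (Pt D n) R),
     Xb (n./2) C x <->
     Gr_le (star (nu n (n./2))) x /\
     (forall v, x.1 v -> F_dual x.1 (piz R 1 *: v))) /\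
  isomorphic (Xb (n./2) C) (@DL D n (n./2).-1).
Proof.
have e := half_even n_gt0 n_even.
split; last exact: (isotropic_DL n_gt0 n_even C_comp).
move=> R x; rewrite star_nu; last by lia.
rewrite -isotropic_ptE //; last by lia.
exact: (Xb_isotropic n_gt0 n_even C_comp).
Qed.
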